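(* Let $L=\Delta+V$ and let $\Phi:[0,+\infty)\to\mathbb{C}$ be a bounded Borel function. If there exists a finite complex Borel measure $\alpha$ on $[0,+\infty)$ such that for every $x\in[0,+\infty)$ $$\Phi(x)=\int_0^{+\infty}\left(1-\frac{m}{\sqrt{m^2+x}}\right)d\alpha(m),$$ then for every $p>1$ and $f\in L^p(M,\mu)$, $$\|\Phi(-L)f\|_p\le 6(p^*-1)\,|\alpha|([0,+\infty))\,\|f\|_p,$$ where $p^*=\max\{p,\frac{p}{p-1}\}$. If $V\equiv0$, this bound can be improved to $$\|\Phi(-L)f\|_p\le 2(p^*-1)\,|\alpha|([0,+\infty))\,\|f\|_p.$$
   Context: $M$ is a smooth manifold and $\Delta$ a diffusion operator on $M$: in local charts $\Delta=\sum\sigma_{ij}\partial_{x_i}\partial_{x_j}+\sum c_i\partial_{x_i}$ with smooth real coefficients and $(\sigma_{ij})$ symmetric nonnegative. $\Delta$ is locally subelliptic: every point has a relatively compact coordinate neighbourhood $\Omega$ with constants $C,\varepsilon>0$ such that $\|u\|_{H^\varepsilon}^2\le C(|\int u\Delta u|+\|u\|_{L^2}^2)$ for $u\in C_0^\infty(\Omega)$. Put $\Gamma(f,g)=\frac12(\Delta(fg)-f\Delta g-g\Delta f)$, $\Gamma(f)=\Gamma(f,f)$. $\Delta$ is symmetric on $C_0^\infty(M)$ with respect to a smooth measure $\mu$, and $M$ is complete for the distance $d(x,y)=\sup\{|f(x)-f(y)|: f\in C^\infty(M),\ \|\Gamma(f)\|_\infty\le1\}$. $\Delta$ generates a non-explosive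 diffusion process. $V:M\to\mathbb{R}$ is smooth, non-positive and bounded below. $L=\Delta+V$ is essentially self-adjoint on $C_0^\infty(M)$ in $L^2(M,\mu)$; its self-adjoint extension is still denoted $L$. $\Phi(-L)$ is defined on $L^2(M,\mu)$ by the spectral theorem; the conclusion means that the inequality holds on $L^2\cap L^p$, so that $\Phi(-L)$ extends to a bounded operator on $L^p$ satisfying it. $|\alpha|$ is the total variation measure and $\|\cdot\|_p$ the norm of $L^p(M,\mu)$. In the integrand, $\frac{m}{\sqrt{m^2+x}}$ is read as $0$ when $m=0$ (including at $x=0$). *)

(* Defs.v *)
From HB Require Import structures.
From mathcomp Require Import all_boot all_order all_algebra.
From mathcomp Require Import all_classical all_reals all_analysis.
From mathcomp Require Import measurable_realfun complex.
Import Order.TTheory GRing.Theory Num.Theory.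
Import ComplexField.Normc.
Import numFieldTopology.Exports numFieldNormedType.Exports.

Set Implicit Arguments.
Unset Strict Implicit.
Unset Printing Implicit Defensive.

Local Open Scope classical_set_scope.
Local Open Scope ring_scope.
Local Open Scope complex_scope.

(** * Calculus on R^n *)

Section Euclidean.
Variables (R : realType).

Definition basis_vec n (i : 'I_n) : 'rV[R]_n := delta_mx 0 i.

Definition partial n (i : 'I_n) (g : 'rV[R]_n -> R) : 'rV[R]_n -> R :=
  fun x => 'D_(basis_vec i) g x.

Fixpoint Ck_on (k : nat) n (U : set 'rV[R]_n) (g : 'rV[R]_n -> R) : Prop :=
  (forall x, U x -> {for x, continuous g}) /\
  (if k is k'.+1 then
     forall i : 'I_n, (forall x, U x -> derivable g x (basis_vec i)) /\
                      Ck_on k' U (partial i g)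
   else True).

(* Used for open U only. *)
Definition smooth_on n (U : set 'rV[R]_n) (g : 'rV[R]_n -> R) : Prop :=
  forall k, Ck_on k U g.

(* Integration against Lebesgue measure on R^n as an iterated integral.
   By Tonelli and Fubini this is the Lebesgue integral when F is Borel and
   either nonnegative or continuous with compact support; it is used in these
   two cases only. *)
Fixpoint leb_int (n : nat) : ('rV[R]_n -> \bar R) -> \bar R :=
  match n with
  | 0 => fun F => F 0
  | n'.+1 => fun F =>
      (\int[lebesgue_measure]_(t in [set: R])
         leb_int (fun v : 'rV[R]_n' =>
           F (row_mx (const_mx t : 'rV[R]_1) v : 'rV[R]_(1 + n'))))%E
  end.

Definition leb_intr n (g : 'rV[R]_n -> R) : R :=
  fine (leb_int (fun x => (g x)%:E)).

Definition dotp n (x y : 'rV[R]_n) : R := \sum_(i < n) x 0 i * y 0 i.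

(* |u^(xi)|^2 for u^(xi) = \int e^{- 2 i pi x.xi} u(x) dx and u real. *)
Definition fourier_sq n (u : 'rV[R]_n -> R) (xi : 'rV[R]_n) : R :=
  leb_intr (fun x => cos (2 * pi * dotp x xi) * u x) ^+ 2 +
  leb_intr (fun x => sin (2 * pi * dotp x xi) * u x) ^+ 2.

(* Squared norm of the Sobolev space H^s(R^n). *)
Definition sobolev_sq n (s : R) (u : 'rV[R]_n -> R) : \bar R :=
  leb_int (fun xi => ((1 + dotp xi xi) `^ s * fourier_sq u xi)%:E).

End Euclidean.

(** * Smooth manifolds and diffusion operators *)

(* The values of the two maps outside chart_dom and its image are irrelevant. *)
Record chart (R : realType) (M : topologicalType) (n : nat) := Chart {
  chart_dom : set M ;
  chart_map : M -> 'rV[R]_n ;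
  chart_inv : 'rV[R]_n -> M }.

Section Manifold.
Variables (R : realType) (M : ptopologicalType) (n : nat).
Local Notation chart := (chart R M n).
Implicit Types (c : chart) (A : set chart) (f g u : M -> R).

Definition chart_img c : set 'rV[R]_n := chart_map c @` chart_dom c.

Definition is_chart c : Prop :=
  [/\ open (chart_dom c),
      open (chart_img c),
      (forall x, chart_dom c x -> chart_inv c (chart_map c x) = x),
      (forall x, chart_dom c x -> {for x, continuous (chart_map c)}) &
      (forall y, chart_img c y -> {for y, continuous (chart_inv c)})].

Definition smooth_transition c1 c2 : Prop :=
  forall i : 'I_n,
    smooth_on (chart_map c1 @` (chart_dom c1 `&` chart_dom c2))
              (fun y => chart_map c2 (chart_inv c1 y) 0 i).

Definition compatible c1 c2 : Prop :=
  smooth_transition c1 c2 /\ smooth_transition c2 c1.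

(* A is a maximal smooth atlas on the Hausdorff, second countable space M. *)
Definition smooth_manifold A : Prop :=
  [/\ hausdorff_space M /\ @second_countable M,
      (forall c, A c -> is_chart c),
      (forall x, exists2 c, A c & chart_dom c x),
      (forall c1 c2, A c1 -> A c2 -> compatible c1 c2) &
      (forall c, is_chart c -> (forall c', A c' -> compatible c c') -> A c)].

Definition smooth A f : Prop :=
  forall c, A c -> smooth_on (chart_img c) (f \o chart_inv c).

Definition supp f : set M := closure [set x | f x != 0].

Definition test_function A f : Prop := smooth A f /\ compact (supp f).

Definition psd_mx (S : 'M[R]_n) : Prop :=
  S^T = S /\ forall v : 'rV[R]_n, 0 <= (v *m S *m v^T) 0 0.

(* Only the values of Delta on smooth functions are meaningful. *)
Definition diffusion_operator A (Delta : (M -> R) -> M -> R) : Prop :=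
  forall c, A c ->
  exists (sigma : 'rV[R]_n -> 'M[R]_n) (b : 'rV[R]_n -> 'rV[R]_n),
  [/\ (forall i j, smooth_on (chart_img c) (fun y => sigma y i j)),
      (forall i, smooth_on (chart_img c) (fun y => b y 0 i)),
      (forall y, chart_img c y -> psd_mx (sigma y)) &
      forall f, smooth A f -> forall y, chart_img c y ->
        let F := f \o chart_inv c in
        Delta f (chart_inv c y) =
          \sum_(i < n) \sum_(j < n) sigma y i j * partial i (partial j F) y
          + \sum_(i < n) b y 0 i * partial i F y].

Definition read_in_chart c u : 'rV[R]_n -> R :=
  fun y => u (chart_inv c y) * \1_(chart_img c) y.

(* The integrals and the L^2 norm are those of Lebesgue measure in the
   coordinates of the neighbourhood. *)
Definition locally_subelliptic A (Delta : (M -> R) -> M -> R) : Prop :=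
  forall x : M, exists c, exists C eps : R,
  [/\ A c /\ chart_dom c x,
      compact (closure (chart_dom c)),
      0 < C, 0 < eps &
      forall u, test_function A u -> supp u `<=` chart_dom c ->
        (sobolev_sq eps (read_in_chart c u) <=
         (C * (`| leb_intr (read_in_chart c (fun z => u z * Delta u z)) |
               + leb_intr (read_in_chart c (fun z => u z ^+ 2))))%:E)%E].

Definition carre_du_champ (Delta : (M -> R) -> M -> R) f g : M -> R :=
  fun x => 2^-1 * (Delta (fun z => f z * g z) x - f x * Delta g x - g x * Delta f x).

Definition borel : Type := g_sigma_algebraType (@open M).
HB.instance Definition _ := Measurable.on borel.

Variable mu : {measure set borel -> \bar R}.

Definition smooth_measure A : Prop :=
  forall c, A c -> exists rho : 'rV[R]_n -> R,
  [/\ smooth_on (chart_img c) rho,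
      (forall y, chart_img c y -> 0 < rho y) &
      forall B : set borel, measurable B -> B `<=` chart_dom c ->
        mu B = leb_int (fun y => (rho y * \1_(chart_map c @` B) y)%:E)].

Definition symmetric_on_tests A (Delta : (M -> R) -> M -> R) : Prop :=
  forall f g, test_function A f -> test_function A g ->
    \int[mu]_x (f x * Delta g x) = \int[mu]_x (Delta f x * g x).

Definition intrinsic_dist A (Delta : (M -> R) -> M -> R) (x y : M) : \bar R :=
  ereal_sup [set (`| f x - f y |)%:E | f in
    [set f | smooth A f /\
      (Lnorm mu +oo (fun z => (carre_du_champ Delta f f z)%:E) <= 1)%E]].

Definition complete_for (dist : M -> M -> \bar R) : Prop :=
  forall u : nat -> M,
    (forall e : R, 0 < e -> exists N, forall i j, (N <= i)%N -> (N <= j)%N ->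
       (dist (u i) (u j) < e%:E)%E) ->
    exists l, forall e : R, 0 < e -> exists N, forall i, (N <= i)%N ->
       (dist (u i) l < e%:E)%E.

(* sigma(X_r, 0 <= r <= s) *)
Definition natural_filtration (Om : Type) (X : R -> Om -> M) (s : R) :
    set (set Om) :=
  <<s [set E | exists r (B : set borel),
         [/\ 0 <= r <= s, measurable B & E = X r @^-1` B]] >>.

(* The family (P x) and the process X form a Markov process with continuous
   paths and infinite life time, started at x under P x, which solves the
   martingale problem for Delta on C_0^infty(M). *)
Definition nonexplosive_diffusion A (Delta : (M -> R) -> M -> R) : Prop :=
  exists (d : measure_display) (Om : measurableType d)
         (P : R.-pker borel ~> Om) (X : R -> Om -> borel),
  [/\ (forall w, {within `[0, +oo[, continuous (fun t => X t w : M)}) /\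
      (forall t, 0 <= t -> measurable_fun setT (X t)),
      (forall x, {ae P x, forall w, X 0 w = x}),
      (forall x s t E (B : set borel), 0 <= s -> 0 <= t ->
         natural_filtration X s E -> measurable B ->
         (P x (E `&` X (s + t)%R @^-1` B) =
          \int[P x]_(w in E) P (X s w) (X t @^-1` B))%E) &
      (forall f, test_function A f -> forall x s t E, 0 <= s <= t ->
         natural_filtration X s E ->
         \int[P x]_(w in E) (f (X t w) - f (X s w)
           - \int[lebesgue_measure]_(r in `[s, t]) Delta f (X r w)) = 0)].

End Manifold.

(** * Complex L^p spaces and unbounded operators *)

Section ComplexIntegral.
Context {d} {T : measurableType d} {R : realType}.
Implicit Types (mu : {measure set T -> \bar R}) (f g : T -> R[i]).

Definition cmeasurable (D : set T) f : Prop :=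
  measurable_fun D (fun x => complex.Re (f x)) /\
  measurable_fun D (fun x => complex.Im (f x)).

Definition cintegral mu (D : set T) f : R[i] :=
  (\int[mu]_(x in D) complex.Re (f x)) +i*
  (\int[mu]_(x in D) complex.Im (f x)).

Definition cLnorm mu (p : \bar R) f : \bar R :=
  Lnorm mu p (fun x => (normc (f x))%:E).

Definition in_Lp mu (p : \bar R) f : Prop :=
  cmeasurable setT f /\ (cLnorm mu p f < +oo)%E.

Definition inner mu f g : R[i] := cintegral mu setT (fun x => f x * (g x)^*).

End ComplexIntegral.

(* An unbounded operator on L^2(T, mu; C) is given by its graph, a set of pairs
   of representatives. *)
Section Operators.
Context {d} {T : measurableType d} {R : realType}.
Variable mu : {measure set T -> \bar R}.
Local Notation cfun := (T -> R[i]).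
Local Notation L2 := (in_Lp mu 2%:E).
Implicit Types (G : set (cfun * cfun)) (f g h : cfun).

Definition L2_cvg (u : nat -> cfun) f : Prop :=
  (fun k => cLnorm mu 2%:E (fun x => u k x - f x)) @ \oo --> 0%E.

Definition operator_L2 G : Prop := forall f g, G (f, g) -> L2 f /\ L2 g.

Definition densely_defined G : Prop :=
  forall f, L2 f -> exists u : nat -> cfun,
    (forall k, exists g, G (u k, g)) /\ L2_cvg u f.

Definition symmetric_op G : Prop :=
  forall f g h k, G (f, g) -> G (h, k) -> inner mu g h = inner mu f k.

Definition closure_op G : set (cfun * cfun) :=
  [set p | [/\ L2 p.1, L2 p.2 & exists u : nat -> cfun * cfun,
     [/\ forall k, G (u k), L2_cvg (fun k => (u k).1) p.1
       & L2_cvg (fun k => (u k).2) p.2]]].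

Definition adjoint_op G : set (cfun * cfun) :=
  [set p | [/\ L2 p.1, L2 p.2 &
     forall f g, G (f, g) -> inner mu g p.1 = inner mu f p.2]].

Definition self_adjoint G : Prop := densely_defined G /\ adjoint_op G = G.

Definition essentially_self_adjoint G : Prop :=
  [/\ operator_L2 G, densely_defined G, symmetric_op G
    & self_adjoint (closure_op G)].

Definition opp_op G : set (cfun * cfun) :=
  [set p | G (p.1, fun x => - p.2 x)].

Definition linear_L2 (S : cfun -> cfun) : Prop :=
  (forall f, L2 f -> L2 (S f)) /\
  (forall (a : R[i]) f g, L2 f -> L2 g ->
     {ae mu, forall x, S (fun y => a * f y + g y) x = a * S f x + S g x}).

(* A projection-valued Borel measure on R: resolution E B is an orthogonal
   projection of L^2, and scalar_measure E f is the positive measure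
   B |-> <E(B) f, f>. *)
Record resolution_of_identity := ResolutionOfIdentity {
  resolution :> set R -> cfun -> cfun ;
  scalar_measure : cfun -> {measure set (measurableTypeR R) -> \bar R} ;
  resolution_linear : forall B : set (measurableTypeR R), measurable B ->
    linear_L2 (resolution B) ;
  resolution_symm : forall B : set (measurableTypeR R), measurable B ->
    forall f g, L2 f -> L2 g ->
    inner mu (resolution B f) g = inner mu f (resolution B g) ;
  resolutionI : forall B C : set (measurableTypeR R),
    measurable B -> measurable C -> forall f, L2 f ->
    {ae mu, forall x, resolution (B `&` C) f x
                      = resolution B (resolution C f) x} ;
  resolutionT : forall f, L2 f -> {ae mu, forall x, resolution setT f x = f x} ;
  scalar_measureE : forall f (B : set (measurableTypeR R)), L2 f ->
    measurable B ->
    scalar_measure f B = (complex.Re (inner mu (resolution B f) f))%:E }.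

(* G = \int x dE(x), with domain { f | \int x^2 d<E(x) f, f> < +oo }. *)
Definition spectral_resolution_of G (E : resolution_of_identity) : Prop :=
  forall f, L2 f ->
    ((exists g, G (f, g)) <->
       (\int[scalar_measure E f]_x (x ^+ 2)%:E < +oo)%E) /\
    (forall g, G (f, g) ->
       inner mu g f = (\int[scalar_measure E f]_x x)%:C).

(* S = \int_D Phi dE; the quadratic form determines the linear map S almost
   everywhere, by polarization. *)
Definition spectral_integral (E : resolution_of_identity) (D : set R)
    (Phi : R -> R[i]) (S : cfun -> cfun) : Prop :=
  linear_L2 S /\
  forall f, L2 f -> inner mu (S f) f = cintegral (scalar_measure E f) D Phi.

(* S = Phi(G), for G self-adjoint with spectrum in D and Phi bounded Borel on
   D. *)
Definition functional_calculus G (D : set R) (Phi : R -> R[i])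
    (S : cfun -> cfun) : Prop :=
  exists E, spectral_resolution_of G E /\ spectral_integral E D Phi S.

End Operators.

(** * Complex measures *)

Section ComplexMeasures.
Variable R : realType.
Local Notation RB := (measurableTypeR R).

(* Real and imaginary parts; charges are finite by definition. *)
Record complex_measure := ComplexMeasure {
  cm_re : {charge set RB -> \bar R} ;
  cm_im : {charge set RB -> \bar R} }.

Definition cm_value (a : complex_measure) (B : set R) : R[i] :=
  fine (cm_re a B) +i* fine (cm_im a B).

Definition cm_variation (a : complex_measure) (B : set R) : \bar R :=
  ereal_sup [set v | exists F : nat -> set RB,
    [/\ forall i, measurable (F i), trivIset setT F, \bigcup_i F i = B
      & v = (\sum_(0 <= i <oo) (normc (cm_value a (F i)))%:E)%E]].

(* Difference of the integrals for the two parts of the Jordan decomposition. *)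
Definition charge_integral (nu : {charge set RB -> \bar R}) (D : set R)
    (h : R -> R) : R :=
  let Hn := cid (projT2 (cid (Hahn_decomposition nu))) in
  \int[jordan_pos (projT2 Hn)]_(x in D) h x
  - \int[jordan_neg (projT2 Hn)]_(x in D) h x.

Definition cm_integral (a : complex_measure) (D : set R) (h : R -> R) : R[i] :=
  charge_integral (cm_re a) D h +i* charge_integral (cm_im a) D h.

End ComplexMeasures.

(** * The Schroedinger operator *)

Section Schroedinger.
Variables (R : realType) (M : ptopologicalType) (n : nat).
Variables (A : set (chart R M n)) (Delta : (M -> R) -> M -> R) (V : M -> R).

Definition schroedinger (f : M -> R) : M -> R := fun x => Delta f x + V x * f x.

(* Graph of the complex-linear extension of Delta + V to C_0^infty(M; C). *)
Definition schroedinger_core : set ((borel M -> R[i]) * (borel M -> R[i])) :=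
  [set p | exists a b : M -> R,
    [/\ test_function A a, test_function A b,
        p.1 = (fun x => a x +i* b x) &
        p.2 = (fun x => schroedinger a x +i* schroedinger b x)]].

End Schroedinger.

(* Main.v *)
From HB Require Import structures.
Require Import Defs.
From mathcomp Require Import all_boot all_order all_algebra.
From mathcomp Require Import all_classical all_reals all_analysis.
From mathcomp Require Import measurable_realfun complex.
From mathcomp Require Import ring lra.
Import Order.TTheory GRing.Theory Num.Theory.
Import ComplexField.Normc.
Import numFieldTopology.Exports numFieldNormedType.Exports.

Set Implicit Arguments.
Unset Strict Implicit.
Unset Printing Implicit Defensive.

Local Open Scope classical_set_scope.
Local Open Scope ring_scope.
Local Open Scope complex_scope.

(** The kernel which represents Phi is an average of resolvents. For m > 0 and
x >= 0 put k(t) = m^2 + t^2; then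

  m / sqrt(m^2 + x) = (2 / pi) int_0^oo (m / k(t)) * (k(t) / (k(t) + x)) dt,

and the weights (2 / pi) * m / k(t) have integral one. If every operator
k (k - L)^-1 with k > 0 is a contraction of L^p, then so is m / sqrt(m^2 - L),
the operator 1 - m / sqrt(m^2 - L) has norm at most 2 on L^p, and integration
against alpha gives

  |Phi(-L) f|_p <= 2 |alpha| |f|_p.

Both bounds of the theorem follow because max(p, p / (p - 1)) >= 2.

For 1 < p <= 2 the resolvents contract L^p because L is dissipative there: with
psi(s) = s (e + s)^(-q) and q = (4 - p) / 2, a regularization of s^((p - 2) / 2),
every complex test function u satisfies
int psi(|u|^2) Re(u conj(L u)) <= 0 ([core_trunc_le0]). The symmetry of L turns
minus this integral into that of an expression in V and first derivatives,
which is nonnegative at each point ([schroedinger_defect_ge0]); integration by parts is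
thus done by algebra, without cut-off functions. Essential self-adjointness
provides enough test functions: the range of 1 - L / k on them is dense
([resolvent_dense]), so the resolvents are limits to which Young's inequality
and Fatou's lemma apply ([resolvent_Lp]). For p > 2 the contraction is moved to
the other side of the pairing <u, g> by symmetry
([resolves_pairing_bound]).

The spectral side is handled through the scalar measures nu_f alone. A
variational argument shows that <u, f> = int k / (k + x) dnu_f when u is the
resolvent of f ([resolvent_form]). Polarization turns the L^p contraction into
bounds for differences of such integrals; Tonelli's theorem averages them over
t ([sqrt_kernel_combination]), and Fubini's theorem exchanges the integrals
against nu_f and alpha ([charge_representation]). The pairing <Phi(-L) f, g> is
thereby the integral against alpha of a function of m of modulus at most
2 |f|_p |g|_q, which a fine partition compares with the total variation
([charge_pairing]). Duality gives the bound of the norm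
([cLnorm_dual]). *)

(** * Calculus of functions of class C^k *)

Section SmoothCalculus.
Variables (R : realType) (n : nat) (U : set 'rV[R]_n).
Hypothesis openU : open U.
Implicit Types (f g : 'rV[R]_n -> R) (x v : 'rV[R]_n).

Lemma open_near_eq f g x : U x -> (forall y, U y -> f y = g y) ->
  \forall y \near x, f y = g y.
Proof. by move=> Ux fg; apply: filterS (open_nbhs_nbhs (conj openU Ux)). Qed.

Lemma eq_partial f g i x : U x -> (forall y, U y -> f y = g y) ->
  partial i f x = partial i g x.
Proof. by move=> Ux fg; apply: near_eq_derive; exact: open_near_eq. Qed.

Lemma continuous_for_eq f g x : U x -> (forall y, U y -> f y = g y) ->
  {for x, continuous f} -> {for x, continuous g}.
Proof.
move=> Ux fg; rewrite /prop_for /continuous_at -(fg _ Ux); apply: cvg_trans.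
by apply: (@near_eq_cvg _ _ (nbhs x)); exact: open_near_eq.
Qed.

Lemma Ck_on_eq k f g : (forall y, U y -> f y = g y) ->
  Ck_on k U f -> Ck_on k U g.
Proof.
elim: k f g => [|k IH] f g fg /= [cf df].
  by split => // x Ux; exact: continuous_for_eq (cf x Ux).
split; first by move=> x Ux; exact: continuous_for_eq (cf x Ux).
move=> i; have [di Ci] := df i; split.
  by move=> x Ux; apply: near_eq_derivable (di x Ux); exact: open_near_eq.
by apply: IH Ci => y Uy; exact: eq_partial.
Qed.

Lemma Ck_onW k f : Ck_on k.+1 U f -> Ck_on k U f.
Proof.
elim: k f => [|k IH] f [cf df]; first by split.
by split => // i; have [? /IH] := df i.
Qed.

Lemma Ck_on_continuous k f x : Ck_on k U f -> U x -> {for x, continuous f}.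
Proof. by case: k => [|k] [+ _]; apply. Qed.

Lemma Ck_on_cst k (c : R) : Ck_on k U (fun=> c).
Proof.
have cc x : {for x, continuous (fun _ : 'rV[R]_n => c)} by exact: cst_continuous.
elim: k c cc => [|k IH] c cc; split => // i; split.
  by move=> x Ux; exact: derivable_cst.
apply: (@Ck_on_eq _ (fun=> 0)) => [y _|]; last first.
  by apply: IH => x; exact: cst_continuous.
by rewrite /partial derive_cst.
Qed.

Lemma Ck_onD k f g : Ck_on k U f -> Ck_on k U g -> Ck_on k U (fun x => f x + g x).
Proof.
elim: k f g => [|k IH] f g [cf df] [cg dg]; split => //.
1,2: by move=> x Ux; exact: cvgD (cf _ Ux) (cg _ Ux).
move=> i; have [dfi Cfi] := df i; have [dgi Cgi] := dg i; split.
  by move=> x Ux; apply: derivableD; [exact: dfi|exact: dgi].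
apply: Ck_on_eq (IH _ _ Cfi Cgi) => y Uy.
by rewrite /partial deriveD//; [exact: dfi|exact: dgi].
Qed.

Lemma partialM f g i x : derivable f x (basis_vec R i) ->
  derivable g x (basis_vec R i) ->
  partial i (fun y => f y * g y) x = f x * partial i g x + g x * partial i f x.
Proof. by move=> df dg; exact: (deriveM df dg). Qed.

Lemma partialD f g i x : derivable f x (basis_vec R i) ->
  derivable g x (basis_vec R i) ->
  partial i (fun y => f y + g y) x = partial i f x + partial i g x.
Proof. by move=> df dg; exact: (deriveD df dg). Qed.

Lemma partial_cst i (c : R) : partial i (fun _ : 'rV[R]_n => c) = fun=> 0.
Proof. by apply/funext => y; rewrite /partial derive_cst. Qed.

Lemma Ck_onM k f g : Ck_on k U f -> Ck_on k U g -> Ck_on k U (fun x => f x * g x).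
Proof.
elim: k f g => [|k IH] f g Cf Cg.
  have [cf _] := Cf; have [cg _] := Cg.
  by split => // x Ux; exact: cvgM (cf _ Ux) (cg _ Ux).
have [cf df] := Cf; have [cg dg] := Cg.
split; first by move=> x Ux; exact: cvgM (cf _ Ux) (cg _ Ux).
move=> i; have [dfi Cfi] := df i; have [dgi Cgi] := dg i; split.
  move=> x Ux; rewrite -[fun y => _]/(f * g); apply: derivableM.
    exact: dfi.
  exact: dgi.
apply: Ck_on_eq (Ck_onD (IH _ _ (Ck_onW Cf) Cgi) (IH _ _ (Ck_onW Cg) Cfi)).
move=> y Uy; rewrite partialM//; [exact: dfi|exact: dgi].
Qed.

(** The restriction of f to a line through x reduces the chain rule to
one variable. *)
Lemma is_derive_comp1 f (h : R -> R) x v (dh : R) : derivable f x v ->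
  is_derive (f x) 1 h dh -> is_derive x v (h \o f) (dh * 'D_v f x).
Proof.
move=> df hh.
have dl : derivable (fun t : R => f (t *: v + x)) 0 1 by exact: (derivable1P _ _ _).1.
have Dl : 'D_1 (fun t : R => f (t *: v + x)) 0 = 'D_v f x.
  rewrite /derive; set g1 := fun t => t^-1 *: _; set g2 := fun t => t^-1 *: _.
  suff -> : g1 = g2 by []; apply/funext => t; rewrite /g1 /g2/=.
  by rewrite addr0 scale0r add0r [_%:A]mulr1.
have il : is_derive (0 : R) 1 (fun t : R => f (t *: v + x)) ('D_v f x).
  by rewrite -Dl; exact: derivableP.
have hh' : is_derive (f (0 *: v + x)) 1 h dh by rewrite scale0r add0r.
have [dc Dc] := is_derive1_comp hh' il.
split; first exact: (derivable1P _ _ _).2.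
rewrite -Dc /derive; set g1 := fun t => t^-1 *: _; set g2 := fun t => t^-1 *: _.
suff -> : g1 = g2 by []; apply/funext => t; rewrite /g1 /g2/=.
by rewrite addr0 scale0r add0r [_%:A]mulr1.
Qed.

Lemma partial_powR f i x (c : R) : 0 < f x -> derivable f x (basis_vec R i) ->
  derivable (fun y => f y `^ c) x (basis_vec R i) /\
  partial i (fun y => f y `^ c) x = c * f x `^ (c - 1) * partial i f x.
Proof.
move=> f0 df.
by have [? ?] := is_derive_comp1 df (@is_derive1_powR R c _ f0); split.
Qed.

(** The induction runs over all exponents at once, since the
derivative of the power c contains the power c - 1. *)
Lemma Ck_on_powR k f (c : R) : (forall y, U y -> 0 < f y) -> Ck_on k U f ->
  Ck_on k U (fun x => f x `^ c).
Proof.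
move=> f0; have cont j r x : Ck_on j U f -> U x -> {for x, continuous (fun y => f y `^ r)}.
  move=> Cf Ux; apply: (@continuous_comp _ _ _ f (fun z => z `^ r)).
    exact: Ck_on_continuous Cf Ux.
  have [+ _] := @is_derive1_powR R r _ (f0 _ Ux).
  by move=> /derivable1_diffP/differentiable_continuous.
elim: k c => [|k IH] c Cf; split => //; try by [move=> x; exact: cont Cf].
move=> i; have [_ /(_ i)[dfi Cfi]] := Cf; split.
  by move=> x Ux; have [] := partial_powR c (f0 _ Ux) (dfi _ Ux).
apply: (@Ck_on_eq _ (fun x => c * f x `^ (c - 1) * partial i f x)).
  by move=> y Uy; have [_ ->] := partial_powR c (f0 _ Uy) (dfi _ Uy).
apply: Ck_onM => //; apply: Ck_onM; first exact: Ck_on_cst.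
by apply: IH; exact: Ck_onW.
Qed.

End SmoothCalculus.

#[local] Opaque partial.

(** * Second order operators at a point *)

Section LocalOperator.
Variables (R : realType) (n : nat) (U : set 'rV[R]_n).
Hypothesis openU : open U.
Variables (S : 'M[R]_n) (b : 'rV[R]_n).
Implicit Types (F G : 'rV[R]_n -> R) (u v : 'I_n -> R).

Definition coef_form u v : R := \sum_(i < n) \sum_(j < n) S i j * u i * v j.

(** The second and first order parts act on unrelated families h and
u, which makes the rules for sums and products identities between
coefficients. *)
Definition coef_op (h : 'I_n -> 'I_n -> R) (u : 'I_n -> R) : R :=
  \sum_(i < n) \sum_(j < n) S i j * h i j + \sum_(i < n) b 0 i * u i.

Definition local_op F (y : 'rV[R]_n) : R :=
  coef_op (fun i j => partial i (partial j F) y) (fun i => partial i F y).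

Local Notation grad F y := (fun i => partial i F y).

Lemma coef_formD u v w : coef_form (fun i => u i + v i) w =
  coef_form u w + coef_form v w.
Proof.
rewrite /coef_form -big_split; apply: eq_bigr => i _.
by rewrite -big_split; apply: eq_bigr => j _ /=; ring.
Qed.

Lemma coef_formZ (k : R) u w : coef_form (fun i => k * u i) w = k * coef_form u w.
Proof.
rewrite /coef_form mulr_sumr; apply: eq_bigr => i _.
by rewrite mulr_sumr; apply: eq_bigr => j _ /=; ring.
Qed.

Hypothesis psdS : psd_mx S.

Lemma coef_formC u v : coef_form u v = coef_form v u.
Proof.
rewrite /coef_form exchange_big; apply: eq_bigr => i _; apply: eq_bigr => j _.
have -> : S j i = S i j by rewrite -{1}psdS.1 mxE.
ring.
Qed.

Lemma coef_form_ge0 u : 0 <= coef_form u u.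
Proof.
have := psdS.2 (\row_i u i); rewrite mxE; congr (_ <= _).
rewrite /coef_form exchange_big; apply: eq_bigr => j _.
rewrite !mxE mulr_suml; apply: eq_bigr => i _; rewrite !mxE; ring.
Qed.

Lemma coef_opM (h hF hG : 'I_n -> 'I_n -> R) (u uF uG : 'I_n -> R) (f g : R) :
  (forall i j, h i j = f * hG i j + g * hF i j + uF i * uG j + uG i * uF j) ->
  (forall i, u i = f * uG i + g * uF i) ->
  coef_op h u = f * coef_op hG uG + g * coef_op hF uF + 2 * coef_form uF uG.
Proof.
move=> hE uE; rewrite [2 * _]mulrDl mul1r {2}coef_formC /coef_op /coef_form.
rewrite -!big_split !mulr_sumr -!big_split; apply: eq_bigr => i _ /=.
have -> : \sum_j S i j * h i j = \sum_j (f * (S i j * hG i j) +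
    g * (S i j * hF i j) + S i j * uF i * uG j + S i j * uG i * uF j).
  by apply: eq_bigr => j _; rewrite hE; ring.
rewrite !big_split/= -!mulr_sumr uE; ring.
Qed.

Lemma coef_opD (h hF hG : 'I_n -> 'I_n -> R) (u uF uG : 'I_n -> R) :
  (forall i j, h i j = hF i j + hG i j) -> (forall i, u i = uF i + uG i) ->
  coef_op h u = coef_op hF uF + coef_op hG uG.
Proof.
move=> hE uE; rewrite /coef_op -!big_split; apply: eq_bigr => i _ /=.
have -> : \sum_j S i j * h i j = \sum_j (S i j * hF i j + S i j * hG i j).
  by apply: eq_bigr => j _; rewrite hE mulrDr.
by rewrite big_split/= uE mulrDr addrACA.
Qed.

Lemma partial_derivable k F i x : Ck_on k.+1 U F -> U x ->
  derivable F x (basis_vec R i).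
Proof. by move=> [_ /(_ i)[+ _]]; apply. Qed.

Lemma partialMU F G i x : smooth_on U F -> smooth_on U G -> U x ->
  partial i (fun y => F y * G y) x = F x * partial i G x + G x * partial i F x.
Proof.
move=> sF sG Ux; apply: partialM; exact: partial_derivable (_ : Ck_on 1 U _) Ux.
Qed.

Lemma partialDU F G i x : smooth_on U F -> smooth_on U G -> U x ->
  partial i (fun y => F y + G y) x = partial i F x + partial i G x.
Proof.
by move=> sF sG Ux; apply: partialD; exact: partial_derivable (_ : Ck_on 1 U _) Ux.
Qed.

Lemma partial_smooth F i : smooth_on U F -> smooth_on U (partial i F).
Proof. by move=> sF k; have [_ /(_ i)[]] := sF k.+1. Qed.

Lemma smooth_onM F G : smooth_on U F -> smooth_on U G ->
  smooth_on U (fun y => F y * G y).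
Proof. by move=> sF sG k; exact: Ck_onM. Qed.

Lemma partial2M F G i j x : smooth_on U F -> smooth_on U G -> U x ->
  partial i (partial j (fun y => F y * G y)) x =
  F x * partial i (partial j G) x + G x * partial i (partial j F) x
  + partial i F x * partial j G x + partial i G x * partial j F x.
Proof.
move=> sF sG Ux.
rewrite (eq_partial openU i Ux (fun y Uy => partialMU j sF sG Uy)).
rewrite partialDU//; [|exact/smooth_onM/partial_smooth..].
rewrite !partialMU//; [|exact: partial_smooth..].
move: (partial i (partial j G) x) (partial i (partial j F) x) (partial i F x)
  (partial j G x) (partial i G x) (partial j F x) (F x) (G x) => *.
ring.
Qed.

Lemma local_opM F G x : smooth_on U F -> smooth_on U G -> U x ->
  local_op (fun y => F y * G y) x =
  F x * local_op G x + G x * local_op F x + 2 * coef_form (grad F x) (grad G x).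
Proof.
move=> sF sG Ux; apply: coef_opM => [i j|i].
  exact: partial2M.
exact: partialMU.
Qed.

Lemma local_opD F G x : smooth_on U F -> smooth_on U G -> U x ->
  local_op (fun y => F y + G y) x = local_op F x + local_op G x.
Proof.
move=> sF sG Ux; apply: coef_opD => [i j|i]; last exact: partialDU.
rewrite (eq_partial openU i Ux (fun y Uy => partialDU j sF sG Uy)).
by apply: partialDU => //; exact: partial_smooth.
Qed.

Lemma local_op_cst (k : R) x : local_op (fun=> k) x = 0.
Proof.
rewrite /local_op /coef_op big1 ?add0r => [|i _]; last first.
  by rewrite big1// => j _; rewrite !partial_cst mulr0.
by rewrite big1// => i _; rewrite partial_cst mulr0.
Qed.

End LocalOperator.

(** * The integration by parts defect *)

Lemma powR_pred (R : realType) (x r : R) : 0 < x -> x `^ r = x `^ (r - 1) * x.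
Proof.
move=> x0; have {3}-> : x = x `^ 1 by rewrite powRr1// ltW.
by rewrite -powRD ?subrK// (gt_eqF x0) implybT.
Qed.

Section Truncation.
Variable R : realType.
Implicit Types (a b s e q : R).

(** With e > 0, q = (4 - p) / 2 and s = |u|^2 this is a smooth substitute
for |u|^(p - 2). The first factor makes it vanish together with u, so it is a
test function when u is one. *)
Definition trunc e q s : R := s * (e + s) `^ (- q).

(** For a symmetric operator D the first two terms have opposite
integrals and the third has the integral of psi * f * D f, so the integral of
the defect is -2 times that of psi * f * D f. For an operator of second order
that kills constants, the second derivatives cancel. This replaces integration
by parts. *)
Definition parts_defect (T : Type) (D : (T -> R) -> T -> R) (psi f : T -> R) (x : T) : R :=
  psi x * D (fun y => f y * f y) x - f x * f x * D psi x
  + f x * D (fun y => psi y * f y) x - 3 * (psi x * (f x * D f x)).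

End Truncation.

Section LocalDefect.
Variables (R : realType) (n : nat) (U : set 'rV[R]_n).
Hypothesis openU : open U.
Variables (S : 'M[R]_n) (b : 'rV[R]_n).
Hypothesis psdS : psd_mx S.
Implicit Types (F G psi : 'rV[R]_n -> R) (e q : R).

Local Notation D := (local_op S b).
Local Notation form := (coef_form S).
Local Notation grad F y := (fun i => partial i F y).

Lemma parts_defectE psi F y : smooth_on U psi -> smooth_on U F -> U y ->
  parts_defect D psi F y = 2 * (psi y * form (grad F y) (grad F y)
                                + F y * form (grad psi y) (grad F y)).
Proof.
move=> sp sF Uy; rewrite /parts_defect.
rewrite (local_opM openU b psdS sF sF Uy) (local_opM openU b psdS sp sF Uy).
move: (D F y) (D psi y) (form _ _) (form _ _) => *; ring.
Qed.

Lemma form_combination (u v : 'I_n -> R) (s t : R) :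
  form (fun i => s * u i + t * v i) (fun i => s * u i + t * v i) =
  s ^+ 2 * form u u + 2 * (s * t) * form u v + t ^+ 2 * form v v.
Proof.
have lin w : form (fun i => s * u i + t * v i) w = s * form u w + t * form v w.
  by rewrite coef_formD !coef_formZ.
have linr w : form w (fun i => s * u i + t * v i) = s * form w u + t * form w v.
  by rewrite coef_formC// lin !(coef_formC psdS w).
rewrite lin !linr (coef_formC psdS v u).
move: (form _ _) (form _ _) (form _ _) => *; ring.
Qed.

Lemma smooth_on_trunc e q F : 0 < e -> (forall y, 0 <= F y) ->
  smooth_on U F -> smooth_on U (fun y => trunc e q (F y)).
Proof.
move=> e0 F0 sF k; apply: Ck_onM => //; apply: Ck_on_powR => //.
  by move=> y _; rewrite ltr_pwDl.
by apply: Ck_onD => //; exact: Ck_on_cst.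
Qed.

Lemma partial_trunc e q F i y : 0 < e -> (forall y, 0 <= F y) ->
  smooth_on U F -> U y -> partial i (fun y => trunc e q (F y)) y =
  (e + F y) `^ (- q - 1) * (e + F y - q * F y) * partial i F y.
Proof.
move=> e0 F0 sF Uy.
have eF0 : 0 < e + F y by rewrite ltr_pwDl.
have scst : smooth_on U (fun=> e) by move=> k; exact: Ck_on_cst.
have sD : smooth_on U (fun y => e + F y) by move=> k; exact: Ck_onD.
have dD : derivable (fun z => e + F z) y (basis_vec R i).
  exact: partial_derivable (sD 1%N) Uy.
have [dP DP] := partial_powR (- q) eF0 dD.
rewrite (partialM (partial_derivable (sF 1%N) Uy) dP).
rewrite DP (partialDU i scst sF Uy) partial_cst.
rewrite (powR_pred (- q) eF0).
move: (partial i F y) ((e + F y) `^ (- q - 1)) => *; ring.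
Qed.

(** With s = F^2 + G^2 and Q the quadratic form of the
coefficients, (e + s)^(q + 1) / 2 times the sum is
(e + s) Q(G dF - F dG) + (3 e + (3 - 2 q) s) Q(F dF + G dG).
The second coefficient is nonnegative because q <= 3 / 2. *)
Lemma parts_defect_pair_ge0 e q F G y : 0 < e -> 0 <= q -> q <= 3 / 2 ->
  smooth_on U F -> smooth_on U G -> U y ->
  0 <= parts_defect D (fun z => trunc e q (F z * F z + G z * G z)) F y
     + parts_defect D (fun z => trunc e q (F z * F z + G z * G z)) G y.
Proof.
move=> e0 q0 q32 sF sG Uy; set psi := fun z => trunc _ _ _.
pose s z := F z * F z + G z * G z.
have s0 z : 0 <= s z by rewrite addr_ge0// -expr2 sqr_ge0.
have ss : smooth_on U s by move=> k; apply: Ck_onD => //; exact: Ck_onM.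
have sp : smooth_on U psi by exact: (smooth_on_trunc q e0 s0 ss).
rewrite !parts_defectE//.
set u := grad F y; set v := grad G y.
have gs i : partial i s y = 2 * (F y * u i + G y * v i).
  rewrite /s (partialDU i (smooth_onM openU sF sF) (smooth_onM openU sG sG) Uy).
  rewrite (partialMU i sF sF Uy) (partialMU i sG sG Uy) /u /v.
  move: (partial _ _ _) (partial _ _ _) (F y) (G y) => *; ring.
set X := (e + s y) `^ (- q - 1).
have X0 : 0 < X by rewrite powR_gt0// ltr_pwDl.
pose c := X * (e + s y - q * s y) * 2.
have gp : (fun i => partial i psi y) = (fun i => c * (F y * u i + G y * v i)).
  apply/funext => i; rewrite (partial_trunc q i e0 s0 ss Uy) gs /c -/X.
  by rewrite !mulrA.
have psiE : psi y = s y * (X * (e + s y)).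
  by rewrite /psi /trunc -/(s y) /X -powR_pred// ltr_pwDl.
have lin w : form (grad psi y) w = c * (F y * form u w + G y * form v w).
  by rewrite gp coef_formZ coef_formD !coef_formZ.
have Q1 := coef_form_ge0 psdS (fun i => F y * u i + G y * v i).
have Q2 := coef_form_ge0 psdS (fun i => G y * u i + - F y * v i).
rewrite !form_combination in Q1 Q2.
rewrite !lin ![form v u]coef_formC// psiE -mulrDr mulr_ge0//.
set a := form u u; set d := form v v; set m := form u v.
rewrite -/a -/d -/m in Q1 Q2.
have -> : s y * (X * (e + s y)) * a + F y * (c * (F y * a + G y * m)) +
    (s y * (X * (e + s y)) * d + G y * (c * (F y * m + G y * d))) =
  X * ((e + s y) * (G y ^+ 2 * a + 2 * (G y * - F y) * m + (- F y) ^+ 2 * d)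
  + (3 * e + (3 - 2 * q) * s y) * (F y ^+ 2 * a + 2 * (F y * G y) * m + G y ^+ 2 * d)).
  by rewrite /c /s; ring.
apply: mulr_ge0; first exact: ltW.
apply: addr_ge0; apply: mulr_ge0 => //; first by rewrite addr_ge0// ltW.
apply: addr_ge0; first by rewrite mulr_ge0// ltW.
rewrite mulr_ge0//; lra.
Qed.

End LocalDefect.

(** * Schroedinger operators on a manifold *)

Section ManifoldCalculus.
Variables (R : realType) (M : ptopologicalType) (n : nat).
Variables (A : set (chart R M n)) (Delta : (M -> R) -> M -> R) (V : M -> R).
Hypothesis hM : smooth_manifold A.
Implicit Types (f g : M -> R).

Lemma open_chart_img c : A c -> open (chart_img c).
Proof. by have [_ + _ _ _] := hM => /(_ c) /[apply] -[]. Qed.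

Lemma smoothM f g : smooth A f -> smooth A g -> smooth A (fun x => f x * g x).
Proof.
move=> sf sg c Ac.
exact: (smooth_onM (open_chart_img Ac) (sf _ Ac) (sg _ Ac)).
Qed.

Lemma smoothD f g : smooth A f -> smooth A g -> smooth A (fun x => f x + g x).
Proof.
move=> sf sg c Ac k.
exact: (Ck_onD (open_chart_img Ac) (sf _ Ac k) (sg _ Ac k)).
Qed.

Lemma smooth_cst (k : R) : smooth A (fun=> k).
Proof. by move=> c Ac m; exact: (Ck_on_cst (open_chart_img Ac)). Qed.

Lemma smooth_trunc (e q : R) f : 0 < e -> (forall x, 0 <= f x) ->
  smooth A f -> smooth A (fun x => trunc e q (f x)).
Proof.
move=> e0 f0 sf c Ac.
exact: (smooth_on_trunc (open_chart_img Ac) q e0 (fun y => f0 (chart_inv c y)) (sf _ Ac)).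
Qed.

Lemma test_functionM f g : smooth A f -> test_function A g ->
  test_function A (fun x => f x * g x).
Proof.
move=> sf [sg cg]; split; first exact: smoothM.
apply: subclosed_compact cg _; first exact: closed_closure.
apply: closure_subset => x /=; apply: contra => /eqP ->.
by rewrite mulr0.
Qed.

Lemma test_functionD f g : test_function A f -> test_function A g ->
  test_function A (fun x => f x + g x).
Proof.
move=> [sf cf] [sg cg]; split; first exact: smoothD.
apply: subclosed_compact (compactU cf cg) _; first exact: closed_closure.
rewrite -closureU; apply: closure_subset => x /=.
have [->|f0 _] := eqVneq (f x) 0; first by rewrite add0r; right.
by left.
Qed.

Lemma test_functionZ (k : R) f : test_function A f ->
  test_function A (fun x => k * f x).
Proof. by apply: test_functionM; exact: smooth_cst. Qed.

Lemma test_function0 : test_function A (fun=> 0).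
Proof.
split; first exact: smooth_cst.
rewrite /supp (_ : [set _ | _] = set0) ?closure0; first exact: compact0.
by apply/seteqP; split => x //=; rewrite eqxx.
Qed.

Hypothesis hDelta : diffusion_operator A Delta.

(** The value of Delta f at x only depends on the coefficients at
the image of x in a chart, so these may be frozen there. *)
Lemma diffusion_local x : exists (U : set 'rV[R]_n) (S : 'M[R]_n) (b y : 'rV[R]_n)
    (phi : 'rV[R]_n -> M),
  [/\ open U, U y, psd_mx S, phi y = x & forall f, smooth A f ->
    smooth_on U (f \o phi) /\ Delta f x = local_op S b (f \o phi) y].
Proof.
have [_ hc cov _ _] := hM; have [c Ac cx] := cov x.
have [_ _ invK _ _] := hc _ Ac.
have [sigma [b [_ _ psd DE]]] := hDelta Ac.
have iy : chart_img c (chart_map c x) by exists x.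
exists (chart_img c), (sigma (chart_map c x)), (b (chart_map c x)),
  (chart_map c x), (chart_inv c).
split => //; [exact: open_chart_img|exact: psd|exact: invK|move=> f sf].
by split; [exact: sf|rewrite -{1}(invK _ cx) DE].
Qed.

Local Notation L := (schroedinger Delta V).

Lemma schroedingerD f g : smooth A f -> smooth A g ->
  L (fun x => f x + g x) = (fun x => L f x + L g x).
Proof.
move=> sf sg; apply/funext => x; rewrite /schroedinger.
have [U [S [b [y [phi [oU Uy _ _ D]]]]]] := diffusion_local x.
have [_ ->] := D _ (smoothD sf sg).
have [sf' ->] := D _ sf; have [sg' ->] := D _ sg.
by rewrite (local_opD oU _ _ sf' sg')//; ring.
Qed.

Lemma schroedingerZ (k : R) f : smooth A f ->
  L (fun x => k * f x) = (fun x => k * L f x).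
Proof.
move=> sf; apply/funext => x; rewrite /schroedinger.
have [U [S [b [y [phi [oU Uy psd _ D]]]]]] := diffusion_local x.
have [_ ->] := D _ (smoothM (smooth_cst k) sf).
have [sk _] := D _ (smooth_cst k); have [sf' ->] := D _ sf.
rewrite (local_opM oU b psd sk sf')//.
have -> : local_op S b ((fun=> k) \o phi) y = 0 by exact: local_op_cst.
have -> : coef_form S (fun i => partial i ((fun=> k) \o phi) y)
    (fun i => partial i (f \o phi) y) = 0.
  rewrite (_ : (fun i => partial i ((fun=> k) \o phi) y) = fun=> 0 * 0).
    by rewrite coef_formZ mul0r.
  by apply/funext => i; rewrite mul0r partial_cst.
rewrite /=; ring.
Qed.

Lemma schroedinger0 : L (fun=> 0) = fun=> 0.
Proof.
have := schroedingerZ 0 (smooth_cst 0).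
rewrite (_ : (fun x => 0 * 0) = fun=> 0); last by apply/funext => x; rewrite mul0r.
by move=> ->; apply/funext => x; rewrite mul0r.
Qed.

Hypothesis hV : forall x, V x <= 0.

(** The potential adds -2 V psi (f^2 + g^2) to the defect of
the differential part, which is nonnegative since V <= 0. *)
Lemma schroedinger_defect_ge0 (e q : R) f g x : 0 < e -> 0 <= q -> q <= 3 / 2 ->
  smooth A f -> smooth A g ->
  0 <= parts_defect L (fun z => trunc e q (f z * f z + g z * g z)) f x
     + parts_defect L (fun z => trunc e q (f z * f z + g z * g z)) g x.
Proof.
move=> e0 q0 q32 sf sg; set psi := fun z => trunc _ _ _.
have s0 z : 0 <= f z * f z + g z * g z by rewrite addr_ge0// -expr2 sqr_ge0.
have ss := smoothD (smoothM sf sf) (smoothM sg sg).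
have sp : smooth A psi by exact: (smooth_trunc q e0 s0 ss).
have [U [S [b [y [phi [oU Uy psd xE D]]]]]] := diffusion_local x.
have psi0 : 0 <= psi x by rewrite mulr_ge0// powR_ge0.
have defE h : smooth A h -> parts_defect L psi h x =
    parts_defect (local_op S b) (psi \o phi) (h \o phi) y
    - 2 * (V x * psi x * (h x * h x)).
  move=> sh; rewrite /parts_defect /schroedinger.
  have [_ ->] := D _ (smoothM sh sh); have [_ ->] := D _ (smoothM sp sh).
  have [_ ->] := D _ sh; have [_ ->] := D _ sp.
  rewrite /= xE -!/(comp _ _).
  move: (local_op _ _ _ _) (local_op _ _ _ _) (local_op _ _ _ _)
    (local_op _ _ _ _) => *; ring.
rewrite !defE//.
have := parts_defect_pair_ge0 oU b psd e0 q0 q32 (D _ sf).1 (D _ sg).1 Uy.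
have W h : 0 <= - 2 * (V x * psi x * (h * h)).
  rewrite mulNr oppr_ge0 pmulr_rle0// mulr_le0_ge0 -?expr2 ?sqr_ge0//.
  by rewrite mulr_le0_ge0.
move=> P0; have := addr_ge0 P0 (addr_ge0 (W (f x)) (W (g x))).
by rewrite addrACA !mulNr.
Qed.

End ManifoldCalculus.

(** * The real inner product of L^2 *)

Section RealPairing.
Variable R : realType.
Implicit Types (z w : R[i]) (a : R).
Local Notation Re := (@complex.Re R).
Local Notation Im := (@complex.Im R).

(** The real inner product of the plane. Working with it instead of the
complex one keeps quadratic forms real; imaginary parts are recovered by
multiplying one argument by i. *)
Definition rdot z w : R := Re z * Re w + Im z * Im w.

Lemma rdotC z w : rdot z w = rdot w z.
Proof. by rewrite /rdot mulrC [Im z * _]mulrC. Qed.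

Lemma rdotDl z1 z2 w : rdot (z1 + z2) w = rdot z1 w + rdot z2 w.
Proof. by case: z1 z2 => [a b] [c d]; rewrite /rdot/=; ring. Qed.

Lemma rdotZl a z w : rdot (a%:C * z) w = a * rdot z w.
Proof. by case: z => b c; rewrite /rdot/=; ring. Qed.

Lemma rdotNl z w : rdot (- z) w = - rdot z w.
Proof. by case: z => b c; rewrite /rdot/=; ring. Qed.

Lemma rdot_mull c z w : rdot (c * z) w = rdot z (c^* * w).
Proof. by case: c z w => [a b] [d e] [f g]; rewrite /rdot/=; ring. Qed.

Lemma rdot_ge0 z : 0 <= rdot z z.
Proof. by rewrite addr_ge0// -expr2 sqr_ge0. Qed.

Lemma rdotM c z : rdot (c * z) (c * z) = rdot c c * rdot z z.
Proof. by case: c z => [a b] [d e]; rewrite /rdot/=; ring. Qed.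

Lemma sqr_normc z : normc z ^+ 2 = rdot z z.
Proof.
case: z => a b; rewrite /normc sqr_sqrtr /rdot/= ?expr2//.
by rewrite addr_ge0// sqr_ge0.
Qed.

Lemma normc_ge0 z : 0 <= normc z.
Proof. by case: z => a b; rewrite /normc sqrtr_ge0. Qed.

Lemma rdot_eq0 z : rdot z z = 0 -> z = 0.
Proof. by rewrite -sqr_normc => /eqP; rewrite sqrf_eq0 => /eqP /eq0_normc. Qed.

Lemma rdot_le2 z w : `|rdot z w| <= 2^-1 * (rdot z z + rdot w w).
Proof.
have := rdot_ge0 (z + w); have := rdot_ge0 (z - w).
rewrite !(rdotDl, rdotNl, rdotC _ (_ + _), rdotC _ (- _)) (rdotC w z) => h1 h2.
rewrite ler_norml; apply/andP; split; lra.
Qed.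

Lemma normr_rdot z w : `|rdot z w| <= normc z * normc w.
Proof.
rewrite -(@ler_pXn2r _ 2)// ?nnegrE ?mulr_ge0 ?normc_ge0// exprMn !sqr_normc.
rewrite real_normK ?num_real// -subr_ge0.
have -> : rdot z z * rdot w w - rdot z w ^+ 2 = (Re z * Im w - Im z * Re w) ^+ 2.
  by rewrite /rdot; ring.
exact: sqr_ge0.
Qed.

Lemma rdot_subl2 z w : rdot (z + w) (z + w) <= 2 * (rdot z z + rdot w w).
Proof.
have := rdot_ge0 (z - w).
rewrite !(rdotDl, rdotNl, rdotC _ (_ + _), rdotC _ (- _)) (rdotC w z) => h.
lra.
Qed.

End RealPairing.

Lemma sqrt_cvg0 (R : realType) (r : nat -> R) : r @ \oo --> (0 : R) ->
  (fun k => Num.sqrt (r k)) @ \oo --> (0 : R).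
Proof.
move=> r0; rewrite -sqrtr0.
exact: (@continuous_cvg _ _ _ \oo _ r Num.sqrt (0 : R) (@sqrt_continuous R 0) r0).
Qed.

Section SquareIntegrable.
Context {d} {T : measurableType d} {R : realType}.
Variable mu : {measure set T -> \bar R}.
Local Notation cfun := (T -> R[i]).
Local Notation L2 := (in_Lp mu 2%:E).
Local Notation Re := (@complex.Re R).
Local Notation Im := (@complex.Im R).
Implicit Types (f g h : cfun) (a : R) (c : R[i]).

Lemma measurable_rdot f g : cmeasurable setT f -> cmeasurable setT g ->
  measurable_fun setT (fun x => rdot (f x) (g x)).
Proof.
by move=> [? ?] [? ?]; apply: measurable_funD; exact: measurable_funM.
Qed.

Lemma cmeasurableD f g : cmeasurable setT f -> cmeasurable setT g ->
  cmeasurable setT (fun x => f x + g x).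
Proof.
move=> [fr fi] [gr gi]; split.
  rewrite (_ : (fun _ => _) = (fun x => Re (f x) + Re (g x))).
    exact: measurable_funD.
  by apply/funext => x; case: (f x) (g x) => [? ?] [].
rewrite (_ : (fun _ => _) = (fun x => Im (f x) + Im (g x))).
  exact: measurable_funD.
by apply/funext => x; case: (f x) (g x) => [? ?] [].
Qed.

Lemma cmeasurableM f g : cmeasurable setT f -> cmeasurable setT g ->
  cmeasurable setT (fun x => f x * g x).
Proof.
move=> [fr fi] [gr gi]; split.
  rewrite (_ : (fun _ => _) = (fun x => Re (f x) * Re (g x) - Im (f x) * Im (g x))).
    by apply: measurable_funB; exact: measurable_funM.
  by apply/funext => x; case: (f x) (g x) => [? ?] [].
rewrite (_ : (fun _ => _) = (fun x => Re (f x) * Im (g x) + Im (f x) * Re (g x))).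
  by apply: measurable_funD; exact: measurable_funM.
by apply/funext => x; case: (f x) (g x) => [? ?] [].
Qed.

Lemma cmeasurableB f g : cmeasurable setT f -> cmeasurable setT g ->
  cmeasurable setT (fun x => f x - g x).
Proof.
move=> mf mg; apply: cmeasurableD mf _.
rewrite (_ : (fun x => - g x) = (fun x => -1 * g x)).
  by apply: cmeasurableM mg; split; exact: measurable_cst.
by apply/funext => x; rewrite mulN1r.
Qed.

Lemma cmeasurable_cst c : cmeasurable setT (fun _ : T => c).
Proof. by split; exact: measurable_cst. Qed.

Lemma cLnorm2E f :
  cLnorm mu 2%:E f = ((\int[mu]_x (rdot (f x) (f x))%:E) `^ 2^-1)%E.
Proof.
rewrite /cLnorm unlock; congr (_ `^ _)%E; apply: eq_integral => x _.
by rewrite /= ger0_norm ?normc_ge0// powR_mulrn ?normc_ge0// sqr_normc.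
Qed.

Lemma L2P f : L2 f <-> cmeasurable setT f /\
  mu.-integrable setT (EFin \o (fun x => rdot (f x) (f x))).
Proof.
rewrite /in_Lp cLnorm2E; split=> -[mf fi]; split => //.
  apply/integrableP; split; first by apply/measurable_EFinP; exact: measurable_rdot.
  under eq_integral => x _ do rewrite /= ger0_norm ?rdot_ge0//.
  exact: (@lty_poweRy _ _ 2^-1).
apply: poweR_lty; apply: le_lt_trans (integrable_lty _ fi) => //.
Qed.

Lemma L2_cmeas f : L2 f -> cmeasurable setT f. Proof. by case. Qed.

Lemma integrable_rdot f g : L2 f -> L2 g ->
  mu.-integrable setT (EFin \o (fun x => rdot (f x) (g x))).
Proof.
move=> /L2P[mf fi] /L2P[mg gi].
have := integrableZl measurableT 2^-1 (integrableD measurableT fi gi).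
apply: le_integrable => //.
  by apply/measurable_EFinP; exact: measurable_rdot.
move=> x _ /=; rewrite lee_fin (le_trans (rdot_le2 _ _))//.
by rewrite ler_norm.
Qed.

Lemma L2D f g : L2 f -> L2 g -> L2 (fun x => f x + g x).
Proof.
move=> /[dup] Lf /L2P[mf fi] /[dup] Lg /L2P[mg gi]; apply/L2P; split.
  exact: cmeasurableD.
have := integrableZl measurableT 2 (integrableD measurableT fi gi).
apply: le_integrable => //.
  by apply/measurable_EFinP; apply: measurable_rdot; exact: cmeasurableD.
move=> x _ /=; rewrite lee_fin ger0_norm ?rdot_ge0// (le_trans _ (ler_norm _))//.
exact: rdot_subl2.
Qed.

Lemma L2Z c f : L2 f -> L2 (fun x => c * f x).
Proof.
move=> /L2P[mf fi]; apply/L2P; split.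
  by apply: (cmeasurableM _ mf); exact: cmeasurable_cst.
have := integrableZl measurableT (rdot c c) fi.
by apply: eq_integrable => // x _ /=; rewrite rdotM.
Qed.

Lemma L2N f : L2 f -> L2 (fun x => - f x).
Proof.
move=> /(L2Z (-1)); congr L2.
by apply/funext => x; rewrite mulN1r.
Qed.

Lemma L2B f g : L2 f -> L2 g -> L2 (fun x => f x - g x).
Proof. by move=> Lf /L2N; exact: L2D. Qed.

Definition ip f g : R := \int[mu]_x rdot (f x) (g x).

Lemma ipC f g : ip f g = ip g f.
Proof. by apply: eq_Rintegral => x _; rewrite rdotC. Qed.

Lemma ipDl f g h : L2 f -> L2 g -> L2 h ->
  ip (fun x => f x + g x) h = ip f h + ip g h.
Proof.
move=> Lf Lg Lh; rewrite /ip -RintegralD//; [|exact: integrable_rdot..].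
by apply: eq_Rintegral => x _; rewrite rdotDl.
Qed.

Lemma ipZl a f h : L2 f -> L2 h -> ip (fun x => a%:C * f x) h = a * ip f h.
Proof.
move=> Lf Lh; rewrite /ip -RintegralZl//; last exact: integrable_rdot.
by apply: eq_Rintegral => x _; rewrite rdotZl.
Qed.

Lemma ipNl f h : L2 f -> L2 h -> ip (fun x => - f x) h = - ip f h.
Proof.
move=> Lf Lh; rewrite -mulN1r -ipZl//; apply: eq_Rintegral => x _.
by rewrite rdotNl rdotZl mulN1r.
Qed.

Lemma ipBl f g h : L2 f -> L2 g -> L2 h ->
  ip (fun x => f x - g x) h = ip f h - ip g h.
Proof. by move=> Lf Lg Lh; rewrite ipDl ?ipNl//; exact: L2N. Qed.

Lemma ipDr f g h : L2 f -> L2 g -> L2 h ->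
  ip h (fun x => f x + g x) = ip h f + ip h g.
Proof. by move=> *; rewrite ipC ipDl// !(ipC h). Qed.

Lemma ipBr f g h : L2 f -> L2 g -> L2 h ->
  ip h (fun x => f x - g x) = ip h f - ip h g.
Proof. by move=> *; rewrite ipC ipBl// !(ipC h). Qed.

Lemma ipZr a f h : L2 f -> L2 h -> ip h (fun x => a%:C * f x) = a * ip h f.
Proof. by move=> *; rewrite ipC ipZl// ipC. Qed.

Lemma ip_mull c f g : ip (fun x => c * f x) g = ip f (fun x => c^* * g x).
Proof. by apply: eq_Rintegral => x _; rewrite rdot_mull. Qed.

Lemma ip_ge0 f : 0 <= ip f f.
Proof. by apply: Rintegral_ge0 => x _; exact: rdot_ge0. Qed.

Lemma ipE f : L2 f -> (\int[mu]_x (rdot (f x) (f x))%:E)%E = (ip f f)%:E.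
Proof.
by move=> /L2P[_ fi]; rewrite /ip /Rintegral fineK//; exact: integrable_fin_num.
Qed.

Lemma cLnorm2_sqrt f : L2 f -> cLnorm mu 2%:E f = (Num.sqrt (ip f f))%:E.
Proof. by move=> Lf; rewrite cLnorm2E ipE// poweR_EFin powR12_sqrt// ip_ge0. Qed.

Lemma ip_le2 t f g : 0 < t -> L2 f -> L2 g ->
  2 * ip f g <= t * ip f f + t^-1 * ip g g.
Proof.
move=> t0 Lf Lg; have := ip_ge0 (fun x => t%:C * f x - g x).
have Ltf := L2Z t%:C Lf.
rewrite ipBl ?ipBr ?ipZl ?ipZr//; last exact: L2B.
rewrite (ipC g f) => h; have : 0 <= t^-1 * (t * (t * ip f f) - t * ip f g - (t * ip f g - ip g g)).
  by rewrite mulr_ge0// invr_ge0 ltW.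
rewrite !mulrBr !mulrA mulVf ?gt_eqF// !mul1r => h'; lra.
Qed.

Lemma ip_CS f g : L2 f -> L2 g -> `|ip f g| <= Num.sqrt (ip f f) * Num.sqrt (ip g g).
Proof.
move=> Lf Lg; rewrite -sqrtrM ?ip_ge0// -sqrtr_sqr ler_wsqrtr//.
have f0 := ip_ge0 f; have g0 := ip_ge0 g.
have key a b : ip (fun x => a%:C * f x + b%:C * g x) (fun x => a%:C * f x + b%:C * g x) =
    a ^+ 2 * ip f f + 2 * (a * b) * ip f g + b ^+ 2 * ip g g.
  have La := L2Z a%:C Lf; have Lb := L2Z b%:C Lg; have Lab := L2D La Lb.
  rewrite ipDl// !ipDr// !ipZl// !ipZr// (ipC g f); ring.
have := ip_ge0 (fun x => (ip g g)%:C * f x + (- ip f g)%:C * g x); rewrite key.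
have -> : ip g g ^+ 2 * ip f f + 2 * (ip g g * - ip f g) * ip f g + (- ip f g) ^+ 2 * ip g g
  = ip g g * (ip f f * ip g g - ip f g ^+ 2) by ring.
have [g00|gN0] := eqVneq (ip g g) 0.
  move=> _; rewrite g00 mulr0.
  have := ip_ge0 (fun x => (- ip f g)%:C * f x + (ip f f + 1)%:C * g x); rewrite key g00.
  set t := ip f g; set s := ip f f => h.
  have : 0 <= - (t ^+ 2 * (s + 2)) by move: h; congr (_ <= _); ring.
  rewrite oppr_ge0 pmulr_lle0// ltr_pwDr//.
by rewrite pmulr_rge0 ?subr_ge0// lt_def gN0.
Qed.

Lemma eq_ip f g h : L2 f -> L2 g -> L2 h ->
  {ae mu, forall x, f x = g x} -> ip f h = ip g h.
Proof.
move=> Lf Lg Lh fg; rewrite /ip /Rintegral; congr fine.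
apply: ae_eq_integral => //.
- by apply/measurable_EFinP/measurable_rdot; exact: L2_cmeas.
- by apply/measurable_EFinP/measurable_rdot; exact: L2_cmeas.
- by apply: filterS fg => x -> _.
Qed.

Lemma ip_eq0 f : L2 f -> ip f f = 0 -> {ae mu, forall x, f x = 0}.
Proof.
move=> Lf f0; have [mf fi] := (L2P f).1 Lf.
have : (\int[mu]_x `|(rdot (f x) (f x))%:E| = 0)%E.
  under eq_integral => x _ do rewrite /= ger0_norm ?rdot_ge0//.
  by rewrite ipE// f0.
move=> /(ae_eq_integral_abs mu measurableT (measurable_int _ fi)).
by apply: filterS => x /(_ I)[] /rdot_eq0.
Qed.

Lemma Re_inner f g : Re (inner mu f g) = ip f g.
Proof.
apply: eq_Rintegral => x _; rewrite /rdot.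
by case: (f x) (g x) => [? ?] [? ?]/=; rewrite mulrN opprK.
Qed.

Lemma Im_inner f g : Im (inner mu f g) = ip f (fun x => 'i%C * g x).
Proof.
apply: eq_Rintegral => x _; rewrite /rdot.
by case: (f x) (g x) => [? ?] [? ?]/=; ring.
Qed.

Lemma L2_cvgP (u : nat -> cfun) f : (forall k, L2 (u k)) -> L2 f ->
  L2_cvg mu u f <->
  (fun k => ip (fun x => u k x - f x) (fun x => u k x - f x)) @ \oo --> (0 : R).
Proof.
move=> Lu Lf; rewrite /L2_cvg.
have -> : (fun k => cLnorm mu 2%:E (fun x => u k x - f x)) =
    (EFin \o (fun k => Num.sqrt (ip (fun x => u k x - f x) (fun x => u k x - f x)))).
  by apply/funext => k /=; rewrite cLnorm2_sqrt//; exact: L2B.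
split=> [/fine_cvgP[_ /=]|] h.
  have -> : (fun k => ip (fun x => u k x - f x) (fun x => u k x - f x)) =
    (fun k => Num.sqrt (ip (fun x => u k x - f x) (fun x => u k x - f x)) ^+ 2).
    by apply/funext => k; rewrite sqr_sqrtr ?ip_ge0.
  have -> : 0 = (0 : R) * 0 by rewrite mulr0.
  exact: (cvgM h h).
apply/fine_cvgP; split; first by apply: nearW.
exact: sqrt_cvg0.
Qed.

Lemma ip_cvg (u : nat -> cfun) f h : (forall k, L2 (u k)) -> L2 f -> L2 h ->
  L2_cvg mu u f -> (fun k => ip (u k) h) @ \oo --> ip f h.
Proof.
move=> Lu Lf Lh /(L2_cvgP Lu Lf) uf.
pose r k := Num.sqrt (ip (fun x => u k x - f x) (fun x => u k x - f x)).
have r0 : r @ \oo --> (0 : R).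
  exact: sqrt_cvg0.
have rh : (fun k => r k * Num.sqrt (ip h h)) @ \oo --> (0 : R).
  by have := cvgM r0 (cvg_cst (Num.sqrt (ip h h))); rewrite mul0r; exact.
apply: (@squeeze_cvgr _ _ _ _ (fun k => ip f h - r k * Num.sqrt (ip h h))
  (fun k => ip f h + r k * Num.sqrt (ip h h))).
- apply: nearW => k; have := ip_CS (L2B (Lu k) Lf) Lh.
  by rewrite ipBl// -/(r k) ler_distl.
- by rewrite -[X in _ --> X]subr0; apply: cvgB => //; exact: cvg_cst.
- by rewrite -[X in _ --> X]addr0; apply: cvgD => //; exact: cvg_cst.
Qed.

Lemma ip_cvg2 (u v : nat -> cfun) f g : (forall k, L2 (u k)) -> L2 f ->
  (forall k, L2 (v k)) -> L2 g -> L2_cvg mu u f -> L2_cvg mu v g ->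
  (fun k => ip (u k) (v k)) @ \oo --> ip f g.
Proof.
move=> Lu Lf Lv Lg uf vg.
pose r k := Num.sqrt (ip (fun x => u k x - f x) (fun x => u k x - f x)).
pose s k := Num.sqrt (ip (fun x => v k x - g x) (fun x => v k x - g x)).
have r0 : r @ \oo --> (0 : R).
  exact/sqrt_cvg0/L2_cvgP.
have s0 : s @ \oo --> (0 : R).
  exact/sqrt_cvg0/L2_cvgP.
have rs : (fun k => r k * s k) @ \oo --> (0 : R).
  by rewrite -(mul0r (0 : R)); exact: cvgM.
have d0 : (fun k => ip (fun x => u k x - f x) (fun x => v k x - g x)) @ \oo --> (0 : R).
  apply: (@squeeze_cvgr _ _ _ _ (fun k => 0 - r k * s k) (fun k => 0 + r k * s k)).
  - apply: nearW => k; have := ip_CS (L2B (Lu k) Lf) (L2B (Lv k) Lg).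
    by rewrite -[X in `|X|]subr0 -/(r k) -/(s k) ler_distl.
  - by rewrite -[X in _ --> X]subr0; apply: cvgB => //; exact: cvg_cst.
  - by rewrite -[X in _ --> X]addr0; apply: cvgD => //; exact: cvg_cst.
have uvE : (fun k => ip (u k) (v k)) = (fun k =>
    ip (fun x => u k x - f x) (fun x => v k x - g x) + ip (u k) g + ip (v k) f - ip f g).
  apply/funext => k; have Lvg := L2B (Lv k) Lg.
  rewrite ipBl// !ipBr// (ipC (v k) f); ring.
rewrite uvE [X in _ --> X](_ : _ = 0 + ip f g + ip g f - ip f g); last first.
  rewrite (ipC g f); ring.
have ug := ip_cvg Lu Lf Lg uf; have vf := ip_cvg Lv Lg Lf vg.
by apply: cvgB; [apply: cvgD => //; exact: cvgD|exact: cvg_cst].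
Qed.

End SquareIntegrable.

(** * Almost everywhere convergence *)

Section Completeness.

Lemma geometric_increments_cvg (R : realType) (w : nat -> R) (C : R) :
  (forall k, `|w k.+1 - w k| <= C * 2^-1 ^+ k) -> cvgn w.
Proof.
move=> hw.
have C0 : 0 <= C by have := hw 0%N; rewrite expr0 mulr1; exact: le_trans.
have : cvgn (series (telescope w)).
  apply: normed_cvg; apply: (@series_le_cvg _ _ (geometric C 2^-1)).
  - by move=> k /=.
  - by move=> k /=; rewrite mulr_ge0// exprn_ge0.
  - by move=> k /=; exact: hw.
  - by apply: is_cvg_geometric_series; rewrite ger0_norm// invf_lt1// ltr1n.
move=> /cvg_ex[l hl]; apply/cvg_ex; exists (w 0%N + l).
have wl := cvgD (cvg_cst (w 0%N)) hl.
apply: (@cvg_trans _ ((w 0%N + series (telescope w) k) @[k --> \oo])); last exact: wl.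
by apply: near_eq_cvg; apply: nearW => k; rewrite /= -eq_sum_telescope.
Qed.

Context {d} {T : measurableType d} {R : realType}.
Variable mu : {measure set T -> \bar R}.
Local Notation cfun := (T -> R[i]).
Local Notation L2 := (in_Lp mu 2%:E).
Local Notation Re := (@complex.Re R).
Local Notation Im := (@complex.Im R).
Implicit Types (f g h : cfun) (u v : nat -> cfun).

Definition ae_cvg u f : Prop := {ae mu, forall x,
  ((fun k => Re (u k x)) @ \oo --> Re (f x)) /\
  ((fun k => Im (u k x)) @ \oo --> Im (f x))}.

(** The series of 4^k |v_(k+1) - v_k|^2 has a finite integral, hence is
finite almost everywhere; there the increments are O(2^-k) and v converges. *)
Lemma fast_ae_cvg v : (forall k, L2 (v k)) ->
  (forall k, ip mu (fun x => v k.+1 x - v k x) (fun x => v k.+1 x - v k x)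
    <= 16^-1 ^+ k) ->
  exists f, cmeasurable setT f /\ ae_cvg v f.
Proof.
move=> Lv hv.
pose a k x := rdot (v k.+1 x - v k x) (v k.+1 x - v k x).
have La k := L2B (Lv k.+1) (Lv k).
pose G k x := (4 ^+ k * a k x)%:E.
have G0 k x : (0 <= G k x)%E by rewrite lee_fin mulr_ge0 ?exprn_ge0 ?rdot_ge0.
have mG k : measurable_fun setT (G k).
  apply/measurable_EFinP; apply: measurable_funM => //.
  by apply: measurable_rdot; exact: L2_cmeas (La k).
have IG k : (\int[mu]_x G k x <= (4^-1 ^+ k)%:E)%E.
  rewrite /G; under eq_integral do rewrite EFinM.
  rewrite ge0_integralZl_EFin//; last 2 first.
  - by move=> x _; rewrite lee_fin rdot_ge0.
  - by apply/measurable_EFinP; apply: measurable_rdot; exact: L2_cmeas (La k).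
  rewrite ipE// -EFinM lee_fin (le_trans (ler_wpM2l _ (hv k))) ?exprn_ge0//.
  by rewrite -exprMn (_ : 4 / 16 = 4^-1 :> R)//; field.
have mS : measurable_fun setT (fun x => \sum_(k <oo) G k x)%E.
  by apply: ge0_emeasurable_sum => //; exact: mG.
have S0 x : (0 <= \sum_(k <oo) G k x)%E by apply: nneseries_ge0 => *; exact: G0.
have iS : mu.-integrable setT (fun x => \sum_(k <oo) G k x)%E.
  apply/integrableP; split => //.
  under eq_integral do rewrite gee0_abs//.
  rewrite integral_nneseries//.
  apply: (@le_lt_trans _ _ 2%:E); last exact: ltry.
  apply: lime_le.
    by apply: is_cvg_nneseries => *; exact: integral_ge0.
  apply: nearW => n; apply: (@le_trans _ _ (2 - 4 / 3 * 4^-1 ^+ n)%:E).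
    elim: n => [|n IH]; first by rewrite big_geq// expr0 lee_fin mulr1; lra.
    rewrite big_nat_recr//=; apply: le_trans (leeD IH (IG n)) _.
    by rewrite -EFinD lee_fin exprS; lra.
  by rewrite lee_fin gerBl mulr_ge0// exprn_ge0.
pose f x : R[i] := fine (limn_esup (fun k => (Re (v k x))%:E))
  +i* fine (limn_esup (fun k => (Im (v k x))%:E)).
exists f; split.
  split; apply: measurableT_comp => //; apply: measurable_fun_limn_esup => k;
  by apply/measurable_EFinP; have [] := L2_cmeas (Lv k).
have := integrable_ae measurableT iS; apply: filterS => x /(_ I) fS.
have cvgv w : (forall k, (w k.+1 - w k) ^+ 2 <= a k x) ->
    w @ \oo --> fine (limn_esup (EFin \o w)).
  move=> wa; have cw : cvgn w.
    pose C := fine (\sum_(k <oo) G k x)%E.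
    apply: (@geometric_increments_cvg _ _ (Num.sqrt C)) => k.
    have C0 : 0 <= C by rewrite fine_ge0.
    have aC : 4 ^+ k * a k x <= C.
      rewrite -lee_fin /C fineK//.
      have := @nneseries_lim_ge _ (G ^~ x) xpredT 0 k.+1 (fun n _ _ => G0 n x).
      apply: le_trans; rewrite big_nat_recr//= leeDr//.
      by apply: sume_ge0 => i _; exact: (G0 i x).
    rewrite -(@ler_pXn2r _ 2)// ?nnegrE ?mulr_ge0 ?sqrtr_ge0 ?exprn_ge0//.
    rewrite real_normK ?num_real// (le_trans (wa k))// exprMn sqr_sqrtr//.
    rewrite -exprM mulnC exprM.
    have -> : (2^-1 : R) ^+ 2 = 4^-1 by rewrite exprVn; congr _^-1; ring.
    by rewrite exprVn ler_pdivlMr ?exprn_gt0// mulrC.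
  move/cvg_ex : cw => [l hl].
  have : (EFin \o w) @ \oo --> l%:E by exact: cvg_EFin (nearW _ _) hl.
  by move=> /cvg_limn_einf_sup[_ ->].
have ReB z w : Re (z - w) = Re z - Re w by case: z w => [? ?] [].
have ImB z w : Im (z - w) = Im z - Im w by case: z w => [? ?] [].
split; apply: cvgv => k; rewrite /a /rdot ReB ImB -!expr2.
  by rewrite lerDl sqr_ge0.
by rewrite lerDr sqr_ge0.
Qed.

Lemma cvg_rdot (z w : nat -> R[i]) (a b : R[i]) :
  (fun k => Re (z k)) @ \oo --> Re a -> (fun k => Im (z k)) @ \oo --> Im a ->
  (fun k => Re (w k)) @ \oo --> Re b -> (fun k => Im (w k)) @ \oo --> Im b ->
  (fun k => rdot (z k) (w k)) @ \oo --> rdot a b.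
Proof. by move=> *; apply: cvgD; exact: cvgM. Qed.

(** Fatou's lemma for integrals which are only bounded in the limit. *)
Lemma fatou_ae (h : nat -> T -> R) (k : T -> R) (C : R) :
  (forall n, measurable_fun setT (h n)) -> measurable_fun setT k ->
  (forall n x, 0 <= h n x) -> (forall x, 0 <= k x) ->
  {ae mu, forall x, (h ^~ x) @ \oo --> k x} ->
  (forall e : R, 0 < e -> \forall n \near \oo, (\int[mu]_x (h n x)%:E <= (C + e)%:E)%E) ->
  (\int[mu]_x (k x)%:E <= C%:E)%E.
Proof.
move=> mh mk h0 k0 hk hC.
have mEh n : measurable_fun setT (EFin \o h n) by exact/measurable_EFinP.
apply: (@le_trans _ _ (\int[mu]_x limn_einf (fun n => (h n x)%:E))%E).
  apply: ae_ge0_le_integral => //.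
  - by move=> x _; rewrite lee_fin.
  - exact/measurable_EFinP.
  - by move=> x _; rewrite limn_einf_lim; apply: lime_ge;
      [exact: is_cvg_einfs|apply: nearW => n; apply: le_ereal_inf_tmp => _ [m _ <-];
       rewrite lee_fin].
  - rewrite (_ : (fun x => limn_einf (fun n => (h n x)%:E)) = (fun x => - limn_esup (fun n => - (h n x)%:E))%E).
      apply: measurableT_comp => //; apply: measurable_fun_limn_esup => n.
      have : measurable_fun setT (EFin \o (fun x => - h n x)).
        by apply/measurable_EFinP; exact: measurable_funN.
      exact.
    apply/funext => x.
    by have := limn_esupN (fun n => (h n x)%:E); rewrite /comp/= => ->; rewrite oppeK.
  apply: filterS hk => x hk _.
  have : (fun n => (h n x)%:E) @ \oo --> (k x)%:E by exact: cvg_EFin (nearW _ _) hk.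
  by move=> /cvg_limn_einf_sup[-> _].
apply: le_trans (fatou mu measurableT mEh _) _; first by move=> n x _; rewrite lee_fin.
apply/lee_addgt0Pr => e e0; rewrite limn_einf_lim; apply: lime_le.
  exact: is_cvg_einfs.
apply: filterS (hC _ e0) => n; apply: le_trans.
by apply: ereal_inf_lbound; exists n => //=.
Qed.

End Completeness.

(** * Completeness and projections in L^2 *)

Lemma cvg_seq_ge (R : realType) (w : nat -> R) (l c : R) : w @ \oo --> l ->
  (forall k, c <= w k) -> c <= l.
Proof.
move=> wl h; rewrite -(cvg_lim (@norm_hausdorff _ _) wl).
by apply: limr_ge; [exact: cvgP wl|exact: nearW].
Qed.

Section Projection.
Context {d} {T : measurableType d} {R : realType}.
Variable mu : {measure set T -> \bar R}.
Local Notation cfun := (T -> R[i]).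
Local Notation L2 := (in_Lp mu 2%:E).
Local Notation Re := (@complex.Re R).
Local Notation Im := (@complex.Im R).
Local Notation ip := (ip mu).
Local Notation nsq f := (ip f f).
Implicit Types (f g h : cfun) (u v : nat -> cfun).

Definition L2_cauchy u : Prop := forall e : R, 0 < e -> exists K, forall i j,
  (K <= i)%N -> (K <= j)%N ->
  nsq (fun x => u i x - u j x) <= e.

(** A subsequence with fast decreasing distances converges almost
everywhere, and Fatou's lemma identifies its limit with the L^2 limit of the
whole sequence. *)
Lemma L2_complete u : (forall k, L2 (u k)) -> L2_cauchy u ->
  exists f (phi : nat -> nat),
  [/\ L2 f, forall k, (k <= phi k)%N, L2_cvg mu u f & ae_cvg mu (u \o phi) f].
Proof.
move=> Lu cu.
have /choice[K hK] : forall k, exists K, forall i j, (K <= i)%N -> (K <= j)%N ->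
    nsq (fun x => u i x - u j x) <= 16^-1 ^+ k by move=> k; apply: cu; rewrite exprn_gt0.
(* The summand k keeps phi cofinal when all the K i vanish. *)
pose phi k := (k + \sum_(i < k.+1) K i)%N.
have phiS k : (phi k <= phi k.+1)%N by rewrite /phi [X in (_ <= _ + X)%N]big_ord_recr/= leq_add// leq_addr.
have phiK k : (K k <= phi k)%N.
  by rewrite /phi big_ord_recr/= addnA leq_addl.
have phi_ge k : (k <= phi k)%N by rewrite leq_addr.
have [f [mf vf]] : exists f, cmeasurable setT f /\ ae_cvg mu (u \o phi) f.
  apply: fast_ae_cvg => [k|k]; first exact: Lu.
  by apply: hK => //; apply: leq_trans (phiK k) (phiS k).
have dist i (C : R) N : (forall j, (N <= j)%N -> nsq (fun x => u i x - u j x) <= C) ->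
    (\int[mu]_x (rdot (u i x - f x) (u i x - f x))%:E <= C%:E)%E.
  move=> hC; apply: (@fatou_ae _ _ _ _
    (fun n x => rdot (u i x - u (phi n) x) (u i x - u (phi n) x))).
  - by move=> n; apply: measurable_rdot; exact: L2_cmeas (L2B (Lu i) (Lu _)).
  - by apply: measurable_rdot; exact: cmeasurableB (L2_cmeas (Lu i)) mf.
  - by move=> n x; exact: rdot_ge0.
  - by move=> x; exact: rdot_ge0.
  - have ReB z w : Re (z - w) = Re z - Re w by case: z w => [? ?] [].
    have ImB z w : Im (z - w) = Im z - Im w by case: z w => [? ?] [].
    apply: filterS vf => x [rf jf]; apply: cvg_rdot;
      (under eq_fun do rewrite ReB ImB) || idtac;
      rewrite ?ReB ?ImB; (under eq_fun do rewrite ?ReB ?ImB);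
      apply: cvgB => //; exact: cvg_cst.
  move=> e e0; exists N => // n /= Nn.
  rewrite ipE; last exact: L2B.
  by rewrite lee_fin (le_trans (hC _ _))// ?lerDl ?ltW// (leq_trans Nn).
have Lf : L2 f.
  have LB : L2 (fun x => u (phi 0%N) x - f x).
    apply/L2P; split; first exact: cmeasurableB (L2_cmeas (Lu _)) mf.
    apply/integrableP; split.
      by apply/measurable_EFinP/measurable_rdot; exact: cmeasurableB (L2_cmeas (Lu _)) mf.
    under eq_integral => x _ do rewrite /= ger0_norm ?rdot_ge0//.
    apply: le_lt_trans (dist (phi 0%N) (16^-1 ^+ 0) (K 0%N) _) (ltry _) => j hj.
    exact: hK.
  have := L2B (Lu (phi 0%N)) LB; congr L2.
  by apply/funext => x; rewrite opprB addrC subrK.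
exists f, phi; split => //; apply/L2_cvgP => //; apply/cvgrPdist_le => e e0.
have [N hN] := cu _ e0; exists N => // i /= Ni.
rewrite sub0r normrN ger0_norm ?ip_ge0// -lee_fin -ipE; last exact: L2B.
by apply: (dist _ _ N) => j Nj; exact: hN.
Qed.

Lemma parallelogram f g h : L2 f -> L2 g -> L2 h ->
  nsq (fun x => g x - h x) = 2 * nsq (fun x => f x - g x) + 2 * nsq (fun x => f x - h x)
    - 4 * nsq (fun x => f x - (2^-1%:C * (g x + h x))).
Proof.
move=> Lf Lg Lh; have Lgh := L2D Lg Lh; have Lm := L2Z 2^-1%:C Lgh.
have Lfg := L2B Lf Lg; have Lfh := L2B Lf Lh; have Lhg := L2B Lg Lh.
have Lfm := L2B Lf Lm.
rewrite !ipBl// !ipBr// !ipZl// !ipZr// !ipDl// !ipDr//.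
rewrite (ipC _ g f) (ipC _ h f) (ipC _ h g); by field.
Qed.

(** Minimizing sequences of the distance to P are Cauchy by the
parallelogram identity. The limit need not belong to P, so orthogonality comes
from comparing f - u_k with f - u_k - a h, where u_k is in P, and letting k
grow. *)
Lemma L2_projection (P : cfun -> Prop) f : (exists g, P g) ->
  (forall g, P g -> L2 g) ->
  (forall (a : R) g h, P g -> P h -> P (fun x => g x + a%:C * h x)) ->
  (forall (a : R) g, P g -> P (fun x => a%:C * g x)) -> L2 f ->
  exists u g, [/\ forall k, P (u k), L2 g, L2_cvg mu u g &
    forall h, P h -> ip (fun x => f x - g x) h = 0].
Proof.
move=> [p0 Pp0] PL PD PZ Lf.
pose S := [set nsq (fun x => f x - g x) | g in P].
have S0 : has_inf S.
  split; first by exists (nsq (fun x => f x - p0 x)), p0.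
  by exists 0 => _ [g _ <-]; exact: ip_ge0.
pose D := inf S.
have DP g : P g -> D <= nsq (fun x => f x - g x).
  by move=> Pg; apply: ge_inf; [exact: S0.2|exists g].
have /choice[u hu] : forall k : nat, exists g, P g /\
    nsq (fun x => f x - g x) <= D + k.+1%:R^-1.
  move=> k; have [] := @inf_adherent _ S k.+1%:R^-1; rewrite ?invr_gt0 ?ltr0n//.
  by move=> _ [g Pg <-] /ltW ?; exists g.
have Lu k : L2 (u k) by exact/PL/(hu k).1.
have cu : L2_cauchy u.
  move=> e e0; have e40 : 0 < e / 4 by rewrite divr_gt0.
  pose N := Num.bound (e / 4)^-1.
  have hN k : (N <= k)%N -> k.+1%:R^-1 <= e / 4.
    move=> Nk; rewrite -[leRHS]invrK lef_pV2 ?posrE ?invr_gt0 ?ltr0n//.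
    have := archi_boundP (ltW (_ : 0 < (e / 4)^-1)); rewrite invr_gt0 => /(_ e40) /ltW.
    by move=> /le_trans; apply; rewrite ler_nat (leq_trans Nk).
  exists N => i j Ni Nj; rewrite (parallelogram Lf (Lu i) (Lu j)).
  have [Pi hi] := hu i; have [Pj hj] := hu j.
  have Pm : P (fun x => 2^-1%:C * (u i x + u j x)).
    rewrite (_ : (fun _ => _) = (fun x => 2^-1%:C * (u i x + 1%:C * u j x))).
      exact/PZ/PD.
    by apply/funext => x; rewrite mul1r.
  have := DP _ Pm; have := hN _ Ni; have := hN _ Nj; move: hi hj.
  move: i.+1%:R^-1 j.+1%:R^-1 => *; lra.
have [g [_ [Lg _ ug _]]] := L2_complete Lu cu.
exists u, g; split => //; first by move=> k; exact: (hu k).1.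
move=> h Ph; have Lh := PL _ Ph; have Lfg := L2B Lf Lg.
have key a : 0 <= a ^+ 2 * nsq h - 2 * a * ip (fun x => f x - g x) h.
  (* The slack 1 / (k + 1) is the excess of u_k over the infimum. *)
  have cv : (fun k => a ^+ 2 * nsq h - 2 * a * (ip f h - ip (u k) h) + k.+1%:R^-1) @ \oo
      --> a ^+ 2 * nsq h - 2 * a * (ip f h - ip g h) + 0.
    apply: cvgD; last exact: cvg_harmonic.
    apply: cvgB; first exact: cvg_cst.
    apply: cvgM; first exact: cvg_cst.
    by apply: cvgB; [exact: cvg_cst|exact: ip_cvg].
  rewrite ipBl// -[leRHS]addr0; apply: cvg_seq_ge cv _ => k; have [Pk hk] := hu k.
  have := DP _ (PD a _ _ Pk Ph).
  have Lk := Lu k; have Lah := L2Z a%:C Lh; have Lkh := L2D Lk Lah.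
  have Lfk := L2B Lf Lk; have Lfkh := L2B Lf Lkh.
  move: hk; rewrite !ipBl// !ipBr// !ipDl// !ipDr// !ipZl// !ipZr//.
  rewrite (ipC _ (u k) f) (ipC _ h f) (ipC _ h (u k)).
  move: k.+1%:R^-1 => e h1 h2; lra.
set t := ip (fun x => f x - g x) h in key *.
have [h0|h0] := eqVneq (nsq h) 0.
  have := key t; have := key (- t); rewrite h0 !mulr0 => h1 h2.
  by apply/eqP; rewrite -sqrf_eq0 eq_le sqr_ge0 andbT; lra.
have hp : 0 < nsq h by rewrite lt_def h0 ip_ge0.
have := key (t / nsq h).
have -> : (t / nsq h) ^+ 2 * nsq h - 2 * (t / nsq h) * t = - (t ^+ 2 / nsq h) by field.
rewrite oppr_ge0 pmulr_lle0 ?invr_gt0// => t0.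
by apply/eqP; rewrite -sqrf_eq0 eq_le t0 sqr_ge0.
Qed.

End Projection.

(** * Dissipativity on test functions *)

Lemma powR_cvg (R : realType) (w : nat -> R) (l c : R) : 0 < l ->
  w @ \oo --> l -> (fun k => w k `^ c) @ \oo --> l `^ c.
Proof.
move=> l0 wl; have [+ _] := @is_derive1_powR R c l l0.
move=> /derivable1_diffP/differentiable_continuous cl.
exact: (@continuous_cvg _ _ _ \oo _ w (fun z => z `^ c) l cl wl).
Qed.

Lemma trunc_cvg (R : realType) (q s : R) : 0 < s ->
  (fun k : nat => trunc k.+1%:R^-1 q s) @ \oo --> s * s `^ (- q).
Proof.
move=> s0; apply: cvgM; first exact: cvg_cst.
apply: powR_cvg => //; rewrite -[X in _ --> X]add0r.
by apply: cvgD; [exact: cvg_harmonic|exact: cvg_cst].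
Qed.

Section CoreDissipativity.
Variables (R : realType) (M : ptopologicalType) (n : nat).
Variables (A : set (chart R M n)) (Delta : (M -> R) -> M -> R) (V : M -> R).
Variable mu : {measure set (borel M) -> \bar R}.
Hypothesis hM : smooth_manifold A.
Hypothesis hDelta : diffusion_operator A Delta.
Hypothesis hV : forall x, V x <= 0.
Local Notation L := (schroedinger Delta V).
Local Notation core := (schroedinger_core A Delta V).
Hypothesis hL : essentially_self_adjoint mu core.
Local Notation cfun := (borel M -> R[i]).
Local Notation L2 := (in_Lp mu 2%:E).
Implicit Types (a b f g : M -> R) (u w : cfun).

Lemma test_trunc e q f : 0 < e -> (forall x, 0 <= f x) ->
  test_function A f -> test_function A (fun x => trunc e q (f x)).
Proof.
move=> e0 f0 [sf cf]; split; first exact: smooth_trunc.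
apply: subclosed_compact cf _; first exact: closed_closure.
apply: closure_subset => x /=; apply: contra => /eqP ->.
by rewrite /trunc mul0r.
Qed.

Lemma core_L2 u w : core (u, w) -> L2 u /\ L2 w.
Proof. by have [+ _ _ _] := hL; exact. Qed.

Lemma core_test a b : test_function A a -> test_function A b ->
  core ((fun x => a x +i* b x), (fun x => L a x +i* L b x)).
Proof. by move=> ta tb; exists a, b. Qed.

Lemma core_real a : test_function A a ->
  core ((fun x => (a x)%:C), (fun x => (L a x)%:C)).
Proof.
move=> ta; have := core_test ta (test_function0 hM).
by rewrite (schroedinger0 V hM hDelta).
Qed.

Lemma integrable_test a b : test_function A a -> test_function A b ->
  mu.-integrable setT (EFin \o (fun x => a x * L b x)).
Proof.
move=> /core_real/core_L2[La _] /core_real/core_L2[_ Lb].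
have := integrable_rdot La Lb; apply: eq_integrable => // x _ /=.
by rewrite /rdot/= mulr0 addr0.
Qed.

Lemma int_test_sym a b : test_function A a -> test_function A b ->
  \int[mu]_x (a x * L b x) = \int[mu]_x (b x * L a x).
Proof.
move=> /core_real ca /core_real cb; have [_ _ sym _] := hL.
have := congr1 (@complex.Re R) (sym _ _ _ _ ca cb); rewrite !Re_inner.
move=> E; transitivity (ip mu (fun x => (a x)%:C) (fun x => (L b x)%:C)).
  by apply: eq_Rintegral => x _; rewrite /rdot/= mulr0 addr0.
by rewrite -E; apply: eq_Rintegral => x _; rewrite /rdot/= mulr0 addr0 mulrC.
Qed.

(** The symmetry of L on test functions is applied to the pairs
(psi, a^2) and (a, psi a). *)
Lemma int_parts_defect psi a : test_function A psi -> test_function A a ->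
  mu.-integrable setT (EFin \o parts_defect L psi a) /\
  \int[mu]_x parts_defect L psi a x = - 2 * \int[mu]_x (psi x * (a x * L a x)).
Proof.
move=> tp ta; have taa := test_functionM hM ta.1 ta.
have tpa := test_functionM hM tp.1 ta.
have i1 := integrable_test tp taa; have i2 := integrable_test taa tp.
have i3 := integrable_test ta tpa; have i4 := integrable_test tpa ta.
have i12 := integrableB measurableT i1 i2.
have i123 := integrableD measurableT i12 i3.
have i5 := integrableZl measurableT 3 i4.
have i := integrableB measurableT i123 i5.
have E x : parts_defect L psi a x = psi x * L (fun y => a y * a y) x -
    a x * a x * L psi x + a x * L (fun y => psi y * a y) x -
    3 * (psi x * a x * L a x) by rewrite /parts_defect !mulrA.
split; first by apply: eq_integrable i => // x _ /=; rewrite E.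
under eq_Rintegral do rewrite E.
rewrite RintegralB// RintegralD// RintegralB// RintegralZl//.
rewrite (int_test_sym tp taa) (int_test_sym ta tpa).
under [in RHS]eq_Rintegral do rewrite mulrA.
move: (\int[mu]_x _) (\int[mu]_x _) => s t; ring.
Qed.

Lemma core_trunc_le0 e q u w : 0 < e -> 0 <= q -> q <= 3 / 2 -> core (u, w) ->
  \int[mu]_x (trunc e q (rdot (u x) (u x)) * rdot (u x) (w x)) <= 0.
Proof.
move=> e0 q0 q32 [a [b [ta tb /= -> ->]]].
pose s x := a x * a x + b x * b x.
have s0 x : 0 <= s x by rewrite addr_ge0// -expr2 sqr_ge0.
have ts := test_functionD hM (test_functionM hM ta.1 ta) (test_functionM hM tb.1 tb).
pose psi x := trunc e q (s x).
have tp : test_function A psi by exact: test_trunc.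
have [ia Ia] := int_parts_defect tp ta; have [ib Ib] := int_parts_defect tp tb.
have : 0 <= \int[mu]_x (parts_defect L psi a x + parts_defect L psi b x).
  by apply: Rintegral_ge0 => x _; exact: (schroedinger_defect_ge0 hM hDelta hV x e0 q0 q32 ta.1 tb.1).
rewrite RintegralD// Ia Ib -mulrDr mulNr oppr_ge0 pmulr_rle0//; apply: le_trans.
have i1 := integrable_test (test_functionM hM tp.1 ta) ta.
have i2 := integrable_test (test_functionM hM tp.1 tb) tb.
under eq_Rintegral do rewrite mulrA.
under [X in _ <= _ + X]eq_Rintegral do rewrite mulrA.
rewrite -RintegralD// le_eqVlt; apply/orP; left; apply/eqP.
by apply: eq_Rintegral => x _; rewrite /psi /s /rdot/= mulrDr !mulrA.
Qed.

(** The case q = 1, where the weight s / (e + s) tends to 1 as e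
tends to 0. *)
Lemma core_le0 u w : core (u, w) -> ip mu u w <= 0.
Proof.
move=> cuw; have [Lu Lw] := core_L2 cuw.
pose t k x := trunc k.+1%:R^-1 1 (rdot (u x) (u x)) * rdot (u x) (w x).
have iuw := integrable_rdot Lu Lw.
have muu := measurable_rdot (L2_cmeas Lu) (L2_cmeas Lu).
have mt k : measurable_fun setT (EFin \o t k).
  apply/measurable_EFinP; apply: measurable_funM.
    apply: measurable_funM => //.
    apply: (measurableT_comp (measurable_powR _)).
    exact: measurable_funD.
  exact: measurable_rdot (L2_cmeas Lu) (L2_cmeas Lw).
have k0 k : 0 < k.+1%:R^-1 :> R by rewrite invr_gt0 ltr0n.
have truncE k s : 0 <= s -> trunc k.+1%:R^-1 1 s = s / (k.+1%:R^-1 + s) :> R.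
  by move=> s0; rewrite /trunc powR_inv1// addr_ge0// ltW.
have tle k x : `|t k x| <= `|rdot (u x) (w x)|.
  rewrite normrM -[leRHS]mul1r ler_wpM2r// ger0_norm; last first.
    by rewrite mulr_ge0 ?rdot_ge0 ?powR_ge0.
  rewrite truncE ?rdot_ge0// ler_pdivrMr ?mul1r ?lerDr ?ltW//.
  by rewrite ltr_pwDl// rdot_ge0.
have H : (\int[mu]_x (EFin \o t k) x @[k --> \oo] -->
    \int[mu]_x (EFin \o (fun x => rdot (u x) (w x))) x)%E.
  apply: (@dominated_cvg _ _ _ mu setT measurableT (fun k => EFin \o t k)
    (EFin \o (fun x => rdot (u x) (w x)))
    (abse \o (EFin \o (fun x => rdot (u x) (w x))))) => //.
  - move=> x _; apply: cvg_EFin; first exact: nearW.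
    rewrite /comp/=; have [u0|u0] := eqVneq (u x) 0.
      rewrite (_ : (fun k => t k x) = fun=> rdot (u x) (w x)); first exact: cvg_cst.
      by apply/funext => k; rewrite /= /t u0 /rdot/= !mul0r addr0 mulr0.
    have s0 : 0 < rdot (u x) (u x).
      by rewrite lt_def rdot_ge0 andbT; apply: contra u0 => /eqP/rdot_eq0 ->.
    rewrite /t -[X in _ --> X]mul1r; apply: cvgM; last exact: cvg_cst.
    by have := @trunc_cvg R 1 _ s0; rewrite powR_inv1 ?ltW// divff ?gt_eqF.
  - exact: integrable_abse.
  - by move=> k x _ /=; rewrite lee_fin.
have tint k : mu.-integrable setT (EFin \o t k).
  by apply: le_integrable iuw => // x _; rewrite /= lee_fin.
move: H; rewrite -(fineK (integrable_fin_num measurableT iuw)).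
move=> /fine_cvgP[_ /=]; rewrite -/(ip mu u w) => H.
rewrite -oppr_ge0; apply: (cvg_seq_ge (cvgN H)) => k /=.
by rewrite oppr_ge0; apply: (core_trunc_le0 _ _ _ cuw) => //; lra.
Qed.

End CoreDissipativity.

(** * The closure and its resolvents *)

Lemma cvg_seq_eq (R : realType) (v w : nat -> R) (l : R) : (forall k, v k = w k) ->
  v @ \oo --> l -> w @ \oo --> l.
Proof. by move=> /funext ->. Qed.

Lemma cvg_seqZ (R : realType) (w : nat -> R) (c l : R) : w @ \oo --> l ->
  (fun k => c * w k) @ \oo --> c * l.
Proof. by move=> wl; apply: cvgM => //; exact: cvg_cst. Qed.

Arguments cvg_seqZ {R w} c {l}.

Lemma eq_Re_Im (R : realType) (z1 z2 : R[i]) : complex.Re z1 = complex.Re z2 ->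
  complex.Im z1 = complex.Im z2 -> z1 = z2.
Proof. by case: z1 z2 => [? ?] [? ?] /= -> ->. Qed.

Section L2Limits.
Context {d} {T : measurableType d} {R : realType}.
Variable mu : {measure set T -> \bar R}.
Local Notation cfun := (T -> R[i]).
Local Notation L2 := (in_Lp mu 2%:E).
Local Notation ip := (ip mu).
Local Notation nsq f := (ip f f).
Implicit Types (f g h : cfun) (u v : nat -> cfun).

Lemma nsqD f g : L2 f -> L2 g ->
  nsq (fun x => f x + g x) <= 2 * (nsq f + nsq g).
Proof.
move=> Lf Lg; have := ip_le2 ltr01 Lf Lg; rewrite invr1 !mul1r => h.
have Lfg := L2D Lf Lg; rewrite ipDl// !ipDr// (ipC _ g f); lra.
Qed.

Lemma nsqZ (c : R[i]) f : L2 f -> nsq (fun x => c * f x) = rdot c c * nsq f.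
Proof.
move=> Lf; rewrite /ip -RintegralZl//; last exact: integrable_rdot.
by apply: eq_Rintegral => x _; rewrite rdotM.
Qed.

Lemma ip_muli f g : ip f (fun x => 'i%C * g x) = ip (fun x => - 'i%C * f x) g.
Proof.
apply: eq_Rintegral => x _; rewrite /rdot.
by case: (f x) (g x) => [? ?] [? ?]/=; ring.
Qed.

Lemma L2_cvg_ext u u' f : (forall k, u k = u' k) -> L2_cvg mu u f -> L2_cvg mu u' f.
Proof. by move=> /funext ->. Qed.

Lemma L2_cvgD u v f g : (forall k, L2 (u k)) -> (forall k, L2 (v k)) -> L2 f -> L2 g ->
  L2_cvg mu u f -> L2_cvg mu v g ->
  L2_cvg mu (fun k x => u k x + v k x) (fun x => f x + g x).
Proof.
move=> Lu Lv Lf Lg /(L2_cvgP Lu Lf) uf /(L2_cvgP Lv Lg) vg.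
apply/L2_cvgP; [by move=> k; exact: L2D|exact: L2D|].
have uv : (fun k => 2 * (nsq (fun x => u k x - f x) + nsq (fun x => v k x - g x)))
    @ \oo --> (0 : R).
  by rewrite -(mulr0 2); apply: cvg_seqZ; rewrite -(addr0 0); exact: cvgD.
apply: (squeeze_cvgr _ (cvg_cst 0) uv).
apply: nearW => k; rewrite ip_ge0/=.
apply: le_trans (nsqD (L2B (Lu k) Lf) (L2B (Lv k) Lg)).
by rewrite le_eqVlt; apply/orP; left; apply/eqP; congr ip; apply/funext => x; ring.
Qed.

Lemma L2_cvgZ (c : R[i]) u f : (forall k, L2 (u k)) -> L2 f ->
  L2_cvg mu u f -> L2_cvg mu (fun k x => c * u k x) (fun x => c * f x).
Proof.
move=> Lu Lf /(L2_cvgP Lu Lf) uf; apply/L2_cvgP; [by move=> k; exact: L2Z|exact: L2Z|].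
have := cvg_seqZ (rdot c c) uf; rewrite mulr0; apply: cvg_seq_eq => k.
rewrite -nsqZ; last exact: L2B.
by congr ip; apply/funext => x; rewrite mulrBr.
Qed.

Lemma L2_cvg_ae u f g : (forall k, L2 (u k)) -> L2 f -> L2 g ->
  {ae mu, forall x, f x = g x} -> L2_cvg mu u f -> L2_cvg mu u g.
Proof.
move=> Lu Lf Lg fg /(L2_cvgP Lu Lf) uf; apply/L2_cvgP => //.
move: uf; apply: cvg_seq_eq => k.
have La := L2B (Lu k) Lf; have Lb := L2B (Lu k) Lg.
have ab : {ae mu, forall x, u k x - f x = u k x - g x}.
  by apply: filterS fg => x ->.
by rewrite (eq_ip La Lb La ab) ipC (eq_ip La Lb Lb ab).
Qed.

End L2Limits.

Section Closure.
Variables (R : realType) (M : ptopologicalType) (n : nat).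
Variables (A : set (chart R M n)) (Delta : (M -> R) -> M -> R) (V : M -> R).
Variable mu : {measure set (borel M) -> \bar R}.
Hypothesis hM : smooth_manifold A.
Hypothesis hDelta : diffusion_operator A Delta.
Hypothesis hV : forall x, V x <= 0.
Local Notation L := (schroedinger Delta V).
Local Notation core := (schroedinger_core A Delta V).
Hypothesis hL : essentially_self_adjoint mu core.
Local Notation clos := (closure_op mu core).
Local Notation cfun := (borel M -> R[i]).
Local Notation L2 := (in_Lp mu 2%:E).
Local Notation ip := (ip mu).
Local Notation nsq f := (ip f f).
Implicit Types (u w f : cfun) (c : R[i]).

Lemma coreD u w u' w' : core (u, w) -> core (u', w') ->
  core ((fun x => u x + u' x), (fun x => w x + w' x)).
Proof.
move=> [a [b [ta tb /= -> ->]]] [a' [b' [ta' tb' /= -> ->]]].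
exists (fun x => a x + a' x), (fun x => b x + b' x); split => //=.
- exact: test_functionD.
- exact: test_functionD.
- rewrite (schroedingerD V hM hDelta ta.1 ta'.1).
  by rewrite (schroedingerD V hM hDelta tb.1 tb'.1).
Qed.

Lemma coreZ c u w : core (u, w) -> core ((fun x => c * u x), (fun x => c * w x)).
Proof.
move=> [a [b [ta tb /= -> ->]]]; case: c => p q.
have tZ k (f : M -> R) : test_function A f -> test_function A (fun x => k * f x).
  exact: (test_functionZ hM).
exists (fun x => p * a x + (- q) * b x), (fun x => p * b x + q * a x); split => //=.
- by apply: (test_functionD hM); exact: tZ.
- by apply: (test_functionD hM); exact: tZ.
- by apply/funext => x; rewrite mulNr.
rewrite (schroedingerD V hM hDelta (tZ p _ ta).1 (tZ (- q) _ tb).1).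
rewrite (schroedingerD V hM hDelta (tZ p _ tb).1 (tZ q _ ta).1).
rewrite !(schroedingerZ V hM hDelta _ ta.1) !(schroedingerZ V hM hDelta _ tb.1).
by apply/funext => x; rewrite mulNr.
Qed.

Lemma clos_L2 u w : clos (u, w) -> L2 u /\ L2 w.
Proof. by case. Qed.

Lemma core_seq_L2 (s : nat -> cfun * cfun) : (forall k, core (s k)) ->
  (forall k, L2 (s k).1) /\ (forall k, L2 (s k).2).
Proof.
move=> cs; split=> k; have := cs k; rewrite (surjective_pairing (s k));
by move=> /(core_L2 hL)[].
Qed.

Lemma closD u w u' w' : clos (u, w) -> clos (u', w') ->
  clos ((fun x => u x + u' x), (fun x => w x + w' x)).
Proof.
move=> [/= Lu Lw [s [cs su sw]]] [/= Lu' Lw' [t [ct tu tw]]].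
have [Ls1 Ls2] := core_seq_L2 cs; have [Lt1 Lt2] := core_seq_L2 ct.
split; [exact: L2D|exact: L2D|].
exists (fun k => ((fun x => (s k).1 x + (t k).1 x), (fun x => (s k).2 x + (t k).2 x))).
split => [k||]; [|exact: L2_cvgD|exact: L2_cvgD].
have := cs k; have := ct k.
rewrite (surjective_pairing (s k)) (surjective_pairing (t k)) => ? ?.
exact: coreD.
Qed.

Lemma closZ c u w : clos (u, w) -> clos ((fun x => c * u x), (fun x => c * w x)).
Proof.
move=> [/= Lu Lw [s [cs su sw]]]; have [Ls1 Ls2] := core_seq_L2 cs.
split; [exact: L2Z|exact: L2Z|].
exists (fun k => ((fun x => c * (s k).1 x), (fun x => c * (s k).2 x))).
split => [k||]; [|exact: L2_cvgZ|exact: L2_cvgZ].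
by have := cs k; rewrite (surjective_pairing (s k)) => /(coreZ c).
Qed.

Lemma clos_le0 u w : clos (u, w) -> ip u w <= 0.
Proof.
move=> [/= Lu Lw [s [cs su sw]]]; have [Ls1 Ls2] := core_seq_L2 cs.
rewrite -oppr_ge0; apply: (cvg_seq_ge (cvgN (ip_cvg2 Ls1 Lu Ls2 Lw su sw))) => k.
rewrite oppr_ge0; apply: (core_le0 hM hDelta hV hL).
by rewrite -surjective_pairing.
Qed.

Lemma clos_sym u w v z : clos (u, w) -> clos (v, z) -> ip w v = ip u z.
Proof.
have [_ _ _ [_ sa]] := hL; move=> cuw; rewrite -sa => -[/= _ _ /(_ _ _ cuw)].
by move=> /(congr1 (@complex.Re R)); rewrite !Re_inner.
Qed.

Variable kappa : R.
Hypothesis kappa0 : 0 < kappa.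

Definition resolvent_arg u w : cfun := fun x => u x - kappa^-1%:C * w x.

(** Expand the square: the cross term has the sign of
- <u, w> >= 0. *)
Lemma resolvent_arg_coercive u w : L2 u -> L2 w -> ip u w <= 0 ->
  nsq u <= nsq (resolvent_arg u w).
Proof.
move=> Lu Lw uw; have Lkw := L2Z kappa^-1%:C Lw.
have LB := L2B Lu Lkw.
rewrite /resolvent_arg ipBl// !ipBr// ipZl// (ipC _ _ u) ipZr// ipZl// ipZr//.
have k0 : 0 < kappa^-1 by rewrite invr_gt0.
rewrite -subr_ge0.
have -> : nsq u - kappa^-1 * ip u w - (kappa^-1 * ip u w - kappa^-1 * (kappa^-1 * nsq w))
   - nsq u = kappa^-1 * (2 * (- ip u w) + kappa^-1 * nsq w) by ring.
rewrite mulr_ge0 ?(ltW k0)// addr_ge0// mulr_ge0 ?oppr_ge0 ?(ltW k0)//.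
exact: ip_ge0.
Qed.

(** If h is orthogonal to the range of 1 - L / kappa on test
functions, then h is in the domain of the adjoint, with value kappa h. The
closure is its own adjoint and is dissipative, so kappa |h|^2 <= 0. *)
Lemma resolvent_dense f : L2 f -> exists s : nat -> cfun * cfun,
  (forall k, core (s k)) /\
  L2_cvg mu (fun k => resolvent_arg (s k).1 (s k).2) f.
Proof.
move=> Lf.
pose P v := exists u w, core (u, w) /\ v = resolvent_arg u w.
have PL v : P v -> L2 v.
  by move=> [u [w [/(core_L2 hL)[Lu Lw] ->]]]; apply: L2B => //; exact: L2Z.
have core0 : core ((fun=> 0), (fun=> 0)).
  have := core_real V hM hDelta (test_function0 hM).
  by rewrite (schroedinger0 V hM hDelta).
have PZ (a : R) g : P g -> P (fun x => a%:C * g x).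
  move=> [u [w [cuw ->]]]; exists (fun x => a%:C * u x), (fun x => a%:C * w x).
  split; first exact: coreZ.
  by apply/funext => x; rewrite /resolvent_arg mulrBr mulrCA.
have PD (a : R) g h : P g -> P h -> P (fun x => g x + a%:C * h x).
  move=> [u [w [cuw ->]]] /(PZ a)[u' [w' [cuw' E]]].
  exists (fun x => u x + u' x), (fun x => w x + w' x); split; first exact: coreD.
  apply/funext => x; have := congr1 (fun F => F x) E; rewrite /resolvent_arg/= => ->.
  by rewrite mulrDr opprD addrACA.
have P0 : exists g, P g by exists (resolvent_arg (fun=> 0) (fun=> 0)); do 2 eexists; split; [exact: core0|].
have [v [g [Pv Lg vg orth]]] := L2_projection P0 PL PD PZ Lf.
pose h x := f x - g x; have Lh : L2 h by exact: L2B.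
have hcore u w : core (u, w) -> ip w h = kappa * ip u h.
  move=> cuw; have [Lu Lw] := core_L2 hL cuw.
  have /orth : P (resolvent_arg u w) by exists u, w.
  have Lkw := L2Z kappa^-1%:C Lw.
  rewrite -/h ipC ipBl// ipZl// => /eqP; rewrite subr_eq0 => /eqP ->.
  by rewrite mulrA divff ?mul1r// gt_eqF.
have hclos u w : clos (u, w) -> ip w h = kappa * ip u h.
  move=> [/= Lu Lw [s [cs su sw]]]; have [Ls1 Ls2] := core_seq_L2 cs.
  have c1 := ip_cvg Ls2 Lw Lh sw.
  have c2 := cvg_seqZ kappa (ip_cvg Ls1 Lu Lh su).
  apply: (cvg_unique (@norm_hausdorff _ _) c1); apply: cvg_seq_eq c2 => k.
  rewrite -(hcore (s k).1 (s k).2)//.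
  by rewrite -surjective_pairing.
have Lkh := L2Z kappa%:C Lh.
have : adjoint_op mu clos (h, fun x => kappa%:C * h x).
  split => // u w cuw; have [Lu Lw] := clos_L2 cuw.
  apply: eq_Re_Im; first by rewrite !Re_inner/= ipZr// (hclos u).
  rewrite !Im_inner/=.
  rewrite !ip_muli (hclos _ _ (closZ (- 'i%C) cuw)) ipZr//; exact: L2Z.
have [_ _ _ [_ ->]] := hL => /clos_le0; rewrite ipZr// pmulr_rle0// => h0.
have /ip_eq0 hae : nsq h = 0 by apply/eqP; rewrite eq_le h0 ip_ge0.
have /choice[s hs] : forall k, exists p : cfun * cfun, core p /\ v k = resolvent_arg p.1 p.2.
  by move=> k; have [u [w [cuw vE]]] := Pv k; exists (u, w).
exists s; split; first by move=> k; exact: (hs k).1.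
apply: (@L2_cvg_ext _ _ _ _ v); first by move=> k; exact: (hs k).2.
apply: L2_cvg_ae vg => //; first by move=> k; exact/PL/Pv.
by apply: filterS (hae Lh) => x /eqP; rewrite subr_eq0 => /eqP ->.
Qed.

(** Coercivity turns the convergence of u_k - L u_k / kappa into
the Cauchy property of u_k. Almost everywhere convergence of the test functions
is recorded because L^p norms are only controlled through Fatou's lemma. *)
Lemma resolvent_exists f : L2 f -> exists (s : nat -> cfun * cfun) u,
  [/\ forall k, core (s k), L2 u,
      L2_cvg mu (fun k => resolvent_arg (s k).1 (s k).2) f,
      clos (u, fun x => kappa%:C * (u x - f x)) &
      ae_cvg mu (fun k => (s k).1) u].
Proof.
move=> Lf; have [s [cs sf]] := resolvent_dense Lf.
have [Ls1 Ls2] := core_seq_L2 cs.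
pose g k := resolvent_arg (s k).1 (s k).2.
have Lg k : L2 (g k) by apply: L2B => //; exact: L2Z.
have cauchy : L2_cauchy mu (fun k => (s k).1).
  move=> e e0; have e40 : 0 < e / 4 by rewrite divr_gt0.
  have /cvgrPdist_le/(_ _ e40)[N _ hN] := (L2_cvgP Lg Lf).1 sf.
  exists N => i j Ni Nj.
  have cij : core ((fun x => (s i).1 x - (s j).1 x), (fun x => (s i).2 x - (s j).2 x)).
    have E (F G : cfun) : (fun x => F x - G x) = (fun x => F x + (-1) * G x).
      by apply/funext => x; rewrite mulN1r.
    rewrite !E; apply: coreD; first by rewrite -surjective_pairing.
    by apply: coreZ; rewrite -surjective_pairing.
  have [Lc1 Lc2] := core_L2 hL cij.
  apply: (le_trans (resolvent_arg_coercive Lc1 Lc2 (core_le0 hM hDelta hV hL cij))).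
  have -> : resolvent_arg (fun x => (s i).1 x - (s j).1 x) (fun x => (s i).2 x - (s j).2 x)
     = (fun x => (g i x - f x) + (-1) * (g j x - f x)).
    by apply/funext => x; rewrite /g /resolvent_arg; ring.
  have Lif := L2B (Lg i) Lf; have Ljf := L2B (Lg j) Lf; have Ljf' := L2Z (-1) Ljf.
  apply: (le_trans (nsqD Lif Ljf')); rewrite nsqZ//.
  have -> : rdot (-1) (-1) = 1 :> R by rewrite /rdot/=; ring.
  have := hN _ Ni; have := hN _ Nj; rewrite /= !sub0r !normrN !ger0_norm ?ip_ge0//.
  rewrite -/(g i) -/(g j) => h1 h2; lra.
have [u [phi [Lu phi_ge su ae]]] := L2_complete Ls1 cauchy.
have phiC (v : nat -> cfun) w : L2_cvg mu v w -> L2_cvg mu (v \o phi) w.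
  move=> vw; apply: cvg_comp vw; move=> B [N _ hB]; exists N => // k /= Nk.
  by apply: hB; exact: leq_trans Nk (phi_ge k).
exists (s \o phi), u; split => //; first by move=> k; exact: cs.
  exact: phiC sf.
have LB := L2B Lu Lf.
split; [exact: Lu|exact: L2Z|exists s; split => //=].
apply: (@L2_cvg_ext _ _ _ _ (fun k x => kappa%:C * ((s k).1 x + (-1) * g k x))).
  move=> k; apply/funext => x; rewrite /g /resolvent_arg mulN1r opprB addrC subrK.
  by rewrite mulrA -rmorphM divff ?gt_eqF// rmorph1 mul1r.
apply: L2_cvgZ; [by move=> k; apply: L2D => //; exact: L2Z|exact: L2B|].
have -> : (fun x => u x - f x) = (fun x => u x + (-1) * f x).
  by apply/funext => x; rewrite mulN1r.
apply: L2_cvgD => //; [by move=> k; exact: L2Z|exact: L2Z|exact: L2_cvgZ].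
Qed.

End Closure.

(** * The resolvents contract L^p *)

Section TruncationBounds.
Variable R : realType.
Implicit Types (p q e r s y : R).

Lemma trunc_ge0 e q s : 0 <= s -> 0 <= trunc e q s.
Proof. by move=> s0; rewrite mulr_ge0// powR_ge0. Qed.

Lemma trunc_le e q s : 0 < e -> 1 <= q -> 0 <= s -> trunc e q s <= e `^ (1 - q).
Proof.
move=> e0 q1 s0; have es0 : 0 < e + s by rewrite ltr_pwDl.
apply: (@le_trans _ _ ((e + s) `^ (1 - q))).
  rewrite (powR_pred (1 - q) es0) mulrC (_ : 1 - q - 1 = - q); last by ring.
  by rewrite /trunc ler_wpM2r ?powR_ge0// lerDr ltW.
rewrite -opprB !powRN lef_pV2 ?posrE ?powR_gt0//.
by apply: ge0_ler_powR; rewrite ?nnegrE ?subr_ge0// ?lerDl// ltW.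
Qed.

Lemma trunc_exp_ge1 p : p <= 2 -> 1 <= (4 - p) / 2.
Proof. by move=> p2; lra. Qed.

Lemma trunc_exp_le p : 1 < p -> (4 - p) / 2 <= 3 / 2.
Proof. by move=> p1; lra. Qed.

(** Young's inequality with exponents p / (p - 1) and p, applied to
psi(r^2) r and y; the former is at most r^(p - 1). *)
Lemma trunc_young e p r y : 0 < e -> 1 < p -> p <= 2 -> 0 <= r -> 0 <= y ->
  trunc e ((4 - p) / 2) (r ^+ 2) * (r * y) <=
  (1 - p^-1) * (trunc e ((4 - p) / 2) (r ^+ 2) * r ^+ 2) + p^-1 * y `^ p.
Proof.
move=> e0 p1 p2 r0 y0; set q := (4 - p) / 2.
have p0 : 0 < p by lra.
have p10 : 0 < p - 1 by lra.
have c0 : 0 <= 1 - p^-1 by rewrite subr_ge0 invf_le1// ltW.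
have [->|rN0] := eqVneq r 0.
  rewrite mul0r mulr0 expr0n/= mulr0 mulr0 add0r mulr_ge0 ?powR_ge0//.
  by rewrite invr_ge0 ltW.
have rp : 0 < r by rewrite lt_def rN0.
have r2 : 0 < r ^+ 2 by rewrite exprn_gt0.
set t := trunc e q (r ^+ 2) * r.
have t0 : 0 <= t by rewrite mulr_ge0// trunc_ge0// ltW.
have tr : t <= r `^ (p - 1).
  have -> : r `^ (p - 1) = r ^+ 2 * (r ^+ 2) `^ (- q) * r.
    rewrite -(powR_mulrn 2 r0) -powRrM -powRD; last by rewrite (gt_eqF rp) implybT.
    have {3}<- : r `^ 1 = r by rewrite powRr1.
    rewrite -powRD; last by rewrite (gt_eqF rp) implybT.
    by congr (r `^ _); rewrite /q; field.
  rewrite ler_wpM2r// ler_wpM2l ?sqr_ge0// !powRN lef_pV2 ?posrE ?powR_gt0//; last first.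
    by rewrite ltr_pwDl// sqr_ge0.
  by apply: ge0_ler_powR; rewrite ?nnegrE ?sqr_ge0 ?addr_ge0 ?lerDr// ?ltW// /q; lra.
have := @conjugate_powR R t y (p / (p - 1)) p t0 y0.
have -> : (p / (p - 1))^-1 + p^-1 = 1 by field; rewrite ?gt_eqF.
move=> /(_ (divr_gt0 p0 p10) p0 erefl) young.
have -> : trunc e q (r ^+ 2) * (r * y) = t * y by rewrite mulrA.
apply: (le_trans young); rewrite mulrC invf_div [y `^ p / p]mulrC lerD2r.
have -> : 1 - p^-1 = (p - 1) / p by field; rewrite gt_eqF.
rewrite ler_wpM2l ?divr_ge0 ?(ltW p0) ?(ltW p10)//.
rewrite (_ : trunc e q (r ^+ 2) * r ^+ 2 = t * r); last by rewrite /t expr2 mulrA.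
have [->|tN0] := eqVneq t 0; first by rewrite mul0r powR0// mulf_neq0 ?invr_eq0 ?gt_eqF.
have tp : 0 < t by rewrite lt_def tN0.
rewrite (powR_pred _ tp) mulrC ler_wpM2l//.
have -> : p / (p - 1) - 1 = (p - 1)^-1 by field; rewrite gt_eqF.
apply: (@le_trans _ _ ((r `^ (p - 1)) `^ (p - 1)^-1)).
  by apply: ge0_ler_powR; rewrite ?nnegrE ?invr_ge0 ?powR_ge0 ?(ltW p10).
by rewrite -powRrM divff ?gt_eqF// powRr1.
Qed.

Lemma trunc_limit p r : 1 < p -> p <= 2 -> 0 <= r ->
  (fun k : nat => trunc k.+1%:R^-1 ((4 - p) / 2) (r ^+ 2) * r ^+ 2) @ \oo --> r `^ p.
Proof.
move=> p1 p2 r0; have [->|rN0] := eqVneq r 0.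
  rewrite powR0; last by rewrite gt_eqF//; lra.
  apply: cvg_seq_eq (cvg_cst 0) => k.
  by rewrite expr0n/= mulr0.
have rp : 0 < r by rewrite lt_def rN0.
have r2 : 0 < r ^+ 2 by rewrite exprn_gt0.
have -> : r `^ p = r ^+ 2 * (r ^+ 2) `^ (- ((4 - p) / 2)) * r ^+ 2.
  rewrite -(powR_mulrn 2 r0) -powRrM.
  rewrite -!powRD ?(gt_eqF rp) ?implybT//.
  by congr (r `^ _); field.
by apply: cvgM; [exact: trunc_cvg|exact: cvg_cst].
Qed.

End TruncationBounds.

Section LpSpaces.
Context {d} {T : measurableType d} {R : realType}.
Variable mu : {measure set T -> \bar R}.
Local Notation cfun := (T -> R[i]).
Local Notation L2 := (in_Lp mu 2%:E).
Local Notation nsq f := (ip mu f f).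
Implicit Types (f g h : cfun) (p : R).

Lemma normcE' (z : R[i]) : normc z = Num.sqrt (rdot z z).
Proof. by rewrite -sqr_normc sqrtr_sqr ger0_norm// normc_ge0. Qed.

Lemma measurable_normc f : cmeasurable setT f ->
  measurable_fun setT (fun x => normc (f x)).
Proof.
move=> mf; rewrite (_ : (fun x => _) = (fun x => Num.sqrt (rdot (f x) (f x)))).
  apply: (measurableT_comp _ (measurable_rdot mf mf)).
  by apply: continuous_measurable_fun; exact: sqrt_continuous.
by apply/funext => x; rewrite normcE'.
Qed.

Lemma measurable_normc_powR f p : cmeasurable setT f ->
  measurable_fun setT (fun x => normc (f x) `^ p).
Proof.
by move=> mf; apply: (measurableT_comp (measurable_powR _)); exact: measurable_normc.
Qed.

Lemma cLnormE p f :
  cLnorm mu p%:E f = ((\int[mu]_x (normc (f x) `^ p)%:E) `^ p^-1)%E.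
Proof.
rewrite /cLnorm unlock; congr (_ `^ _)%E; apply: eq_integral => x _.
by rewrite /= ger0_norm ?normc_ge0.
Qed.

Lemma in_Lp_integrable p f : 0 < p -> in_Lp mu p%:E f ->
  mu.-integrable setT (EFin \o (fun x => normc (f x) `^ p)).
Proof.
move=> p0 [mf fi]; apply/integrableP; split.
  by apply/measurable_EFinP; exact: measurable_normc_powR.
under eq_integral => x _ do rewrite /= ger0_norm ?powR_ge0//.
rewrite cLnormE in fi; apply: (@lty_poweRy _ _ p^-1) => //.
by rewrite gt_eqF// invr_gt0.
Qed.

Lemma le_cLnorm p f g : 0 < p ->
  (\int[mu]_x (normc (f x) `^ p)%:E <= \int[mu]_x (normc (g x) `^ p)%:E)%E ->
  (cLnorm mu p%:E f <= cLnorm mu p%:E g)%E.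
Proof.
move=> p0 fg; rewrite !cLnormE; apply: gt0_ler_poweR => //.
- by rewrite invr_ge0 ltW.
- by rewrite in_itv/= leey andbT integral_ge0// => x _; rewrite lee_fin powR_ge0.
- by rewrite in_itv/= leey andbT integral_ge0// => x _; rewrite lee_fin powR_ge0.
Qed.

Lemma bounded_mul_L2 (psi : T -> R) (C : R) f : measurable_fun setT psi ->
  (forall x, `|psi x| <= C) -> L2 f ->
  L2 (fun x => (psi x)%:C * f x) /\ nsq (fun x => (psi x)%:C * f x) <= C ^+ 2 * nsq f.
Proof.
move=> mpsi psiC Lf; have [mf fi] := (L2P mu f).1 Lf.
have mpf : cmeasurable setT (fun x => (psi x)%:C * f x).
  apply: cmeasurableM mf; split => //=; exact: measurable_cst.
have le x : rdot ((psi x)%:C * f x) ((psi x)%:C * f x) <= C ^+ 2 * rdot (f x) (f x).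
  rewrite rdotM ler_wpM2r ?rdot_ge0// /rdot/= mulr0 addr0 -expr2 -real_normK ?num_real//.
  by rewrite ler_pXn2r ?nnegrE//; exact: le_trans (psiC x).
have i2 := integrableZl measurableT (C ^+ 2) fi.
have Lpf : L2 (fun x => (psi x)%:C * f x).
  apply/L2P; split => //; apply: le_integrable i2 => //.
    by apply/measurable_EFinP; exact: measurable_rdot.
  by move=> x _ /=; rewrite lee_fin ger0_norm ?rdot_ge0// (le_trans (le x))// ler_norm.
split => //; rewrite /ip -RintegralZl//; apply: le_Rintegral => //.
by have [] := (L2P mu _).1 Lpf.
Qed.

End LpSpaces.

Section ResolventContraction.
Variables (R : realType) (M : ptopologicalType) (n : nat).
Variables (A : set (chart R M n)) (Delta : (M -> R) -> M -> R) (V : M -> R).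
Variable mu : {measure set (borel M) -> \bar R}.
Hypothesis hM : smooth_manifold A.
Hypothesis hDelta : diffusion_operator A Delta.
Hypothesis hV : forall x, V x <= 0.
Local Notation core := (schroedinger_core A Delta V).
Hypothesis hL : essentially_self_adjoint mu core.
Local Notation clos := (closure_op mu core).
Local Notation cfun := (borel M -> R[i]).
Local Notation L2 := (in_Lp mu 2%:E).
Local Notation ip := (ip mu).
Local Notation nsq f := (ip f f).
Variable kappa : R.
Hypothesis kappa0 : 0 < kappa.
Variable p : R.
Hypothesis p1 : 1 < p.
Hypothesis p2 : p <= 2.
Local Notation q := ((4 - p) / 2).
Local Notation arg := (resolvent_arg kappa).
Implicit Types (u w f : cfun).

(** Pair u - L u / kappa with psi(|u|^2) u. Dissipativity discards
the term with L u, Young's inequality absorbs the pairing with f, and the rest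
is the L^2 error of the approximation of f. *)
Lemma core_Lp_bound e u w f : 0 < e -> core (u, w) -> L2 f -> in_Lp mu p%:E f ->
  \int[mu]_x (trunc e q (rdot (u x) (u x)) * rdot (u x) (u x)) <=
  \int[mu]_x (normc (f x) `^ p) + p * e `^ (1 - q) *
    (Num.sqrt (nsq (arg u w)) * Num.sqrt (nsq (fun x => arg u w x - f x))).
Proof.
move=> e0 cuw Lf Lpf; have [Lu Lw] := core_L2 hL cuw.
have q1 := trunc_exp_ge1 p2.
have p0 : 0 < p by exact: lt_trans p1.
set C := e `^ (1 - q).
pose psi x := trunc e q (rdot (u x) (u x)).
have muu := measurable_rdot (L2_cmeas Lu) (L2_cmeas Lu).
have mpsi : measurable_fun setT psi.
  apply: measurable_funM => //; apply: (measurableT_comp (measurable_powR _)).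
  exact: measurable_funD.
have psi0 x : 0 <= psi x by rewrite trunc_ge0// rdot_ge0.
have psiC x : `|psi x| <= C by rewrite ger0_norm// trunc_le// rdot_ge0.
have [Lpu Npu] := bounded_mul_L2 mpsi psiC Lu.
pose pu x := (psi x)%:C * u x.
have Lg : L2 (arg u w) by apply: L2B => //; exact: L2Z.
have Lgf := L2B Lg Lf.
have XE : \int[mu]_x (trunc e q (rdot (u x) (u x)) * rdot (u x) (u x)) = ip pu u.
  by apply: eq_Rintegral => x _; rewrite /pu rdotZl.
have step1 : ip pu u <= ip pu (arg u w).
  have h : ip pu w <= 0.
    have -> : ip pu w = \int[mu]_x (trunc e q (rdot (u x) (u x)) * rdot (u x) (w x)).
      by apply: eq_Rintegral => x _; rewrite /pu rdotZl.
    by apply: (core_trunc_le0 hM hDelta hV hL _ _ _ cuw) => //;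
      [exact: le_trans q1|exact: trunc_exp_le].
  have Lkw := L2Z kappa^-1%:C Lw.
  rewrite /resolvent_arg ipBr// ipZr// lerDl oppr_ge0 pmulr_rle0//.
  by rewrite invr_gt0.
have step2 : ip pu (arg u w) = ip pu f + ip pu (fun x => arg u w x - f x).
  by rewrite ipBr// addrC subrK.
have fint := in_Lp_integrable p0 Lpf.
have puint := integrable_rdot Lpu Lu.
have step3 : ip pu f <= (1 - p^-1) * ip pu u + p^-1 * \int[mu]_x (normc (f x) `^ p).
  have i1 := integrableZl measurableT (1 - p^-1) puint.
  have i2 := integrableZl measurableT p^-1 fint.
  rewrite /ip -!RintegralZl// -RintegralD//.
  apply: le_Rintegral => //; first exact: integrable_rdot.
    exact: (integrableD measurableT i1 i2).
  move=> x _; rewrite /pu !rdotZl.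
  apply: le_trans (_ : psi x * (normc (u x) * normc (f x)) <= _).
    rewrite ler_wpM2l//; apply: le_trans (ler_norm _) (normr_rdot _ _).
  have := trunc_young e0 p1 p2 (normc_ge0 (u x)) (normc_ge0 (f x)).
  by rewrite sqr_normc.
have step4 : ip pu (fun x => arg u w x - f x) <=
    C * (Num.sqrt (nsq (arg u w)) * Num.sqrt (nsq (fun x => arg u w x - f x))).
  apply: le_trans (ler_norm _) _; apply: (le_trans (ip_CS Lpu Lgf)).
  rewrite mulrA ler_wpM2r ?sqrtr_ge0//.
  have C0 : 0 <= C by exact: powR_ge0.
  rewrite -(ger0_norm C0) -sqrtr_sqr -sqrtrM ?sqr_ge0// ler_wsqrtr//.
  apply: (le_trans Npu); rewrite ler_wpM2l ?sqr_ge0//.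
  exact: (resolvent_arg_coercive kappa0 Lu Lw (core_le0 hM hDelta hV hL cuw)).
rewrite XE; move: step1 step3 step4; rewrite step2.
set X := ip pu u; set I := ip pu f; set J := ip pu _; set F := \int[mu]_x _.
set Y := _ * Num.sqrt _ => s1 s3 s4.
have : p * X <= (p - 1) * X + F + p * (C * Y).
  have -> : (p - 1) * X + F + p * (C * Y) =
      p * ((1 - p^-1) * X + p^-1 * F + C * Y) by field; rewrite gt_eqF.
  by rewrite ler_wpM2l ?(ltW p0)//; lra.
by rewrite !mulrA => h; lra.
Qed.

(** Fatou's lemma is used twice: at fixed e along the approximating
test functions, whose error term vanishes, and then as e tends to 0. *)
Lemma resolvent_Lp (s : nat -> cfun * cfun) u f : (forall k, core (s k)) ->
  L2 u -> L2 f -> in_Lp mu p%:E f ->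
  L2_cvg mu (fun k => arg (s k).1 (s k).2) f ->
  ae_cvg mu (fun k => (s k).1) u ->
  (cLnorm mu p%:E u <= cLnorm mu p%:E f)%E.
Proof.
move=> cs Lu Lf Lpf sf su; have p0 : 0 < p by exact: lt_trans p1.
have [Ls1 Ls2] := core_seq_L2 hL cs.
have fint := in_Lp_integrable p0 Lpf.
pose F := \int[mu]_x (normc (f x) `^ p).
have FE : (\int[mu]_x (normc (f x) `^ p)%:E)%E = F%:E.
  by rewrite /F /Rintegral fineK//; exact: integrable_fin_num.
have mtr e v : cmeasurable setT v ->
    measurable_fun setT (fun x => trunc e q (rdot (v x) (v x)) * rdot (v x) (v x)).
  move=> mv; have mvv := measurable_rdot mv mv.
  apply: measurable_funM => //; apply: measurable_funM => //.
  by apply: (measurableT_comp (measurable_powR _)); exact: measurable_funD.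
have tr0 e v x : 0 <= trunc e q (rdot (v x) (v x)) * rdot (v x) (v x).
  by rewrite mulr_ge0 ?trunc_ge0 ?rdot_ge0.
have Lg k : L2 (arg (s k).1 (s k).2) by apply: L2B => //; exact: L2Z.
have step e : 0 < e ->
    (\int[mu]_x (trunc e q (rdot (u x) (u x)) * rdot (u x) (u x))%:E <= F%:E)%E.
  move=> e0; apply: (@fatou_ae _ _ _ _
    (fun k x => trunc e q (rdot ((s k).1 x) ((s k).1 x)) * rdot ((s k).1 x) ((s k).1 x))).
  - by move=> k; apply: mtr; exact: L2_cmeas (Ls1 k).
  - exact: mtr (L2_cmeas Lu).
  - by move=> k x; exact: tr0.
  - by move=> x; exact: tr0.
  - apply: filterS su => x [xr xi]; have c := cvg_rdot xr xi xr xi.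
    apply: cvgM => //; apply: cvgM => //; apply: powR_cvg.
      by rewrite ltr_pwDl// rdot_ge0.
    by apply: cvgD => //; exact: cvg_cst.
  move=> eta eta0.
  pose b k := p * e `^ (1 - q) * (Num.sqrt (nsq (arg (s k).1 (s k).2)) *
    Num.sqrt (nsq (fun x => arg (s k).1 (s k).2 x - f x))).
  have b0 : b @ \oo --> (0 : R).
    rewrite -(mulr0 (p * e `^ (1 - q))); apply: cvg_seqZ.
    rewrite -(mulr0 (Num.sqrt (nsq f))); apply: cvgM.
      exact: (@continuous_cvg _ _ _ \oo _ _ Num.sqrt _ (@sqrt_continuous R (nsq f))
        (ip_cvg2 Lg Lf Lg Lf sf sf)).
    exact/sqrt_cvg0/L2_cvgP.
  have /cvgrPdist_le/(_ _ eta0) := b0; apply: filterS => k /=.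
  rewrite sub0r normrN => /(le_trans (ler_norm _)) bk.
  have pc : core ((s k).1, (s k).2) by rewrite -surjective_pairing.
  have := core_Lp_bound e0 pc Lf Lpf; rewrite -/F -/(b k) => h.
  have Xi : mu.-integrable setT (EFin \o (fun x =>
      trunc e q (rdot ((s k).1 x) ((s k).1 x)) * rdot ((s k).1 x) ((s k).1 x))).
    have [_ i2] := (L2P mu _).1 (Ls1 k).
    apply: le_integrable (integrableZl measurableT (e `^ (1 - q)) i2) => //.
      by apply/measurable_EFinP; apply: mtr; exact: L2_cmeas (Ls1 k).
    move=> x _ /=; rewrite lee_fin ger0_norm// (le_trans _ (ler_norm _))//.
    by rewrite ler_wpM2r ?rdot_ge0// trunc_le ?rdot_ge0// trunc_exp_ge1.
  rewrite -[leLHS]fineK; last exact: (integrable_fin_num measurableT Xi).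
  by rewrite lee_fin; apply: (le_trans h); rewrite lerD2l.
apply: le_cLnorm => //; rewrite FE.
apply: (@fatou_ae _ _ _ _
    (fun k x => trunc k.+1%:R^-1 q (rdot (u x) (u x)) * rdot (u x) (u x))).
- by move=> k; exact: mtr (L2_cmeas Lu).
- exact: measurable_normc_powR (L2_cmeas Lu).
- by move=> k x; exact: tr0.
- by move=> x; exact: powR_ge0.
- apply: aeW => x; rewrite -sqr_normc.
  exact: trunc_limit p1 p2 (normc_ge0 (u x)).
move=> eta eta0; apply: nearW => k.
apply: (@le_trans _ _ F%:E); last by rewrite lee_fin lerDl ltW.
by apply: step; rewrite invr_gt0 ltr0n.
Qed.

End ResolventContraction.

(** * Resolutions of the identity *)

Section Resolution.
Context {d} {T : measurableType d} {R : realType}.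
Variable mu : {measure set T -> \bar R}.
Variable E : resolution_of_identity mu.
Local Notation cfun := (T -> R[i]).
Local Notation L2 := (in_Lp mu 2%:E).
Local Notation ip := (ip mu).
Local Notation nsq f := (ip f f).
Local Notation RB := (measurableTypeR R).
Local Notation nu := (scalar_measure E).
Implicit Types (f g u v : cfun) (B C : set RB).

Lemma res_L2 B f : measurable B -> L2 f -> L2 (E B f).
Proof. by move=> mB; exact: (resolution_linear E mB).1. Qed.

Lemma res_sym B f g : measurable B -> L2 f -> L2 g -> ip (E B f) g = ip f (E B g).
Proof.
move=> mB Lf Lg; have := congr1 (@complex.Re R) (resolution_symm E mB Lf Lg).
by rewrite !Re_inner.
Qed.

Lemma res_lin B (c : R[i]) f g h : measurable B -> L2 f -> L2 g -> L2 h ->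
  ip (E B (fun y => c * f y + g y)) h =
  ip (fun x => c * E B f x) h + ip (E B g) h.
Proof.
move=> mB Lf Lg Lh; have [_ /(_ c f g Lf Lg) ae] := resolution_linear E mB.
have L1 := res_L2 mB Lf; have L2' := res_L2 mB Lg.
have Lc := L2Z c L1.
by rewrite -ipDl//; apply: eq_ip => //; [apply: res_L2 => //; apply: L2D => //; exact: L2Z|exact: L2D].
Qed.

Lemma res_linR B (a : R) f g h : measurable B -> L2 f -> L2 g -> L2 h ->
  ip (E B (fun y => a%:C * f y + g y)) h = a * ip (E B f) h + ip (E B g) h.
Proof. by move=> mB Lf Lg Lh; rewrite res_lin// ipZl//; exact: res_L2. Qed.

Lemma resI B C f h : measurable B -> measurable C -> L2 f -> L2 h ->
  ip (E B (E C f)) h = ip (E (B `&` C) f) h.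
Proof.
move=> mB mC Lf Lh; apply: eq_ip => //.
- by apply: res_L2 => //; exact: res_L2.
- by apply: res_L2 => //; exact: measurableI.
by apply: filterS (resolutionI E mB mC Lf) => x ->.
Qed.

Lemma nuE f B : L2 f -> measurable B -> nu f B = (ip (E B f) f)%:E.
Proof. by move=> Lf mB; rewrite scalar_measureE// Re_inner. Qed.

Lemma nu_setT f : L2 f -> nu f setT = (nsq f)%:E.
Proof.
move=> Lf; rewrite nuE//; congr (_%:E); apply: eq_ip => //; first exact: res_L2.
exact: resolutionT.
Qed.

Lemma nu_fin f B : L2 f -> measurable B -> (nu f B < +oo)%E.
Proof. by move=> Lf mB; rewrite nuE// ltry. Qed.

Lemma nu_res f B C : L2 f -> measurable B -> measurable C ->
  nu (E B f) C = nu f (C `&` B).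
Proof.
move=> Lf mB mC; have LB := res_L2 mB Lf.
rewrite !nuE//; last exact: measurableI.
rewrite resI// -res_sym//; last by apply: res_L2 => //; exact: measurableI.
by rewrite resI//; [congr (ip (E _ _) _)%:E; rewrite setICA setIid|exact: measurableI].
Qed.

(** The form of the symmetric operator E(B) is polarized, which makes
<E(B) f, g> additive in B. *)
Lemma nu_polar f g B : L2 f -> L2 g -> measurable B ->
  ip (E B f) g = 4^-1 * (ip (E B (fun x => f x + g x)) (fun x => f x + g x)
    - ip (E B (fun x => f x - g x)) (fun x => f x - g x)).
Proof.
move=> Lf Lg mB; have LfB := res_L2 mB Lf; have LgB := res_L2 mB Lg.
have Lp := L2D Lf Lg; have Lm := L2B Lf Lg.
have LNf := L2N Lf.
have ep h : L2 h -> ip (E B (fun x => f x + g x)) h = ip (E B f) h + ip (E B g) h.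
  move=> Lh; have -> : (fun x => f x + g x) = (fun x => 1%:C * f x + g x).
    by apply/funext => x; rewrite mul1r.
  by rewrite res_linR// mul1r.
have em h : L2 h -> ip (E B (fun x => f x - g x)) h = ip (E B f) h - ip (E B g) h.
  move=> Lh; have -> : (fun x => f x - g x) = (fun x => (-1)%:C * g x + f x).
    by apply/funext => x; rewrite rmorphN mulN1r addrC.
  by rewrite res_linR// mulN1r addrC.
rewrite ep// em// (ipDr Lf Lg LfB) (ipDr Lf Lg LgB) (ipBr Lf Lg LfB) (ipBr Lf Lg LgB).
have -> : ip (E B g) f = ip (E B f) g by rewrite res_sym// ipC.
by field.
Qed.

Variables (N : nat) (B : nat -> set RB).
Hypothesis mB : forall j, measurable (B j).
Hypothesis tB : trivIset setT B.
Hypothesis covB : \big[setU/set0]_(j <- iota 0 N) B j = setT.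

Lemma nu_partition f : L2 f -> \sum_(j <- iota 0 N) ip (E (B j) f) f = nsq f.
Proof.
move=> Lf; apply: EFin_inj; rewrite -nu_setT// -covB.
rewrite -(subn0 N) -/(index_iota 0 N) !big_mkord measure_bigsetU//.
  by rewrite -sumEFin; apply: eq_bigr => j _; exact/esym/nuE.
Qed.

Lemma ip_partition f g : L2 f -> L2 g -> ip f g = \sum_(j <- iota 0 N) ip (E (B j) f) g.
Proof.
move=> Lf Lg; have Lp := L2D Lf Lg; have Lm := L2B Lf Lg.
under eq_bigr do rewrite nu_polar//.
rewrite -mulr_sumr sumrB !nu_partition//.
rewrite (ipDl Lf Lg Lp) (ipDr Lf Lg Lf) (ipDr Lf Lg Lg).
rewrite (ipBl Lf Lg Lm) (ipBr Lf Lg Lf) (ipBr Lf Lg Lg) (ipC _ g f); by field.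
Qed.

(** The pieces E(B_j) are orthogonal projections, so the pairing
splits, and 2 a b <= a^2 / c + c b^2 may be used with its own c on each
piece. *)
Lemma ip_level_bound (c : nat -> R) f g : (forall j, 0 < c j) -> L2 f -> L2 g ->
  2 * ip f g <= \sum_(j <- iota 0 N) ((c j)^-1 * ip (E (B j) f) f + c j * ip (E (B j) g) g).
Proof.
move=> c0 Lf Lg; rewrite (ip_partition Lf Lg) mulr_sumr; apply: ler_sum => j _.
have ee h : L2 h -> ip (E (B j) h) (E (B j) h) = ip (E (B j) h) h.
  by move=> Lh; rewrite -res_sym ?resI ?setIid//; exact: res_L2.
have -> : ip (E (B j) f) g = ip (E (B j) f) (E (B j) g).
  by rewrite -res_sym ?resI ?setIid//; exact: res_L2.
have := @ip_le2 _ _ _ mu (c j)^-1 (E (B j) f) (E (B j) g) _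
  (res_L2 (mB j) Lf) (res_L2 (mB j) Lg).
by rewrite invr_gt0 invrK !ee//; apply.
Qed.

Variable c : nat -> R.

(** The operator h(A) for a step function h, in terms of the resolution
of the identity of A. *)
Definition step_op n f : cfun := fun x => \sum_(j <- iota 0 n) (c j)%:C * E (B j) f x.

Lemma step_opS n f : step_op n.+1 f = fun x => (c n)%:C * E (B n) f x + step_op n f x.
Proof.
by apply/funext => x; rewrite /step_op -addn1 iotaD big_cat/= big_seq1 addrC.
Qed.

Lemma step_op_L2 n f : L2 f -> L2 (step_op n f).
Proof.
move=> Lf; elim: n => [|n IH].
  have := L2Z 0 Lf; congr L2.
  by apply/funext => x; rewrite /step_op big_nil mul0r.
by rewrite step_opS; apply: L2D => //; apply: L2Z; exact: res_L2.
Qed.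

Lemma ip_step n f g : L2 f -> L2 g ->
  ip (step_op n f) g = \sum_(j <- iota 0 n) c j * ip (E (B j) f) g.
Proof.
move=> Lf Lg; elim: n => [|n IH].
  rewrite big_nil (_ : step_op 0 f = fun x => 0%:C * f x) ?ipZl ?mul0r//.
  by apply/funext => x; rewrite /step_op big_nil mul0r.
have L1 := res_L2 (mB n) Lf; have L1' := L2Z (c n)%:C L1; have Ls := step_op_L2 n Lf.
by rewrite step_opS ipDl// ipZl// IH -addn1 iotaD big_cat/= big_seq1 addrC.
Qed.

Lemma res_step n f g C : measurable C -> L2 f -> L2 g ->
  ip (E C (step_op n f)) g = \sum_(j <- iota 0 n) c j * ip (E (C `&` B j) f) g.
Proof.
move=> mC Lf Lg; have LC := res_L2 mC Lg.
rewrite (res_sym mC (step_op_L2 n Lf) Lg) ip_step//.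
by apply: eq_bigr => j _; rewrite -res_sym ?resI//; exact: res_L2.
Qed.

(** Applying the operator h(A) multiplies the scalar measure by
h^2. *)
Lemma nu_step f C j : L2 f -> measurable C -> (j < N)%N -> C `<=` B j ->
  nu (step_op N f) C = ((c j ^+ 2)%:E * nu f C)%E.
Proof.
move=> Lf mC jN CB; have Ls := step_op_L2 N Lf.
have key g : L2 g -> ip (E C (step_op N f)) g = c j * ip (E C f) g.
  move=> Lg; rewrite res_step// (bigD1_seq j)/= ?iota_uniq ?mem_iota ?add0n//.
  rewrite [X in _ + X]big1 ?addr0; first by rewrite (setIidl CB).
  move=> k kj; rewrite (_ : C `&` B k = set0).
    have := nuE (L2D Lf Lg) (@measurable0 _ RB); have := nuE (L2B Lf Lg) (@measurable0 _ RB).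
    rewrite !measure0 => -[h1] [h2].
    by rewrite nu_polar// -h1 -h2 subrr mulr0 mulr0.
  apply/seteqP; split => // x [Cx Bkx]; have Bjx := CB _ Cx.
  move/trivIsetP : tB => /(_ j k I I); rewrite eq_sym kj => /(_ isT).
  by move/seteqP => [+ _] => /(_ x); apply.
rewrite !nuE// -EFinM; congr (_%:E).
by rewrite key// res_sym// ipC key// mulrA expr2.
Qed.

End Resolution.

(** * Spectral measures and resolvents *)

Lemma ler_add_divn (R : realType) (a b c : R) : 0 <= c ->
  (forall N, (0 < N)%N -> a <= b + c / N%:R) -> a <= b.
Proof.
move=> c0 h; apply/ler_addgt0Pr => e e0.
pose N := (Num.bound (c / e)).+1.
apply: (le_trans (h N _)) => //; rewrite lerD2l ler_pdivrMr ?ltr0n//.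
rewrite mulrC -ler_pdivrMr//.
have ce : 0 <= c / e by rewrite divr_ge0// ltW.
by apply: (le_trans (ltW (archi_boundP ce))); rewrite ler_nat.
Qed.

Lemma measurable_negative (R : realType) :
  measurable ([set x | x < 0] : set (measurableTypeR R)).
Proof.
have -> : [set x : measurableTypeR R | x < 0] = `]-oo, 0[%classic.
  by apply/seteqP; split => x /=; rewrite in_itv.
exact: measurable_itv.
Qed.

Section Levels.
Variable R : realType.
Local Notation RB := (measurableTypeR R).
Variable h : R -> R.
Hypothesis mh : measurable_fun [set: RB] h.
Hypothesis h0 : forall x, 0 <= h x.
Hypothesis h1 : forall x, h x <= 1.
Variable N : nat.
Hypothesis N0 : (0 < N)%N.

(** Cutting the range of h rather than its domain makes one finite
partition serve all scalar measures. *)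
Definition level j : set RB := [set x | j%:R / N%:R <= h x < j.+1%:R / N%:R].

Lemma measurable_level j : measurable (level j).
Proof.
have -> : level j = setT `&` h @^-1` `[j%:R / N%:R, j.+1%:R / N%:R[%classic.
  by apply/seteqP; split => x /=; rewrite in_itv/=; [split|case].
by apply: mh => //; exact: measurable_itv.
Qed.

Lemma trivIset_level : trivIset setT level.
Proof.
have N0' : 0 < N%:R :> R by rewrite ltr0n.
apply/trivIsetP => i j _ _ ij; apply/seteqP; split => // x [/= /andP[i1 i2] /andP[j1 j2]].
move: ij; suff -> : i = j by rewrite eqxx.
rewrite !ler_pdivrMr// !ltr_pdivlMr// in i1 i2 j1 j2.
have := le_lt_trans i1 j2; have := le_lt_trans j1 i2.
by rewrite !ltr_nat !ltnS => ji ij; apply/eqP; rewrite eqn_leq ij ji.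
Qed.

Lemma cover_level : \big[setU/set0]_(j <- iota 0 N.+1) level j = setT.
Proof.
have N0' : 0 < N%:R :> R by rewrite ltr0n.
apply/seteqP; split => // x _; rewrite -bigcup_seq.
have Nh0 : 0 <= N%:R * h x by rewrite mulr_ge0.
have := Num.Theory.truncn_itv Nh0; set j := Num.truncn _ => /andP[j1 j2].
exists j; last first.
  by rewrite /level/= ler_pdivrMr// ltr_pdivlMr// mulrC j1.
rewrite [X in X j]/=; change (j \in iota 0 N.+1).
by rewrite mem_iota add0n leq0n ltnS -(ler_nat R) (le_trans j1)//
  -[leRHS]mulr1 ler_wpM2l// ltW.
Qed.

Lemma integral_level (nu : {measure set RB -> \bar R}) (F : RB -> \bar R) :
  measurable_fun setT F -> (forall x, 0 <= F x)%E ->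
  (\int[nu]_x F x = \sum_(j <- iota 0 N.+1) \int[nu]_(x in level j) F x)%E.
Proof.
move=> mF F0; rewrite -cover_level ge0_integral_bigsetU//.
- exact: measurable_level.
- exact: iota_uniq.
- exact: sub_trivIset trivIset_level.
- exact: measurable_funS mF.
Qed.

End Levels.

Section ResolventForm.
Context {d} {T : measurableType d} {R : realType}.
Variable mu : {measure set T -> \bar R}.
Variable E : resolution_of_identity mu.
Local Notation cfun := (T -> R[i]).
Local Notation L2 := (in_Lp mu 2%:E).
Local Notation ip := (ip mu).
Local Notation nsq f := (ip f f).
Local Notation RB := (measurableTypeR R).
Local Notation nu := (scalar_measure E).
Variable G : set (cfun * cfun).
Hypothesis GE : spectral_resolution_of G E.
Hypothesis GL2 : forall u w, G (u, w) -> L2 u /\ L2 w.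
Hypothesis Gpos : forall u w, G (u, w) -> 0 <= ip u w.
Hypothesis GB : forall u w v z, G (u, w) -> G (v, z) ->
  G ((fun x => u x - v x), (fun x => w x - z x)).
Hypothesis Gsym : forall u w v z, G (u, w) -> G (v, z) -> ip w v = ip u z.
Implicit Types (f g u v w z : cfun).

Lemma nu_integrable_cst f (c : R) : L2 f -> (nu f).-integrable setT (EFin \o (fun=> c)).
Proof.
move=> Lf; apply: (@measurable_bounded_integrable _ _ _ (nu f) (fun=> c) setT) => //.
- exact: nu_fin.
- by exists `|c|; split; [exact: num_real|move=> y cy x _; exact: ltW].
Qed.

Lemma nu_integrable_bounded f (F : R -> R) (C : R) : L2 f ->
  measurable_fun [set: RB] F -> (forall x, `|F x| <= C) ->
  (nu f).-integrable setT (EFin \o F).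
Proof.
move=> Lf mF FC; apply: (@measurable_bounded_integrable _ _ _ (nu f) F setT) => //.
- exact: nu_fin.
- by exists C; split; [exact: num_real|move=> y Cy x _; exact: le_trans (FC x) (ltW Cy)].
Qed.

Lemma nu_integrable_id f : L2 f -> (\int[nu f]_x (x ^+ 2)%:E < +oo)%E ->
  (nu f).-integrable setT (EFin \o (fun x : RB => x)).
Proof.
move=> Lf x2.
have i2 : (nu f).-integrable setT (EFin \o (fun x : RB => x ^+ 2)).
  apply/integrableP; split; first by apply/measurable_EFinP; exact: measurable_funX.
  by under eq_integral do rewrite /= ger0_norm ?sqr_ge0//.
have := integrableD measurableT (nu_integrable_cst 1 Lf) i2.
apply: le_integrable => //; first by apply/measurable_EFinP; exact: measurable_id.
move=> x _ /=; rewrite lee_fin (le_trans _ (ler_norm _))//.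
rewrite -real_normK ?num_real//; move: `|x| => y.
by have := sqr_ge0 (y - 2^-1); nra.
Qed.

Lemma G_form u w : G (u, w) -> (nu u).-integrable setT (EFin \o (fun x : RB => x)) /\
  ip u w = \int[nu u]_x x.
Proof.
move=> Guw; have [Lu Lw] := GL2 Guw; have [dom form] := GE Lu; split.
  by apply: nu_integrable_id => //; apply/dom; exists w.
by have := congr1 (@complex.Re R) (form _ Guw); rewrite Re_inner ipC.
Qed.

(** A vector u of the spectral subspace of a compact part of the
negative axis is in the domain of the operator. The form of u, which is the
integral of x against nu_u, is nonnegative although x is bounded above by a
negative constant there. *)
Lemma nu_neg_slab f (k : nat) : L2 f ->
  nu f (`[- k.+1%:R, - k.+1%:R^-1]%classic : set RB) = 0%E.
Proof.
move=> Lf; set B : set RB := [set` _].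
have k0 : 0 < k.+1%:R :> R by rewrite ltr0n.
have mB : measurable (B : set RB) by exact: measurable_itv.
have mCB : measurable (~` B : set RB) by exact: measurableC.
have Lu := res_L2 E mB Lf; set u := E B f in Lu.
have nuCB : nu u (~` B) = 0%E by rewrite nu_res// setICl measure0.
have ae (P : RB -> Prop) : (forall x, B x -> P x) -> {ae nu u, forall x, P x}.
  by move=> h; exists (~` B); split => // x /= nP Bx; apply: nP; exact: h.
have [g Gg] : exists g, G (u, g).
  apply/(GE Lu).1; apply: (@le_lt_trans _ _ (\int[nu u]_x (k.+1%:R ^+ 2)%:E)%E).
    apply: ae_ge0_le_integral => //.
    - by move=> x _; rewrite lee_fin sqr_ge0.
    - by apply/measurable_EFinP; exact: measurable_funX.
    apply: ae => x; rewrite /B/= in_itv/= => /andP[x1 x2] _.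
    rewrite lee_fin -(real_normK (num_real x)) ler_pXn2r// ?nnegrE//.
    rewrite ler_norml x1/= (le_trans x2)// (@le_trans _ _ 0)// ?oppr_le0 ?invr_ge0//.
  by rewrite integral_cst//= lte_mul_pinfty ?lee_fin ?sqr_ge0//; exact: nu_fin.
have [ix xE] := G_form Gg; have := Gpos Gg; rewrite xE.
pose D : set RB := setT `\` ~` B.
have mD : measurable D by exact: measurableD.
have -> : \int[nu u]_x x = \int[nu u]_(x in D) x.
  by rewrite /Rintegral (negligible_integral mCB measurableT ix nuCB).
have DB x : D x -> B x by move=> [_ /contrapT].
have iD := integrableS measurableT mD (@subsetT _ D) ix.
have icD := integrableS measurableT mD (@subsetT _ D) (nu_integrable_cst (- k.+1%:R^-1) Lu).
have le : \int[nu u]_(x in D) x <= \int[nu u]_(x in D) (- k.+1%:R^-1).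
  by apply: le_Rintegral => // x /DB; rewrite /B/= in_itv/= => /andP[].
move=> /le_trans/(_ le); rewrite Rintegral_cst// mulNr oppr_ge0 pmulr_rle0 ?invr_gt0// => nuD.
have DE : D = B by apply/seteqP; split => x; [exact: DB|move=> Bx; split => //=; exact].
have : nu u D = 0%E.
  apply/eqP; rewrite eq_le measure_ge0 andbT.
  by rewrite -(@fineK _ (nu u D)) ?lee_fin// fin_num_abs gee0_abs// nu_fin.
by rewrite DE nu_res// setIid.
Qed.

Lemma nu_neg f : L2 f -> nu f [set x | x < 0] = 0%E.
Proof.
move=> Lf; have : (nu f).-negligible (\bigcup_k (`[- k.+1%:R, - k.+1%:R^-1]%classic : set RB)).
  apply: negligible_bigcup => k; exists `[- k.+1%:R, - k.+1%:R^-1]%classic.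
  by split; [exact: measurable_itv|exact: nu_neg_slab|].
move=> /negligibleS; have sub : [set x : RB | x < 0] `<=`
    \bigcup_k (`[- k.+1%:R, - k.+1%:R^-1]%classic : set RB).
  move=> x /= x0; have nx0 : 0 < - x by rewrite oppr_gt0.
  (* The slabs [-(k + 1), -1 / (k + 1)] exhaust the negative axis. *)
  pose k := maxn (Num.bound (- x)) (Num.bound (- x)^-1); exists k => //=.
  rewrite in_itv/=; apply/andP; split.
    rewrite lerNl; apply: (le_trans (ltW (archi_boundP (ltW nx0)))).
    by rewrite ler_nat (leq_trans (leq_maxl _ _) (leqnSn _)).
  rewrite lerNr invf_ple ?posrE ?ltr0n//.
  have h : 0 <= (- x)^-1 by rewrite invr_ge0 ltW.
  apply: (le_trans (ltW (archi_boundP h))).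
  by rewrite ler_nat (leq_trans (leq_maxr _ _) (leqnSn _)).
by move=> /(_ _ sub); apply: measure_negligible; exact: measurable_negative.
Qed.

Lemma nu_ae_ge0 f : L2 f -> {ae nu f, forall x, 0 <= x}.
Proof.
move=> Lf; exists [set x | x < 0]; split; last by move=> x /= /negP; rewrite -ltNge.
- exact: measurable_negative.
- exact: nu_neg.
Qed.

Variable kappa : R.
Hypothesis kappa0 : 0 < kappa.

(** The spectral function of the resolvent. The absolute value makes it
bounded on the whole line; the scalar measures do not charge the negative
axis. *)
Definition rker (x : R) : R := kappa / (kappa + `|x|).

Lemma rker_gt0 x : 0 < rker x.
Proof. by rewrite divr_gt0// ltr_pwDl. Qed.

Lemma rker_le1 x : rker x <= 1.
Proof. by rewrite ler_pdivrMr ?ltr_pwDl// mul1r lerDl. Qed.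

Lemma rker_inv x : (rker x)^-1 = 1 + `|x| / kappa.
Proof. by rewrite /rker invf_div mulrDl divff// gt_eqF. Qed.

Lemma measurable_rker : measurable_fun [set: RB] rker.
Proof.
apply: continuous_measurable_fun => x.
apply: cvgM; first exact: cvg_cst.
apply: cvgV; first by rewrite gt_eqF// ltr_pwDl.
apply: cvgD; first exact: cvg_cst.
exact: norm_continuous.
Qed.

Lemma measurable_inv_rker : measurable_fun [set: RB] (fun x => 1 + `|x| / kappa).
Proof.
by apply: measurable_funD => //; exact: measurable_funM.
Qed.

Lemma form_integral u w : G (u, w) ->
  (\int[nu u]_x (1 + `|x| / kappa)%:E = (nsq u + kappa^-1 * ip u w)%:E)%E.
Proof.
move=> Guw; have [Lu Lw] := GL2 Guw; have [ix ->] := G_form Guw.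
have i1 := nu_integrable_cst 1 Lu.
have ik := integrableZr measurableT kappa^-1 ix.
have ixk : (nu u).-integrable setT (EFin \o (fun x : RB => x / kappa)) by exact: ik.
transitivity (\int[nu u]_x (1 + x / kappa)%:E)%E.
  apply: ae_eq_integral => //.
  - by apply/measurable_EFinP; exact: measurable_inv_rker.
  - by apply/measurable_EFinP; apply: measurable_funD => //; exact: measurable_funM.
  - have [Z [mZ Z0 subZ]] := nu_ae_ge0 Lu; exists Z; split => // x nP; apply: subZ => x0.
    by apply: nP => _ /=; rewrite ger0_norm.
have i1k := integrableD measurableT i1 ixk.
rewrite -(@fineK _ (\int[nu u]_x _)%E); last exact: (integrable_fin_num measurableT i1k).
congr (_%:E); rewrite -/(Rintegral _ _ _).
rewrite RintegralD// RintegralZr// mulrC; congr (_ + _).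
by rewrite Rintegral_cst// mul1r nu_setT.
Qed.

Section Approximation.
Variable N : nat.
Hypothesis N0 : (0 < N)%N.
Local Notation lev := (level rker N).
Let mlev := measurable_level measurable_rker N.
Let tlev : trivIset setT lev. Proof. exact: trivIset_level. Qed.
Let clev : \big[setU/set0]_(j <- iota 0 N.+1) lev j = setT.
Proof. by apply: cover_level => // x; [exact: ltW (rker_gt0 x)|exact: rker_le1]. Qed.
Let N0' : 0 < N%:R :> R. Proof. by rewrite ltr0n. Qed.

Definition grid (j : nat) : R := j%:R / N%:R.

Definition lower_sum f := \sum_(j <- iota 0 N.+1) grid j * ip (E (lev j) f) f.

Lemma upper_sumE f : L2 f ->
  \sum_(j <- iota 0 N.+1) (j.+1%:R / N%:R) * ip (E (lev j) f) f =
  lower_sum f + nsq f / N%:R.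
Proof.
move=> Lf; rewrite -(nu_partition E mlev tlev clev Lf) mulr_suml -big_split/=.
by apply: eq_bigr => j _; rewrite /grid -natr1; ring.
Qed.

Lemma lower_sum_le f : L2 f -> lower_sum f <= \int[nu f]_x rker x.
Proof.
move=> Lf.
have ir : (nu f).-integrable setT (EFin \o rker).
  apply: (@nu_integrable_bounded _ _ 1 Lf measurable_rker) => x.
  by rewrite ger0_norm ?rker_le1// ltW// rker_gt0.
rewrite -lee_fin /Rintegral fineK; last exact: (integrable_fin_num measurableT ir).
rewrite (integral_level measurable_rker (fun x => ltW (rker_gt0 x)) rker_le1 N0); last 2 first.
- by apply/measurable_EFinP; exact: measurable_rker.
- by move=> x; rewrite lee_fin ltW// rker_gt0.
rewrite /lower_sum -sumEFin; apply: lee_sum => j _.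
rewrite EFinM -nuE//.
rewrite -integral_cst//.
apply: ge0_le_integral => //.
- by move=> x _; rewrite lee_fin divr_ge0.
- by apply/measurable_EFinP; apply: measurable_funS measurable_rker.
- by move=> x /= /andP[]; rewrite lee_fin.
Qed.

Lemma lower_sum_ge f : L2 f -> \int[nu f]_x rker x <= lower_sum f + nsq f / N%:R.
Proof.
move=> Lf.
have ir : (nu f).-integrable setT (EFin \o rker).
  apply: (@nu_integrable_bounded _ _ 1 Lf measurable_rker) => x.
  by rewrite ger0_norm ?rker_le1// ltW// rker_gt0.
rewrite -upper_sumE// -lee_fin /Rintegral fineK; last exact: (integrable_fin_num measurableT ir).
rewrite (integral_level measurable_rker (fun x => ltW (rker_gt0 x)) rker_le1 N0); last 2 first.
- by apply/measurable_EFinP; exact: measurable_rker.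
- by move=> x; rewrite lee_fin ltW// rker_gt0.
rewrite -sumEFin; apply: lee_sum => j _.
rewrite EFinM -nuE//.
rewrite -integral_cst//.
apply: ge0_le_integral => //.
- by move=> x _; rewrite lee_fin ltW// rker_gt0.
- by apply/measurable_EFinP; apply: measurable_funS measurable_rker.
- by move=> x /= /andP[_ /ltW]; rewrite lee_fin.
Qed.

(** In 2 <u, f> <= sum_j nu_u(B_j) / c_j + c_j nu_f(B_j) take for c_j
the upper end of the j-th level of the kernel r. As 1 / c_j <= 1 / r there, the
first sum is at most int (1 + x / kappa) dnu_u = <u, f>, and the second is
int r dnu_f up to 1 / N. *)
Lemma form_upper u w f : G (u, w) -> f = (fun x => u x + kappa^-1%:C * w x) ->
  ip u f <= \int[nu f]_x rker x + nsq f / N%:R.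
Proof.
move=> Guw fE; have [Lu Lw] := GL2 Guw; have Lkw := L2Z kappa^-1%:C Lw.
have Lf : L2 f by rewrite fE; exact: L2D.
(* <u, f> is the form of 1 + A / kappa at u. *)
have ufE : ip u f = nsq u + kappa^-1 * ip u w by rewrite fE ipDr// ipZr.
have c0 j : 0 < j.+1%:R / N%:R :> R by rewrite divr_gt0// ltr0n.
have := ip_level_bound E mlev tlev clev c0 Lu Lf.
rewrite big_split upper_sumE//=.
set S1 := \sum_(_ <- _) _.
have S1le : S1 <= ip u f.
  rewrite -lee_fin ufE -(form_integral Guw).
  rewrite (integral_level measurable_rker (fun x => ltW (rker_gt0 x)) rker_le1 N0); last 2 first.
  - by apply/measurable_EFinP; exact: measurable_inv_rker.
  - by move=> x; rewrite lee_fin addr_ge0// divr_ge0// ltW.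
  rewrite /S1 -sumEFin; apply: lee_sum => j _.
  rewrite EFinM -nuE//.
  rewrite -integral_cst//.
  apply: ge0_le_integral => //.
  - by move=> x _; rewrite lee_fin invr_ge0 ltW.
  - by apply/measurable_EFinP; apply: measurable_funS measurable_inv_rker.
  - move=> x /= /andP[_ /ltW xj]; rewrite lee_fin -rker_inv lef_pV2 ?posrE//.
    exact: rker_gt0.
have := lower_sum_le Lf; move: (_ / N%:R) => y; lra.
Qed.

Lemma step_integral_le f (F : R -> R) (D : nat -> R) : L2 f ->
  measurable_fun [set: RB] F -> (forall x, 0 <= F x) ->
  (forall j x, lev j x -> grid j ^+ 2 * F x <= D j) ->
  (\int[nu (step_op E lev grid N.+1 f)]_x (F x)%:E <=
   (\sum_(j <- iota 0 N.+1) D j * ip (E (lev j) f) f)%:E)%E.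
Proof.
move=> Lf mF F0 FD; set v := step_op _ _ _ _ _.
rewrite (integral_level measurable_rker (fun x => ltW (rker_gt0 x)) rker_le1 N0); last 2 first.
- exact/measurable_EFinP.
- by move=> x; rewrite lee_fin.
rewrite -sumEFin big_seq [leRHS]big_seq; apply: lee_sum => j; rewrite mem_iota add0n => /andP[_ jN].
have mFj : measurable_fun (lev j) (EFin \o F).
  by apply/measurable_EFinP; apply: measurable_funS mF.
pose c2 : {nonneg R} := NngNum (sqr_ge0 (grid j)).
rewrite (@eq_measure_integral _ _ _ (lev j) (mscale c2 (nu f))); last first.
  by move=> C mC CB; rewrite (nu_step E mlev tlev _ Lf mC jN CB).
rewrite ge0_integral_mscale//; last first.
  by move=> x _; rewrite lee_fin.
rewrite -ge0_integralZl//; last first.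
  by move=> x _; rewrite lee_fin.
rewrite (EFinM (D j)) -nuE//.
rewrite -integral_cst//.
apply: ge0_le_integral => //.
- by move=> x _; rewrite -EFinM lee_fin mulr_ge0 ?sqr_ge0.
- by apply: measurable_funeM.
- by move=> x /FD; rewrite -EFinM lee_fin.
Qed.

(** Compare u with v = h(A) f, where h is the lower step function of the
kernel r. Positivity of the form b(u - v, u - v) of 1 + A / kappa gives
2 <v, f> <= <u, f> + b(v, v), and b(v, v) <= <v, f> because h^2 / r <= h. *)
Lemma form_lower u w f : G (u, w) -> f = (fun x => u x + kappa^-1%:C * w x) ->
  \int[nu f]_x rker x - nsq f / N%:R <= ip u f.
Proof.
move=> Guw fE; have [Lu Lw] := GL2 Guw; have Lkw := L2Z kappa^-1%:C Lw.
have Lf : L2 f by rewrite fE; exact: L2D.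
pose v := step_op E lev grid N.+1 f.
have Lv : L2 v by exact: step_op_L2.
have jlev j x : lev j x -> grid j <= rker x by move=> /= /andP[].
have vf : ip v f = lower_sum f by rewrite /v ip_step.
have [z Gvz] : exists z, G (v, z).
  apply/(GE Lv).1; apply: le_lt_trans (ltry _).
  apply: (@step_integral_le _ (fun x => x ^+ 2) (fun=> kappa ^+ 2)) => //.
    by move=> x; exact: sqr_ge0.
  move=> j x /jlev jx; rewrite -exprMn -[leLHS]real_normK ?num_real//.
  rewrite ler_pXn2r// ?nnegrE ?(ltW kappa0)// normrM (@ger0_norm _ (grid j)) ?divr_ge0//.
  apply: (@le_trans _ _ (rker x * `|x|)); first by rewrite ler_wpM2r.
  rewrite /rker mulrAC ler_pdivrMr ?ltr_pwDl// ler_wpM2l ?(ltW kappa0)//.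
  by rewrite lerDr ltW.
have [_ Lz] := GL2 Gvz.
have bv : nsq v + kappa^-1 * ip v z <= lower_sum f.
  rewrite -lee_fin -(form_integral Gvz).
  apply: (@step_integral_le _ (fun x => 1 + `|x| / kappa) grid) => //.
  - exact: measurable_inv_rker.
  - by move=> x; rewrite addr_ge0// divr_ge0// ltW.
  move=> j x /jlev jx; rewrite -rker_inv ler_pdivrMr ?rker_gt0// expr2.
  by rewrite ler_wpM2l// divr_ge0.
have := Gpos (GB Guw Gvz); have := ip_ge0 mu (fun x => u x - v x).
have Luv := L2B Lu Lv.
rewrite (ipBl Lu Lv Luv) (ipBr Lu Lv Lu) (ipBr Lu Lv Lv) (ipC _ v u).
have Lwz := L2B Lw Lz.
rewrite (ipBl Lu Lv Lwz) (ipBr Lw Lz Lu) (ipBr Lw Lz Lv) -(Gsym Guw Gvz) => n1 n2.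
have ufE : ip u f = nsq u + kappa^-1 * ip u w by rewrite fE ipDr// ipZr.
have vfE : ip v f = ip u v + kappa^-1 * ip w v by rewrite fE ipDr// ipZr// ipC (ipC _ v w).
have k10 : 0 <= kappa^-1 by rewrite invr_ge0 ltW.
have := mulr_ge0 k10 n2; rewrite (ipC _ v w) => n3.
have := lower_sum_ge Lf; rewrite -vf in bv *.
move: vfE ufE bv n1 n3; rewrite !mulrBr; move: (nsq f / N%:R) => y.
set a := kappa^-1 * ip u w; set b := kappa^-1 * ip w v; set c := kappa^-1 * ip v z.
lra.
Qed.

End Approximation.

(** Upper and lower step functions at mesh 1 / N enclose the
pairing. *)
Lemma resolvent_form u w f : G (u, w) -> f = (fun x => u x + kappa^-1%:C * w x) ->
  ip u f = \int[nu f]_x rker x.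
Proof.
move=> Guw fE.
apply/eqP; rewrite eq_le; apply/andP; split; apply: (@ler_add_divn _ _ _ (nsq f)); rewrite ?ip_ge0// => N N0.
  exact: form_upper Guw fE.
by rewrite -lerBlDr; exact: form_lower Guw fE.
Qed.

End ResolventForm.

(** * Resolvents as bilinear forms *)

Section HolderBound.
Context {d} {T : measurableType d} {R : realType}.
Variable mu : {measure set T -> \bar R}.
Local Notation cfun := (T -> R[i]).
Local Notation L2 := (in_Lp mu 2%:E).
Implicit Types (f g u v : cfun) (p q : R).

Lemma holder_ip p q f g : 0 < p -> 0 < q -> p^-1 + q^-1 = 1 -> L2 f -> L2 g ->
  ((ip mu f g)%:E <= cLnorm mu p%:E f * cLnorm mu q%:E g)%E.
Proof.
move=> p0 q0 pq Lf Lg; have mf := measurable_normc (L2_cmeas Lf).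
have mg := measurable_normc (L2_cmeas Lg).
have ifg := integrable_rdot Lf Lg.
apply: le_trans (hoelder mu mf mg p0 q0 pq).
rewrite Lnorm1 /ip /Rintegral fineK; last exact: (integrable_fin_num measurableT ifg).
apply: (le_trans (lee_abs _)).
apply: (le_trans (le_abse_integral mu measurableT (measurable_int _ ifg))).
apply: ge0_le_integral => //.
- by apply/measurableT_comp => //; exact: measurable_int ifg.
- by apply/measurableT_comp => //; apply/measurable_EFinP; exact: measurable_funM.
move=> x _ /=; rewrite lee_fin (@ger0_norm _ (normc _ * _)) ?mulr_ge0 ?normc_ge0//.
exact: normr_rdot.
Qed.

Lemma cLnorm_unimodular p (c : R[i]) f : normc c = 1 ->
  cLnorm mu p%:E (fun x => c * f x) = cLnorm mu p%:E f.
Proof. by move=> c1; congr (Lnorm _ _ _); apply/funext => x; rewrite normcM c1 mul1r. Qed.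

Lemma cLnorm_ge0 (r : \bar R) f : (0 <= cLnorm mu r f)%E.
Proof. exact: Lnorm_ge0. Qed.

Lemma cLnorm_fine (r : \bar R) f : in_Lp mu r f -> (fine (cLnorm mu r f))%:E = cLnorm mu r f.
Proof. by case=> _ fin; rewrite fineK// ge0_fin_numE// cLnorm_ge0. Qed.

Lemma cLnorm_fine_ge0 (r : \bar R) f : 0 <= fine (cLnorm mu r f).
Proof. by rewrite fine_ge0// cLnorm_ge0. Qed.

Lemma ip_rotate x y f g : L2 f -> L2 g ->
  ip mu f (fun z => (x +i* y) * g z) = x * ip mu f g + y * ip mu f (fun z => 'i%C * g z).
Proof.
move=> Lf Lg; have Lig := L2Z 'i%C Lg.
have -> : (fun z => (x +i* y) * g z) = (fun z => x%:C * g z + y%:C * ('i%C * g z)).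
  by apply/funext => z; rewrite mulrA -mulrDl; congr (_ * _); simpc.
by rewrite ipDr ?ipZr//; exact: L2Z.
Qed.

Lemma L2_opp f : L2 (fun x => - f x) -> L2 f.
Proof. by move=> /L2N; congr (in_Lp _ _); apply/funext => x; rewrite opprK. Qed.

(** The quadratic form of h(A), when E is the resolution of the identity
of A. *)
Definition mean (E : resolution_of_identity mu) (h : R -> R) f : R :=
  \int[scalar_measure E f]_x h x.

(** Scalar measures only provide quadratic forms; polarization recovers
the pairings from them. *)
Definition polar (W : cfun -> R) f g : R :=
  4^-1 * (W (fun x => f x + g x) - W (fun x => f x - g x)).

End HolderBound.

Section ResolventPairing.
Variables (R : realType) (M : ptopologicalType) (n : nat).
Variables (A : set (chart R M n)) (Delta : (M -> R) -> M -> R) (V : M -> R).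
Variable mu : {measure set (borel M) -> \bar R}.
Hypothesis hM : smooth_manifold A.
Hypothesis hDelta : diffusion_operator A Delta.
Hypothesis hV : forall x, V x <= 0.
Local Notation core := (schroedinger_core A Delta V).
Hypothesis hL : essentially_self_adjoint mu core.
Local Notation clos := (closure_op mu core).
Local Notation cfun := (borel M -> R[i]).
Local Notation L2 := (in_Lp mu 2%:E).
Local Notation ip := (ip mu).
Variable E : resolution_of_identity mu.
Hypothesis GE : spectral_resolution_of (opp_op clos) E.
Variables p q : R.
Hypothesis p1 : 1 < p.
Hypothesis q1 : 1 < q.
Hypothesis pq : p^-1 + q^-1 = 1.
Variable kappa : R.
Hypothesis kappa0 : 0 < kappa.
Implicit Types (u v f g : cfun).

Local Notation resolves u f := (clos (u, fun x => kappa%:C * (u x - f x))).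

Lemma opp_clos_L2 v w : opp_op clos (v, w) -> L2 v /\ L2 w.
Proof. by move=> /clos_L2/= [Lv Lw]; split => //; exact: L2_opp. Qed.

Lemma opp_clos_ge0 v w : opp_op clos (v, w) -> 0 <= ip v w.
Proof.
move=> /[dup] /clos_L2/= [Lv Lw] /(clos_le0 hM hDelta hV hL).
have -> : ip v (fun x => - w x) = - ip v w.
  by rewrite ipC ipNl ?(ipC _ w)//; exact: L2_opp.
by rewrite oppr_le0.
Qed.

Lemma opp_closB v w v' w' : opp_op clos (v, w) -> opp_op clos (v', w') ->
  opp_op clos ((fun x => v x - v' x), (fun x => w x - w' x)).
Proof.
rewrite /opp_op/= => c1 c2.
have := closD hM hDelta hL c1 (closZ hM hDelta hL (-1) c2); congr (clos (_, _)).
  by apply/funext => x; rewrite mulN1r.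
by apply/funext => x; rewrite mulN1r opprK opprB addrC.
Qed.

Lemma opp_clos_sym v w v' w' : opp_op clos (v, w) -> opp_op clos (v', w') ->
  ip w v' = ip v w'.
Proof.
rewrite /opp_op/= => c1 c2; have [Lv Lw] := clos_L2 c1; have [Lv' Lw'] := clos_L2 c2.
have := clos_sym hL c1 c2; rewrite ipNl//; last exact: L2_opp.
by rewrite (ipC _ v) ipNl ?(ipC _ w')//; [exact: oppr_inj|exact: L2_opp].
Qed.

Lemma resolves_form u f : L2 f -> resolves u f ->
  ip u f = mean E (rker kappa) f.
Proof.
move=> Lf uf.
have kE : kappa^-1%:C * kappa%:C = 1 :> R[i] by rewrite -rmorphM/= mulVf ?gt_eqF.
apply: (@resolvent_form _ _ _ _ E (opp_op clos) GE _ _ _ _ _ kappa0 u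
  (fun x => - (kappa%:C * (u x - f x)))).
- exact: opp_clos_L2.
- exact: opp_clos_ge0.
- exact: opp_closB.
- exact: opp_clos_sym.
- by rewrite /opp_op/=; move: uf; congr (clos (_, _)); apply/funext => x; rewrite opprK.
- by apply/funext => x; rewrite mulrN mulrA kE mul1r opprB addrC subrK.
Qed.

Lemma resolves_sym u f v g : L2 f -> L2 g -> resolves u f -> resolves v g ->
  ip u g = ip f v.
Proof.
move=> Lf Lg ru rv; have [Lu _] := clos_L2 ru; have [Lv _] := clos_L2 rv.
have := clos_sym hL ru rv; have Luf := L2B Lu Lf; have Lvg := L2B Lv Lg.
rewrite ipZl// ipZr// ipBl// ipBr// => /(mulfI (lt0r_neq0 kappa0)) h.
by move: h => /(congr1 (fun z => ip u v - z)); rewrite !subKr.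
Qed.

Lemma resolves_linear c u f v g : resolves u f -> resolves v g ->
  resolves (fun x => u x + c * v x) (fun x => f x + c * g x).
Proof.
move=> ru rv; have := closD hM hDelta hL ru (closZ hM hDelta hL c rv); congr (clos (_, _)).
by apply/funext => x; ring.
Qed.

Lemma polar_resolvent u f g : L2 f -> L2 g -> resolves u f ->
  polar (mean E (rker kappa)) f g = ip u g.
Proof.
move=> Lf Lg ru; have [s [v [_ Lv _ rv _]]] := resolvent_exists hM hDelta hV hL kappa0 Lg.
have [Lu _] := clos_L2 ru.
have Lp := L2D Lf Lg; have Lm := L2B Lf Lg; have Lup := L2D Lu Lv; have Lum := L2B Lu Lv.
have r1 : resolves (fun x => u x + v x) (fun x => f x + g x).
  have := resolves_linear 1 ru rv; congr (clos (_, _)); apply/funext => x; rewrite !mul1r//.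
have r2 : resolves (fun x => u x - v x) (fun x => f x - g x).
  have := resolves_linear (-1) ru rv; congr (clos (_, _)); apply/funext => x; rewrite !mulN1r//.
rewrite /polar -(resolves_form Lp r1) -(resolves_form Lm r2).
rewrite (ipDl Lu Lv Lp) (ipBl Lu Lv Lm) (ipDr Lf Lg Lu) (ipDr Lf Lg Lv).
rewrite (ipBr Lf Lg Lu) (ipBr Lf Lg Lv) (ipC _ v f) -(resolves_sym Lf Lg ru rv).
by field.
Qed.

(** For p > 2 the conjugate exponent q is less than 2, and the
symmetry <u, g> = <f, v>, where v is the resolvent of g, moves the contraction
to the second argument. *)
Lemma resolves_pairing_bound f g : L2 f -> in_Lp mu p%:E f -> L2 g -> in_Lp mu q%:E g ->
  exists u, resolves u f /\ ((ip u g)%:E <= cLnorm mu p%:E f * cLnorm mu q%:E g)%E.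
Proof.
move=> Lf Lpf Lg Lqg; have p0 : 0 < p by exact: lt_trans p1.
have q0 : 0 < q by exact: lt_trans q1.
have [s [u [cs Lu sf ru su]]] := resolvent_exists hM hDelta hV hL kappa0 Lf.
exists u; split => //; have [p2|p2] := leP p 2.
  apply: (le_trans (holder_ip p0 q0 pq Lu Lg)); apply: lee_wpmul2r; first exact: cLnorm_ge0.
  exact: (resolvent_Lp hM hDelta hV hL kappa0 p1 p2 cs Lu Lf Lpf sf su).
have q2 : q <= 2.
  have : q^-1 >= 2^-1.
    have : p^-1 <= 2^-1 by rewrite lef_pV2 ?posrE// ltW.
    by move: pq; lra.
  by rewrite lef_pV2 ?posrE.
have [t [v [ct Lv tg rv tv]]] := resolvent_exists hM hDelta hV hL kappa0 Lg.
rewrite (resolves_sym Lf Lg ru rv).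
apply: (le_trans (holder_ip p0 q0 pq Lf Lv)); apply: lee_wpmul2l; first exact: cLnorm_ge0.
exact: (resolvent_Lp hM hDelta hV hL kappa0 q1 q2 ct Lv Lg Lqg tg tv).
Qed.

(** The numbers x and y rotate the phase of g: the bound
for all unit vectors (x, y) is one for the modulus of the complex pairing. *)
Lemma resolvent_bilinear_bound x y f g : x ^+ 2 + y ^+ 2 = 1 ->
  L2 f -> in_Lp mu p%:E f -> L2 g -> in_Lp mu q%:E g ->
  x * polar (mean E (rker kappa)) f g + y * polar (mean E (rker kappa)) f (fun z => 'i%C * g z) <=
  fine (cLnorm mu p%:E f) * fine (cLnorm mu q%:E g).
Proof.
move=> xy Lf Lpf Lg Lqg; pose c : R[i] := x +i* y.
have c1 : normc c = 1 by rewrite normcE' /c /rdot/= -!expr2 xy sqrtr1.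
have Lcg := L2Z c Lg.
have Lqcg : in_Lp mu q%:E (fun z => c * g z).
  by case: Lqg => _; split; [case: Lcg|rewrite cLnorm_unimodular].
have [u [ru]] := resolves_pairing_bound Lf Lpf Lcg Lqcg.
rewrite cLnorm_unimodular// -lee_fin EFinM !cLnorm_fine//; apply: le_trans.
have Lig := L2Z 'i%C Lg; have [Lu _] := clos_L2 ru.
rewrite lee_fin (polar_resolvent Lf Lg ru) (polar_resolvent Lf Lig ru).
by rewrite (ip_rotate x y Lu Lg).
Qed.

End ResolventPairing.

(** * The square root kernel as an average of resolvents *)

Section ArctanIntegral.
Variable R : realType.
Local Notation RB := (measurableTypeR R).
Local Notation leb := (@lebesgue_measure R).

Lemma continuous_cauchy_kernel (a : R) : 0 < a ->
  continuous (fun t : R => a / (a ^+ 2 + t ^+ 2)).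
Proof.
move=> a0 t; apply: cvgM; first exact: cvg_cst.
apply: cvgV; first by rewrite gt_eqF// ltr_pwDl ?sqr_ge0// exprn_gt0.
by apply: cvgD; [exact: cvg_cst|exact: exprn_continuous].
Qed.

Lemma measurable_cauchy_kernel (a : R) : 0 < a ->
  measurable_fun [set: RB] (fun t : RB => a / (a ^+ 2 + t ^+ 2)).
Proof. by move=> a0; apply: continuous_measurable_fun; exact: continuous_cauchy_kernel. Qed.

Lemma cauchy_kernel_integral (a : R) : 0 < a ->
  (\int[leb]_(t in `[0%R, +oo[) (a / (a ^+ 2 + t ^+ 2))%:E = (pi / 2)%:E)%E.
Proof.
move=> a0; have aN0 : a != 0 by rewrite gt_eqF.
have at0 (t : R) : 0 < a ^+ 2 + t ^+ 2 by rewrite ltr_pwDl ?sqr_ge0// exprn_gt0.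
have cf := continuous_cauchy_kernel a0.
have dF (t : R) : is_derive t (1 : R) (fun t => atan (a^-1 * t)) (a / (a ^+ 2 + t ^+ 2)).
  apply: is_derive_eq.
  have -> : (a^-1%:A : R^o) = a^-1 by exact: mulr1.
  have h1 := at0 t; have h2 : 0 < 1 + (a^-1 * t) ^+ 2 by rewrite ltr_pwDl ?sqr_ge0.
  have -> : 1 + (a^-1 * t) ^+ 2 = (a ^+ 2 + t ^+ 2) / a ^+ 2 by field.
  by field; rewrite aN0 gt_eqF.
have cF : (fun t => atan (a^-1 * t)) t @[t --> +oo%R] --> (pi / 2 : R).
  apply: (cvg_comp (fun t => a^-1 * t) atan _ (@cvgy_atan R)).
  by apply: gt0_cvgMry; [rewrite invr_gt0|exact: cvg_id].
rewrite (ge0_continuous_FTC2y _ _ cF)/=.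
- by rewrite mulr0 atan0 oppr0 addr0.
- by move=> t _; rewrite divr_ge0// ltW.
- apply/continuous_within_itvcyP; split; first by move=> t _; exact: cf.
  by apply: cvg_at_right_filter; exact: cf.
- by move=> t t0; apply: ex_derive.
- apply: cvg_at_right_filter.
  have d0 := dF 0; have : derivable (fun t => atan (a^-1 * t)) (0:R) 1 by apply: ex_derive.
  by move=> /derivable1_diffP/differentiable_continuous.
- by move=> t _; rewrite derive1E; exact: derive_val.
Qed.

End ArctanIntegral.


Section SqrtKernel.
Variable R : realType.
Local Notation RB := (measurableTypeR R).

(** The absolute value extends the kernel from x >= 0 to the whole
line. *)
Definition sqrt_kernel (m x : R) : R := m / Num.sqrt (m ^+ 2 + `|x|).

Lemma measurable_sqrt_kernel2 :
  measurable_fun [set: RB * RB] (fun z => sqrt_kernel z.1 z.2).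
Proof.
rewrite (_ : (fun _ => _) = (fun z : RB * RB => z.1 * (z.1 ^+ 2 + `|z.2|) `^ (- 2^-1))).
  apply: measurable_funM => //; apply: (measurableT_comp (measurable_powR _)).
  by apply: measurable_funD; [exact: measurable_funX|exact: measurableT_comp].
by apply/funext => -[m x] /=; rewrite powRN powR12_sqrt// addr_ge0// sqr_ge0.
Qed.

Lemma measurable_sqrt_kernel m : measurable_fun [set: RB] (sqrt_kernel m).
Proof. exact: (measurableT_comp measurable_sqrt_kernel2 (pair1_measurable m)). Qed.

Lemma sqrt_kernel_ge0 m x : 0 <= m -> 0 <= sqrt_kernel m x.
Proof. by move=> m0; rewrite divr_ge0// sqrtr_ge0. Qed.

Lemma sqrt_kernel_le1 m x : 0 <= m -> sqrt_kernel m x <= 1.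
Proof.
rewrite le_eqVlt => /predU1P[<-|m0]; first by rewrite /sqrt_kernel mul0r.
have s0 : 0 < m ^+ 2 + `|x| by rewrite ltr_pwDl// exprn_gt0.
rewrite ler_pdivrMr ?sqrtr_gt0// mul1r -[leLHS](ger0_norm (ltW m0)) -sqrtr_sqr.
by rewrite ler_wsqrtr// lerDl.
Qed.

Lemma unit_bounded_integrable (nu : {finite_measure set RB -> \bar R}) (h : R -> R) :
  measurable_fun [set: RB] h -> (forall x, 0 <= h x) -> (forall x, h x <= 1) ->
  nu.-integrable setT (EFin \o h).
Proof.
move=> mh h0 h1; apply: (@measurable_bounded_integrable _ _ _ nu h setT) => //.
  by rewrite ltey_eq fin_num_measure.
exists 1; split; first exact: num_real.
by move=> y y1 x _ /=; rewrite ger0_norm// (le_trans (h1 x))// ltW.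
Qed.

Lemma unit_bounded_integral (nu : {finite_measure set RB -> \bar R}) (h : R -> R) :
  measurable_fun [set: RB] h -> (forall x, 0 <= h x) -> (forall x, h x <= 1) ->
  (\int[nu]_x (h x)%:E)%E = (\int[nu]_x h x)%:E.
Proof.
move=> mh h0 h1; rewrite /Rintegral fineK//; apply: (integrable_fin_num measurableT).
exact: unit_bounded_integrable.
Qed.

End SqrtKernel.

Section ResolventAverage.
Variable R : realType.
Local Notation RB := (measurableTypeR R).
Local Notation leb := (@lebesgue_measure R).
Variable m : R.
Hypothesis m0 : 0 < m.

Definition cauchy_weight (t : R) : R := m / (m ^+ 2 + t ^+ 2).

Lemma kappa_gt0 (t : R) : 0 < m ^+ 2 + t ^+ 2.
Proof. by rewrite ltr_pwDl ?sqr_ge0// exprn_gt0. Qed.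

Lemma cauchy_weight_ge0 t : 0 <= cauchy_weight t.
Proof. by rewrite divr_ge0// ltW// kappa_gt0. Qed.

(** With s = sqrt(m^2 + |x|) the integrand is (m / s) times the
Cauchy kernel s / (s^2 + t^2), whose integral over the half line is pi / 2. *)
Lemma sqrt_kernel_average x : (sqrt_kernel m x)%:E = ((2 / pi)%:E *
  \int[leb]_(t in `[0%R, +oo[) (cauchy_weight t * rker (m ^+ 2 + t ^+ 2) x)%:E)%E.
Proof.
have s0 : 0 < m ^+ 2 + `|x| by rewrite ltr_pwDl// exprn_gt0.
have sg0 : 0 < Num.sqrt (m ^+ 2 + `|x|) by rewrite sqrtr_gt0.
set sg := Num.sqrt _ in sg0.
have -> : (\int[leb]_(t in `[0%R, +oo[) (cauchy_weight t * rker (m ^+ 2 + t ^+ 2) x)%:E =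
    \int[leb]_(t in `[0%R, +oo[) ((m / sg)%:E * (sg / (sg ^+ 2 + t ^+ 2))%:E))%E.
  apply: eq_integral => t _; congr (_%:E).
  rewrite sqr_sqrtr ?ltW// /cauchy_weight /rker.
  have k0 := kappa_gt0 t; have k1 : 0 < m ^+ 2 + t ^+ 2 + `|x| by rewrite ltr_pwDl.
  have k2 : 0 < m ^+ 2 + `|x| + t ^+ 2 by rewrite addrAC.
  move: (`|x|) k0 k1 k2 => y k0 k1 k2.
  by field; rewrite !gt_eqF.
rewrite ge0_integralZl//.
- rewrite cauchy_kernel_integral// -!EFinM; congr (_%:E).
  rewrite /sqrt_kernel -/sg.
  have := pi_gt0 R; move: pi => y y0; by field; rewrite !gt_eqF.
- apply/measurable_EFinP.
  by apply: measurable_funS (measurable_cauchy_kernel sg0).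
- by move=> t _; rewrite lee_fin divr_ge0 ?addr_ge0 ?sqr_ge0// ltW.
- by rewrite lee_fin divr_ge0// ltW.
Qed.

Section Tonelli.
Variable nu : {finite_measure set RB -> \bar R}.

Lemma measurable_weighted_rker :
  measurable_fun [set: RB * RB] (fun z => cauchy_weight z.2 * rker (m ^+ 2 + z.2 ^+ 2) z.1).
Proof.
rewrite (_ : (fun _ => _) = (fun y => m^-1 * rker (m ^+ 2) y) \o
   (fun z : RB * RB => z.2 ^+ 2 + `|z.1|)).
  apply: measurableT_comp.
    by apply: measurable_funM => //; apply: measurable_rker; rewrite exprn_gt0.
  by apply: measurable_funD; [apply: measurable_funX|apply: measurableT_comp].
apply/funext => -[x t] /=; rewrite /cauchy_weight /rker.
have k0 := kappa_gt0 t; have mN0 : m != 0 by rewrite gt_eqF.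
rewrite (@ger0_norm _ (t ^+ 2 + `|x|)) ?addr_ge0 ?sqr_ge0//.
have k1 : 0 < m ^+ 2 + t ^+ 2 + `|x| by rewrite ltr_pwDl.
move: (`|x|) k1 => y k1; have k2 : 0 < m ^+ 2 + (t ^+ 2 + y) by rewrite addrA.
by field; rewrite mN0 !gt_eqF.
Qed.

Lemma integral_sqrt_kernel : (\int[nu]_x (sqrt_kernel m x)%:E = (2 / pi)%:E *
  \int[leb]_(t in `[0%R, +oo[)
    ((cauchy_weight t)%:E * \int[nu]_x (rker (m ^+ 2 + t ^+ 2) x)%:E))%E.
Proof.
pose D : set RB := `[0%R, +oo[%classic.
pose f (z : RB * RB) : \bar R :=
  (cauchy_weight z.2 * rker (m ^+ 2 + z.2 ^+ 2) z.1 * \1_D z.2)%:E.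
have f0 z : (0 <= f z)%E.
  rewrite lee_fin mulr_ge0// mulr_ge0 ?cauchy_weight_ge0//.
  by rewrite ltW// rker_gt0// kappa_gt0.
have mf : measurable_fun [set: RB * RB] f.
  apply/measurable_EFinP; apply: measurable_funM; first exact: measurable_weighted_rker.
  have mD : measurable (D : set RB) by exact: measurable_itv.
  by apply: (measurableT_comp (measurable_indic mD) measurable_snd).
have fE x t : f (x, t) = if t \in D then (cauchy_weight t * rker (m ^+ 2 + t ^+ 2) x)%:E else 0%E.
  by rewrite /f/= indicE; case: ifP => tD; rewrite ?mulr1 ?mulr0.
transitivity (\int[nu]_x ((2 / pi)%:E * \int[leb]_t f (x, t)))%E.
  apply: eq_integral => x _; rewrite sqrt_kernel_average; congr (_ * _)%E.
  by rewrite integral_mkcond; apply: eq_integral => t _; rewrite fE /patch.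
rewrite ge0_integralZl//; last first.
- by rewrite lee_fin divr_ge0// pi_ge0.
- by move=> x _; exact: integral_ge0.
- exact: (@measurable_fun_fubini_tonelli_F _ _ _ _ _ leb f mf f0).
congr (_ * _)%E; rewrite (@fubini_tonelli _ _ _ _ _ nu leb f mf f0) [RHS]integral_mkcond.
apply: eq_integral => t _; rewrite /patch; under eq_integral do rewrite fE.
case: ifP => tD; last by rewrite integral0.
under eq_integral do rewrite EFinM.
rewrite ge0_integralZl//.
- by apply/measurable_EFinP; apply: measurable_rker; exact: kappa_gt0.
- by move=> x _; rewrite lee_fin ltW// rker_gt0// kappa_gt0.
- by rewrite lee_fin cauchy_weight_ge0.
Qed.

Local Notation averaged t := (cauchy_weight t * \int[nu]_x rker (m ^+ 2 + t ^+ 2) x).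

Lemma Rintegral_rker kappa : 0 < kappa ->
  (\int[nu]_x (rker kappa x)%:E)%E = (\int[nu]_x rker kappa x)%:E.
Proof.
move=> k0; apply: unit_bounded_integral; first exact: measurable_rker.
  by move=> x; exact: ltW (rker_gt0 _ x).
by move=> x; exact: rker_le1.
Qed.

Lemma measurable_averaged : measurable_fun [set: RB] (fun t : RB => averaged t).
Proof.
apply: measurable_funM; first exact: measurable_cauchy_kernel.
pose f (z : RB * RB) : \bar R := (rker (m ^+ 2 + z.2 ^+ 2) z.1)%:E.
have f0 z : (0 <= f z)%E by rewrite lee_fin ltW// rker_gt0// kappa_gt0.
have mf : measurable_fun [set: RB * RB] f.
  apply/measurable_EFinP.
  rewrite (_ : (fun _ => _) = (fun z : RB * RB => m^-1 * (m ^+ 2 + z.2 ^+ 2) *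
      (cauchy_weight z.2 * rker (m ^+ 2 + z.2 ^+ 2) z.1))).
    apply: measurable_funM measurable_weighted_rker.
    by apply: measurable_funM => //; apply: measurable_funD => //; exact: measurable_funX.
  apply/funext => z; rewrite mulrA; rewrite [X in X * _](_ : _ = 1) ?mul1r//.
  by rewrite /cauchy_weight; have := kappa_gt0 z.2; move=> k0; field; rewrite !gt_eqF.
apply: (measurableT_comp _ (@measurable_fun_fubini_tonelli_G _ _ _ _ _ nu f mf f0)).
exact: fine_measurable.
Qed.

Lemma averagedE t : (averaged t)%:E = 
  ((cauchy_weight t)%:E * \int[nu]_x (rker (m ^+ 2 + t ^+ 2) x)%:E)%E.
Proof. by rewrite Rintegral_rker ?kappa_gt0. Qed.

Lemma Rintegral_sqrt_kernel :
  leb.-integrable `[0%R, +oo[%classic (EFin \o (fun t => averaged t)) /\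
  \int[nu]_x sqrt_kernel m x = 2 / pi * \int[leb]_(t in `[0%R, +oo[) averaged t.
Proof.
have av0 t : 0 <= averaged t.
  rewrite mulr_ge0 ?cauchy_weight_ge0// Rintegral_ge0// => x _.
  by rewrite ltW// rker_gt0// kappa_gt0.
have := integral_sqrt_kernel; under [in X in _ = X -> _]eq_integral do rewrite -averagedE.
rewrite unit_bounded_integral; last 3 first.
- exact: measurable_sqrt_kernel.
- by move=> x; exact: sqrt_kernel_ge0 (ltW m0).
- by move=> x; exact: sqrt_kernel_le1 (ltW m0).
move=> h; have c0 : 0 < 2 / pi :> R by rewrite divr_gt0// pi_gt0.
have iav : leb.-integrable `[0%R, +oo[%classic (EFin \o (fun t => averaged t)).
  apply/integrableP; split.
    by apply/measurable_EFinP; apply: measurable_funS measurable_averaged.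
  under eq_integral do rewrite /= ger0_norm//.
  rewrite ltey; apply/eqP => iy; move: h; rewrite iy.
  by rewrite gt0_muley ?lte_fin.
split => //; apply: EFin_inj; rewrite h (EFinM (2 / pi)); congr (_ * _)%E.
by rewrite /Rintegral fineK//; apply: integrable_fin_num.
Qed.

End Tonelli.

Lemma cauchy_weight_integral : leb.-integrable `[0%R, +oo[%classic (EFin \o cauchy_weight) /\
  \int[leb]_(t in `[0%R, +oo[) cauchy_weight t = pi / 2.
Proof.
have e := cauchy_kernel_integral m0; split; last by rewrite /Rintegral e.
apply/integrableP; split.
  by apply/measurable_EFinP; apply: measurable_funS (measurable_cauchy_kernel m0).
by under eq_integral do rewrite /= ger0_norm ?cauchy_weight_ge0//; rewrite e ltry.
Qed.

Lemma Rintegral_combination (I : Type) (s : seq I) (c : I -> R) (h : I -> R -> R) (D : set RB) :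
  measurable D -> (forall i, leb.-integrable D (EFin \o h i)) ->
  leb.-integrable D (EFin \o (fun t => \sum_(i <- s) c i * h i t)) /\
  \int[leb]_(t in D) (\sum_(i <- s) c i * h i t) =
  \sum_(i <- s) c i * \int[leb]_(t in D) h i t.
Proof.
move=> mD ih; elim: s => [|i s [IH1 IH2]].
  rewrite big_nil (_ : (fun t => _) = fun=> 0); last by apply/funext => t; rewrite big_nil.
  by split; [exact: integrable0|rewrite /Rintegral integral0].
rewrite (_ : (fun t => _) = fun t => c i * h i t + \sum_(j <- s) c j * h j t); last first.
  by apply/funext => t; rewrite big_cons.
have i1 : leb.-integrable D (EFin \o (fun t => c i * h i t)).
  exact: (integrableZl mD (c i) (ih i)).
split; first exact: (integrableD mD i1 IH1).
by rewrite big_cons RintegralD// RintegralZl// IH2.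
Qed.

(** A bound valid for every resolvent passes to their
average. Signed combinations of measures are allowed since Tonelli's theorem
is applied to each measure separately. *)
Lemma sqrt_kernel_combination (I : Type) (s : seq I) (c : I -> R)
    (nu : I -> {finite_measure set RB -> \bar R}) (K : R) :
  (forall kappa, 0 < kappa -> \sum_(i <- s) c i * \int[nu i]_x rker kappa x <= K) ->
  \sum_(i <- s) c i * \int[nu i]_x sqrt_kernel m x <= K.
Proof.
move=> hK; have mD : measurable (`[0%R, +oo[%classic : set RB) by exact: measurable_itv.
have ih i := (Rintegral_sqrt_kernel (nu i)).1.
have [i1 e1] := Rintegral_combination s c mD ih.
have [iw ew] := cauchy_weight_integral.
have -> : \sum_(i <- s) c i * \int[nu i]_x sqrt_kernel m x = 2 / pi *
    \int[leb]_(t in `[0%R, +oo[%classic) (\sum_(i <- s) c i *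
      (cauchy_weight t * \int[nu i]_x rker (m ^+ 2 + t ^+ 2) x)).
  rewrite e1 mulr_sumr; apply: eq_bigr => i _.
  by rewrite (Rintegral_sqrt_kernel (nu i)).2 mulrCA.
have iwK := integrableZr mD K iw.
apply: (@le_trans _ _ (2 / pi * \int[leb]_(t in `[0%R, +oo[%classic) (cauchy_weight t * K))).
  rewrite ler_wpM2l ?divr_ge0 ?pi_ge0//; apply: le_Rintegral => // t _.
  under eq_bigr do rewrite mulrCA.
  by rewrite -mulr_sumr ler_wpM2l ?cauchy_weight_ge0// hK// kappa_gt0.
rewrite RintegralZr// ew; have := pi_gt0 R; move: pi => y y0.
by rewrite le_eqVlt; apply/orP; left; apply/eqP; field; rewrite gt_eqF.
Qed.

End ResolventAverage.

(** * Bounds for 1 - m / sqrt(m^2 + x) *)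

Section SpectralMultiplier.
Context {d} {T : measurableType d} {R : realType}.
Variable mu : {measure set T -> \bar R}.
Variable E : resolution_of_identity mu.
Local Notation cfun := (T -> R[i]).
Local Notation L2 := (in_Lp mu 2%:E).
Local Notation ip := (ip mu).
Local Notation RB := (measurableTypeR R).
Local Notation nu := (scalar_measure E).
Implicit Types (f g : cfun).

(** The scalar measure of a square integrable function, under a name
which carries its finiteness. *)
Definition finite_nu f (Lf : L2 f) : set RB -> \bar R := nu f.

HB.instance Definition _ f (Lf : L2 f) := Measure.on (finite_nu Lf).

Let finite_nu_fin f (Lf : L2 f) : fin_num_fun (finite_nu Lf).
Proof. by move=> B mB; rewrite ge0_fin_numE// nu_fin. Qed.

HB.instance Definition _ f (Lf : L2 f) :=
  @Measure_isFinite.Build _ _ _ (finite_nu Lf) (finite_nu_fin Lf).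

Lemma mean_unit f (h : R -> R) (Lf : L2 f) : measurable_fun [set: RB] h -> 
  (forall x, 0 <= h x) -> (forall x, h x <= 1) ->
  mean E (fun x => 1 - h x) f = ip f f - mean E h f.
Proof.
move=> mh h0 h1; have ih := unit_bounded_integrable (finite_nu Lf) mh h0 h1.
have i1 := nu_integrable_cst E 1 Lf.
by rewrite /mean RintegralB// Rintegral_cst// nu_setT//= mul1r.
Qed.

Variables p q : R.
Hypothesis p0 : 0 < p.
Hypothesis q0 : 0 < q.
Hypothesis pq : p^-1 + q^-1 = 1.
Local Notation Lp := (in_Lp mu p%:E).
Local Notation Lq := (in_Lp mu q%:E).
Local Notation norm_p f := (fine (cLnorm mu p%:E f)).
Local Notation norm_q g := (fine (cLnorm mu q%:E g)).
Local Notation rotated W x y f g :=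
  (x * polar W f g + y * polar W f (fun z => 'i%C * g z)).

Hypothesis resolvent_bound : forall kappa x y f g, 0 < kappa ->
  x ^+ 2 + y ^+ 2 = 1 -> L2 f -> Lp f -> L2 g -> Lq g ->
  rotated (mean E (rker kappa)) x y f g <= norm_p f * norm_q g.

(** The absolute value keeps the values in [0, 1] for all real m, as
Fubini's theorem is applied on the whole plane. *)
Definition sqrt_defect (m x : R) : R := 1 - sqrt_kernel `|m| x.

Lemma holder_rotated x y f g : x ^+ 2 + y ^+ 2 = 1 -> L2 f -> Lp f -> L2 g -> Lq g ->
  x * ip f g + y * ip f (fun z => 'i%C * g z) <= norm_p f * norm_q g.
Proof.
move=> xy Lf Lpf Lg Lqg; rewrite -ip_rotate// -lee_fin EFinM !cLnorm_fine//.
rewrite -(@cLnorm_unimodular _ _ _ mu q (x +i* y)); last first.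
  by rewrite normcE' /rdot/= -!expr2 xy sqrtr1.
by apply: holder_ip => //; exact: L2Z.
Qed.

Lemma polar_ip f g : L2 f -> L2 g -> polar (fun h => ip h h) f g = ip f g.
Proof.
move=> Lf Lg; have Lp' := L2D Lf Lg; have Lm := L2B Lf Lg; rewrite /polar.
rewrite (ipDl Lf Lg Lp') (ipBl Lf Lg Lm) (ipDr Lf Lg Lf) (ipDr Lf Lg Lg).
by rewrite (ipBr Lf Lg Lf) (ipBr Lf Lg Lg) (ipC _ g f); field.
Qed.

Lemma sqrt_kernel_bound m x y f g : 0 <= m -> x ^+ 2 + y ^+ 2 = 1 ->
  L2 f -> Lp f -> L2 g -> Lq g ->
  rotated (mean E (sqrt_kernel m)) x y f g <= norm_p f * norm_q g.
Proof.
move=> m0 xy Lf Lpf Lg Lqg; have Lig := L2Z 'i%C Lg.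
have [m00|mN0] := eqVneq m 0.
  have z h : mean E (sqrt_kernel m) h = 0.
    rewrite /mean (@eq_Rintegral _ _ _ _ _ (fun=> 0)); first by rewrite /Rintegral integral0.
    by move=> t _; rewrite /sqrt_kernel m00 mul0r.
  by rewrite /polar !z !subrr !mulr0 addr0 mulr_ge0// cLnorm_fine_ge0.
have mp : 0 < m by rewrite lt_def mN0.
have L1 := L2D Lf Lg; have L3 := L2B Lf Lg; have L4 := L2D Lf Lig; have L5 := L2B Lf Lig.
pose s : seq ({finite_measure set RB -> \bar R} * R) :=
  [:: (finite_nu L1 : {finite_measure set RB -> \bar R}, x * 4^-1);
      (finite_nu L3 : {finite_measure set RB -> \bar R}, - (x * 4^-1));
      (finite_nu L4 : {finite_measure set RB -> \bar R}, y * 4^-1);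
      (finite_nu L5 : {finite_measure set RB -> \bar R}, - (y * 4^-1))].
have key h : rotated (mean E h) x y f g = \sum_(i <- s) i.2 * \int[i.1]_z h z.
  by rewrite /s !big_cons big_nil /= /polar /mean; ring.
rewrite key; apply: (sqrt_kernel_combination mp) => kappa k0.
by rewrite -key resolvent_bound.
Qed.

(** The pairing of f with g itself is bounded by Hoelder's
inequality, that of m / sqrt(m^2 - L) f by the previous bound; the sum
gives the constant 2. *)
Lemma sqrt_defect_bound m x y f g : x ^+ 2 + y ^+ 2 = 1 ->
  L2 f -> Lp f -> L2 g -> Lq g ->
  rotated (mean E (sqrt_defect m)) x y f g <= 2 * (norm_p f * norm_q g).
Proof.
move=> xy Lf Lpf Lg Lqg; have Lig := L2Z 'i%C Lg.
have L1 := L2D Lf Lg; have L3 := L2B Lf Lg; have L4 := L2D Lf Lig; have L5 := L2B Lf Lig.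
have dE h : L2 h -> mean E (sqrt_defect m) h = ip h h - mean E (sqrt_kernel `|m|) h.
  move=> Lh; apply: mean_unit => //; first exact: measurable_sqrt_kernel.
    by move=> z; exact: sqrt_kernel_ge0.
  by move=> z; exact: sqrt_kernel_le1.
have pE h : L2 h -> polar (mean E (sqrt_defect m)) f h =
    ip f h - polar (mean E (sqrt_kernel `|m|)) f h.
  move=> Lh; have La := L2D Lf Lh; have Lb := L2B Lf Lh.
  by rewrite -(polar_ip Lf Lh) /polar !dE//; ring.
rewrite !pE//.
have h1 := holder_rotated xy Lf Lpf Lg Lqg.
have xy' : (- x) ^+ 2 + (- y) ^+ 2 = 1 by rewrite !sqrrN.
have := sqrt_kernel_bound (normr_ge0 m) xy' Lf Lpf Lg Lqg.
move: h1; move: (norm_p f * _) (polar _ _ _) (polar _ _ _) (ip f g) (ip f _) => a b c e h.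
by rewrite !mulrBr !mulNr; lra.
Qed.

End SpectralMultiplier.

(** * Fubini for bounded kernels *)

Section Swap.
Variable R : realType.
Local Notation RB := (measurableTypeR R).
Variable D : set RB.
Hypothesis mD : measurable D.
Variable k : RB * RB -> R.
Hypothesis mk : measurable_fun [set: RB * RB] k.
Hypothesis k0 : forall z, 0 <= k z.
Hypothesis k1 : forall z, k z <= 1.

Lemma slice_integrable (sigma : {finite_measure set RB -> \bar R}) (x : R) :
  sigma.-integrable D (EFin \o (fun m => k (m, x))).
Proof.
apply: (integrableS measurableT) => //.
apply: unit_bounded_integrable => //.
exact: (measurableT_comp mk (pair2_measurable x)).
Qed.

Lemma slice_integralE (sigma : {finite_measure set RB -> \bar R}) (x : R) :
  (\int[sigma]_(m in D) (k (m, x))%:E)%E = (\int[sigma]_(m in D) k (m, x))%:E.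
Proof.
by rewrite /Rintegral fineK//; apply: (integrable_fin_num mD); exact: slice_integrable.
Qed.

Lemma slice_integral_ge0 (sigma : {finite_measure set RB -> \bar R}) (x : R) :
  0 <= \int[sigma]_(m in D) k (m, x).
Proof. exact: Rintegral_ge0. Qed.

Lemma measurable_slice_integral (sigma : {finite_measure set RB -> \bar R}) :
  measurable_fun [set: RB] (fun x : RB => \int[sigma]_(m in D) k (m, x)).
Proof.
pose f (z : RB * RB) : \bar R := (k z * \1_D z.1)%:E.
have f0 z : (0 <= f z)%E by rewrite lee_fin mulr_ge0.
have mf : measurable_fun [set: RB * RB] f.
  apply/measurable_EFinP; apply: measurable_funM => //.
  exact: (measurableT_comp (measurable_indic mD) measurable_fst).
have := measurableT_comp (@fine_measurable R setT measurableT)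
  (@measurable_fun_fubini_tonelli_G _ _ _ _ _ sigma f mf f0).
apply: eq_measurable_fun => x _ /=; rewrite /Rintegral [in RHS]integral_mkcond; congr fine.
apply: eq_integral => m _; rewrite /f/= /patch/= indicE.
by case: ifP => mD'; rewrite ?mulr1 ?mulr0.
Qed.

Lemma integrable_slice_integral (sigma rho : {finite_measure set RB -> \bar R}) :
  rho.-integrable D (EFin \o (fun x : RB => \int[sigma]_(m in D) k (m, x))).
Proof.
apply: (integrableS measurableT) => //.
apply: (@measurable_bounded_integrable _ _ _ rho _ setT) => //.
- by rewrite ltey_eq fin_num_measure.
- exact: measurable_slice_integral.
exists (fine (sigma D)); split; first exact: num_real.
move=> y sy x _ /=; rewrite ger0_norm ?slice_integral_ge0//.
apply: le_trans (ltW sy); have -> : fine (sigma D) = \int[sigma]_(m in D) 1.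
  by rewrite Rintegral_cst// mul1r.
apply: le_Rintegral => //; first exact: slice_integrable.
apply: (integrableS measurableT) => //.
by apply: (@unit_bounded_integrable _ sigma (fun=> 1)) => //; exact: measurable_cst.
Qed.

End Swap.

Section Fubini.
Variable R : realType.
Local Notation RB := (measurableTypeR R).
Variables nu tau : {finite_measure set RB -> \bar R}.
Variable D : set RB.
Hypothesis mD : measurable D.
Variable k : RB * RB -> R.
Hypothesis mk : measurable_fun [set: RB * RB] k.
Hypothesis k0 : forall z, 0 <= k z.
Hypothesis k1 : forall z, k z <= 1.

Let ks (z : RB * RB) := k (z.2, z.1).
Let mks : measurable_fun [set: RB * RB] ks.
Proof. exact: (measurableT_comp mk (measurable_fun_pair measurable_snd measurable_fst)). Qed.

Lemma Rintegral_swap : \int[nu]_(x in D) \int[tau]_(m in D) k (m, x) =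
  \int[tau]_(m in D) \int[nu]_(x in D) k (m, x).
Proof.
have mDf (j : RB * RB -> RB) : measurable_fun setT j ->
    measurable_fun [set: RB * RB] (fun z => \1_D (j z) : R).
  by move=> mj; exact: (measurableT_comp (measurable_indic mD) mj).
pose f (z : RB * RB) : \bar R := (k z * (\1_D z.1 * \1_D z.2))%:E.
have f0 z : (0 <= f z)%E by rewrite lee_fin !mulr_ge0.
have mf : measurable_fun [set: RB * RB] f.
  by apply/measurable_EFinP; apply: measurable_funM => //; apply: measurable_funM; exact: mDf.
have fE m x : f (m, x) = if m \in D then if x \in D then (k (m, x))%:E else 0%E else 0%E.
  by rewrite /f/= !indicE; case: (m \in D); case: (x \in D); rewrite ?mulr1 ?mul0r ?mulr0.
apply: (congr1 fine (_ : (\int[nu]_(x in D) (\int[tau]_(m in D) k (m, x))%:E =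
  \int[tau]_(m in D) (\int[nu]_(x in D) k (m, x))%:E)%E)).
transitivity (\int[nu]_x \int[tau]_m f (m, x))%E.
  rewrite integral_mkcond; apply: eq_integral => x _; rewrite /patch.
  under [RHS]eq_integral do rewrite fE.
  case: ifP => xD; last by rewrite integral0_eq// => m _; case: ifP.
  rewrite -(slice_integralE mD mk k0 k1 tau x) [LHS]integral_mkcond; apply: eq_integral => m _.
  by rewrite /patch.
rewrite -(@fubini_tonelli _ _ _ _ _ tau nu f mf f0) [RHS]integral_mkcond.
apply: eq_integral => m _; rewrite /patch.
under [LHS]eq_integral do rewrite fE.
case: ifP => xD; last by rewrite integral0_eq.
have <- := slice_integralE mD mks (fun z => k0 (z.2, z.1)) (fun z => k1 (z.2, z.1)) nu m.
by rewrite [RHS]integral_mkcond; apply: eq_integral => x _; rewrite /patch.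
Qed.

Lemma integrable_swapped :
  tau.-integrable D (EFin \o (fun m : RB => \int[nu]_(x in D) k (m, x))).
Proof.
by apply: (integrable_slice_integral mD mks) => z; [exact: k0|exact: k1].
Qed.

End Fubini.

(** * Jordan parts and total variation *)

Section JordanParts.
Variable R : realType.
Local Notation RB := (measurableTypeR R).
Variable nu : {charge set RB -> \bar R}.

Let hahn := cid (projT2 (cid (Hahn_decomposition nu))).
(** The Jordan parts that are chosen in the integral against a
charge. *)
Definition cpos : {finite_measure set RB -> \bar R} := jordan_pos (projT2 hahn).
Definition cneg : {finite_measure set RB -> \bar R} := jordan_neg (projT2 hahn).

Lemma charge_integralE D h :
  charge_integral nu D h = \int[cpos]_(x in D) h x - \int[cneg]_(x in D) h x.
Proof. by []. Qed.

Lemma fine_charge (B : set RB) : measurable B ->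
  fine (nu B) = fine (cpos B) - fine (cneg B).
Proof.
move=> mB; rewrite (jordan_decomp (projT2 hahn) mB) /cadd/= /cscale/= mulN1e fineB//.
  exact: fin_num_measure (cpos) _ mB.
exact: fin_num_measure (cneg) _ mB.
Qed.

End JordanParts.

Section ChargeSwap.
Variable R : realType.
Local Notation RB := (measurableTypeR R).

Lemma charge_integral_swap (al : {charge set RB -> \bar R})
    (nu : {finite_measure set RB -> \bar R}) (D : set RB) (k : RB * RB -> R) :
  measurable D -> measurable_fun [set: RB * RB] k ->
  (forall z, 0 <= k z) -> (forall z, k z <= 1) ->
  \int[nu]_(x in D) charge_integral al D (fun m => k (m, x)) =
  charge_integral al D (fun m => \int[nu]_(x in D) k (m, x)).
Proof.
move=> mD mk k0 k1; rewrite charge_integralE -!(Rintegral_swap _ _ mD mk k0 k1).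
by rewrite -RintegralB//; exact: integrable_slice_integral.
Qed.

End ChargeSwap.

Section Variation.
Variable R : realType.
Local Notation RB := (measurableTypeR R).
Variable alpha : complex_measure R.
Local Notation re_pos := (cpos (cm_re alpha)).
Local Notation re_neg := (cneg (cm_re alpha)).
Local Notation im_pos := (cpos (cm_im alpha)).
Local Notation im_neg := (cneg (cm_im alpha)).
Variable D : set RB.
Hypothesis mD : measurable D.

Lemma finite_measure_fine (nu : {finite_measure set RB -> \bar R}) (B : set RB) :
  measurable B -> (fine (nu B))%:E = nu B.
Proof. by move=> mB; rewrite fineK// fin_num_measure. Qed.

Lemma normc_le_abs (a b : R) : normc (a +i* b) <= `|a| + `|b|.
Proof.
rewrite -(@ler_pXn2r _ 2)// ?nnegrE ?addr_ge0 ?normc_ge0// sqr_normc /rdot/=.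
rewrite sqrrD !real_normK ?num_real// -!expr2 addrAC lerDl.
by rewrite mulrn_wge0// mulr_ge0.
Qed.

Lemma normc_cm_value_le (B : set RB) : measurable B ->
  ((normc (cm_value alpha B))%:E <= re_pos B + re_neg B + (im_pos B + im_neg B))%E.
Proof.
move=> mB; rewrite -(finite_measure_fine re_pos mB) -(finite_measure_fine re_neg mB).
rewrite -(finite_measure_fine im_pos mB) -(finite_measure_fine im_neg mB) -!EFinD lee_fin.
apply: (le_trans (normc_le_abs _ _)); rewrite (fine_charge (cm_re alpha) mB) (fine_charge (cm_im alpha) mB).
have ge0 (nu : {finite_measure set RB -> \bar R}) : 0 <= fine (nu B) by exact: fine_ge0.
by apply: lerD; (apply: (le_trans (ler_normB _ _)); rewrite !ger0_norm ?ge0).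
Qed.

(** The sum of the four Jordan parts dominates the modulus of the
measure on every set. *)
Lemma cm_variation_fin : (cm_variation alpha D < +oo)%E.
Proof.
apply: (@le_lt_trans _ _ (re_pos D + re_neg D + (im_pos D + im_neg D))%E); last first.
  by rewrite !lte_add_pinfty// ltey_eq fin_num_measure.
apply: ge_ereal_sup => _ [F [mF tF FD ->]].
have tot (nu : {finite_measure set RB -> \bar R}) :
    (\sum_(0 <= i <oo) nu (F i) = nu D)%E.
  by rewrite -FD measure_bigcup//; apply: eq_eseriesl => i; apply/esym/mem_set.
rewrite -!tot -!nneseriesD//; try by [move=> i _ _; rewrite adde_ge0].
by apply: lee_nneseries => i _; [rewrite lee_fin normc_ge0|exact: normc_cm_value_le].
Qed.

Lemma cm_variation_ge0 : (0 <= cm_variation alpha D)%E.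
Proof.
pose F i : set RB := if i == 0%N then D else set0.
apply: (@le_trans _ _ (\sum_(0 <= i <oo) (normc (cm_value alpha (F i)))%:E)%E).
  by apply: nneseries_ge0 => i _ _; rewrite lee_fin normc_ge0.
apply: ereal_sup_ubound; exists F; split => //.
- by move=> [|i]; [exact: mD|exact: measurable0].
- by move=> [|i] [|j] _ _ [x []].
apply/seteqP; split => [x [[|i] _ //]|x Dx]; by exists 0%N.
Qed.

Lemma cm_variation_partition (F : nat -> set RB) n : (forall i, measurable (F i)) ->
  trivIset setT F -> \bigcup_i F i = D ->
  \sum_(i <- iota 0 n) normc (cm_value alpha (F i)) <= fine (cm_variation alpha D).
Proof.
move=> mF tF FD; rewrite -lee_fin fineK; last first.
  by rewrite ge0_fin_numE ?cm_variation_fin// cm_variation_ge0.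
apply: (@le_trans _ _ (\sum_(0 <= i <oo) (normc (cm_value alpha (F i)))%:E)%E); last first.
  by apply: ereal_sup_ubound; exists F.
rewrite -sumEFin -[in leLHS](subn0 n); apply: nneseries_lim_ge => i _ _.
by rewrite lee_fin normc_ge0.
Qed.
End Variation.

(** * Pairing functions with a complex measure *)

Lemma perturbed_square_le (R : realFieldType) (X Y p q e K : R) :
  `|X| <= K -> `|Y| <= K -> X ^+ 2 + Y ^+ 2 <= K ^+ 2 ->
  p <= X <= p + e -> q <= Y <= q + e -> p ^+ 2 + q ^+ 2 <= (K + 2 * e) ^+ 2.
Proof.
have key (Z r : R) : `|Z| <= K -> r <= Z <= r + e -> r ^+ 2 <= Z ^+ 2 + 2 * K * e + e ^+ 2.
  rewrite ler_norml => /andP[z1 z2] /andP[r1 r2].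
  have a0 : 0 <= Z - r by rewrite subr_ge0.
  have ae : 0 <= e - (Z - r) by rewrite subr_ge0 lerBlDl.
  have k0 : 0 <= K by lra.
  have zk : 0 <= K + Z by lra.
  have -> : r = Z - (Z - r) by ring.
  move: (Z - r) a0 ae => a a0 ae.
  have := mulr_ge0 zk a0; have := mulr_ge0 k0 ae; have := mulr_ge0 (addr_ge0 a0 ae) ae.
  have := mulr_ge0 a0 ae; nra.
move=> XK YK XY pX qY; have := key _ _ XK pX; have := key _ _ YK qY.
have := sqr_ge0 e; nra.
Qed.

Section ChargePairing.
Variable R : realType.
Local Notation RB := (measurableTypeR R).
Variable alpha : complex_measure R.
Local Notation re_pos := (cpos (cm_re alpha)).
Local Notation re_neg := (cneg (cm_re alpha)).
Local Notation im_pos := (cpos (cm_im alpha)).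
Local Notation im_neg := (cneg (cm_im alpha)).
Variable D : set RB.
Hypothesis mD : measurable D.
Variables P Q : R -> R.
Hypothesis mP : measurable_fun [set: RB] P.
Hypothesis mQ : measurable_fun [set: RB] Q.
Variable K : R.
Hypothesis K0 : 0 < K.
Hypothesis PQK : forall m, P m ^+ 2 + Q m ^+ 2 <= K ^+ 2.

Let Ple m : `|P m| <= K.
Proof.
rewrite -(@ler_pXn2r _ 2)// ?nnegrE ?(ltW K0)// real_normK ?num_real//.
by apply: le_trans (PQK m); rewrite lerDl sqr_ge0.
Qed.

Let Qle m : `|Q m| <= K.
Proof.
rewrite -(@ler_pXn2r _ 2)// ?nnegrE ?(ltW K0)// real_normK ?num_real//.
by apply: le_trans (PQK m); rewrite lerDr sqr_ge0.
Qed.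

Section Grid.
Variable N : nat.
Hypothesis N0 : (0 < N)%N.

(** Maps [-K, K] onto [0, 1], where the level sets of a function form a
partition. *)
Definition rescale (F : R -> R) (m : R) : R := (F m + K) / (2 * K).
Definition node (i : nat) : R := 2 * K * (i%:R / N%:R) - K.
Definition mesh : R := 2 * K / N%:R.

Let K2 : 0 < 2 * K. Proof. by rewrite mulr_gt0. Qed.
Let N0' : 0 < N%:R :> R. Proof. by rewrite ltr0n. Qed.

Lemma mesh_ge0 : 0 <= mesh.
Proof. by rewrite divr_ge0// ltW. Qed.

Lemma measurable_rescale F : measurable_fun [set: RB] F -> measurable_fun [set: RB] (rescale F).
Proof. by move=> mF; apply: measurable_funM => //; exact: measurable_funD. Qed.

Lemma rescale_ge0 F m : `|F m| <= K -> 0 <= rescale F m.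
Proof. by rewrite ler_norml => /andP[h _]; rewrite divr_ge0 ?(ltW K2)// -lerBlDr sub0r. Qed.

Lemma rescale_le1 F m : `|F m| <= K -> rescale F m <= 1.
Proof.
rewrite ler_norml => /andP[_ h]; rewrite ler_pdivrMr// mul1r mulrDl mul1r.
by rewrite lerD2r.
Qed.

Lemma level_node F i m : level (rescale F) N i m -> node i <= F m <= node i + mesh.
Proof.
have e : i.+1%:R / N%:R = i%:R / N%:R + N%:R^-1 :> R by rewrite -natr1 mulrDl mul1r.
rewrite /level/= /rescale ler_pdivlMr// ltr_pdivrMr// /node /mesh e {e}.
by move: (i%:R / N%:R : R) (N%:R^-1 : R) => a e /andP[h1 h2]; apply/andP; split; lra.
Qed.

(** The index k runs over pairs of levels, of P and of Q. *)
Definition cell k : set RB := D `&`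
  (level (rescale P) N (k %/ N.+1) `&` level (rescale Q) N (k %% N.+1)).

Lemma measurable_cell k : measurable (cell k).
Proof.
apply: measurableI => //; apply: measurableI.
  exact: (measurable_level (measurable_rescale mP)).
exact: (measurable_level (measurable_rescale mQ)).
Qed.

Lemma trivIset_cell : trivIset setT cell.
Proof.
move=> k l _ _ [x [[_ [kP kQ]] [_ [lP lQ]]]].
have e1 : (k %/ N.+1 = l %/ N.+1)%N.
  by apply: (@trivIset_level R (rescale P) N N0) => //; exists x.
have e2 : (k %% N.+1 = l %% N.+1)%N.
  by apply: (@trivIset_level R (rescale Q) N N0) => //; exists x.
by rewrite (divn_eq k N.+1) (divn_eq l N.+1) e1 e2.
Qed.

Lemma bigcup_cell : \big[setU/set0]_(k <- iota 0 (N.+1 * N.+1)) cell k = D.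
Proof.
rewrite -bigcup_seq; apply/seteqP; split => [x [k _ []]//|x Dx].
have cov F : (forall m, `|F m| <= K) -> exists2 i, (i < N.+1)%N & level (rescale F) N i x.
  move=> FK; have := @cover_level R (rescale F) (fun m => rescale_ge0 (FK m))
    (fun m => rescale_le1 (FK m)) N N0.
  move/seteqP => [_ /(_ x I)]; rewrite -bigcup_seq => -[i /= p xi]; exists i => //.
  by move: p; rewrite -[_ :: _]/(iota 0 N.+1) mem_iota add0n.
have [i iN xi] := cov P Ple; have [j jN xj] := cov Q Qle.
exists (i * N.+1 + j)%N.
  change ((i * N.+1 + j)%N \in iota 0 (N.+1 * N.+1)); rewrite mem_iota add0n leq0n/= (@leq_trans (i.+1 * N.+1))//.
    by rewrite mulSn addnC ltn_add2r.
  by rewrite leq_mul2r iN orbT.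
by split => //; rewrite divnMDl// divn_small// addn0 modnMDl modn_small.
Qed.

Lemma integral_cell (nu : {finite_measure set RB -> \bar R}) (F : R -> R) :
  measurable_fun [set: RB] F -> (forall m, `|F m| <= K) ->
  \int[nu]_(x in D) F x = \sum_(k <- iota 0 (N.+1 * N.+1)) \int[nu]_(x in cell k) F x.
Proof.
move=> mF FK; have iF B : measurable B -> nu.-integrable B (EFin \o F).
  move=> mB; apply: (integrableS measurableT) => //.
  apply: (@measurable_bounded_integrable _ _ _ nu F setT) => //.
    by rewrite ltey_eq fin_num_measure.
  by exists K; split; [exact: num_real|move=> y Ky x _; exact: le_trans (FK x) (ltW Ky)].
rewrite -{1}bigcup_cell /Rintegral integral_bigsetU_EFin//.
- rewrite -sum_fine// => k _; apply: integrable_fin_num; first exact: measurable_cell.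
  by apply: iF; exact: measurable_cell.
- exact: measurable_cell.
- exact: iota_uniq.
- exact: sub_trivIset trivIset_cell.
- by apply/measurable_EFinP; exact: measurable_funS mF.
Qed.

Lemma cell_integral_bounds (nu : {finite_measure set RB -> \bar R}) (F : R -> R) i (B : set RB) :
  measurable_fun [set: RB] F -> measurable B -> B `<=` level (rescale F) N i ->
  node i * fine (nu B) <= \int[nu]_(x in B) F x <= (node i + mesh) * fine (nu B).
Proof.
move=> mF mB Bi; have c1 (c : R) : nu.-integrable B (EFin \o (fun=> c)).
  apply: (integrableS measurableT) => //.
  apply: (@measurable_bounded_integrable _ _ _ nu (fun=> c) setT) => //.
    by rewrite ltey_eq fin_num_measure.
  by exists `|c|; split; [exact: num_real|move=> y cy x _; exact: ltW].
have iF : nu.-integrable B (EFin \o F).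
  apply: le_integrable (c1 (`|node i| + mesh)) => //.
    by apply/measurable_EFinP; exact: measurable_funS mF.
  move=> x /Bi /level_node /andP[h1 h2] /=; rewrite lee_fin (le_trans _ (ler_norm _))//.
  rewrite ler_norml; apply/andP; split.
    apply: le_trans h1; rewrite opprD; have := ler_norm (- node i); rewrite normrN.
    by have := mesh_ge0; move: mesh `|_| => a b; lra.
  by apply: (le_trans h2); rewrite lerD2r ler_norm.
rewrite -!Rintegral_cst//; apply/andP; split; apply: le_Rintegral => // x /Bi.
  by move=> /level_node /andP[].
by move=> /level_node /andP[].
Qed.

Local Notation I nu F k := (\int[nu]_(x in cell k) F x).

(** If P and Q had constant values a and b on the cell, its
contribution would be at most |(a, b)| |alpha(cell)|; their oscillation costs
a multiple of the mesh. *)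
Lemma cell_pairing k :
  I re_pos P k - I re_neg P k - (I im_pos Q k - I im_neg Q k) <=
  (K + 2 * mesh) * normc (cm_value alpha (cell k)) +
  mesh * (fine (re_pos (cell k)) + fine (im_neg (cell k))).
Proof.
have mc := measurable_cell k.
have cP : cell k `<=` level (rescale P) N (k %/ N.+1) by move=> x [_ []].
have cQ : cell k `<=` level (rescale Q) N (k %% N.+1) by move=> x [_ []].
have /andP[_ b1] := cell_integral_bounds re_pos mP mc cP.
have /andP[b2 _] := cell_integral_bounds re_neg mP mc cP.
have /andP[b3 _] := cell_integral_bounds im_pos mQ mc cQ.
have /andP[_ b4] := cell_integral_bounds im_neg mQ mc cQ.
set pp := node (k %/ N.+1) in b1 b2; set qq := node (k %% N.+1) in b3 b4.
have eP := fine_charge (cm_re alpha) mc; have eQ := fine_charge (cm_im alpha) mc.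
have key : pp * fine (cm_re alpha (cell k)) - qq * fine (cm_im alpha (cell k)) <=
    (K + 2 * mesh) * normc (cm_value alpha (cell k)).
  have [c0|/set0P[x cx]] := eqVneq (cell k) set0.
    rewrite c0 !charge0/= !mulr0 subr0 mulr_ge0 ?normc_ge0// addr_ge0 ?(ltW K0)//.
    by rewrite mulr_ge0// mesh_ge0.
  apply: (@le_trans _ _ (normc (pp +i* (- qq)) * normc (cm_value alpha (cell k)))).
    apply: le_trans (normr_rdot _ _); apply: le_trans (ler_norm _).
    by rewrite /rdot/= mulNr.
  rewrite ler_wpM2r ?normc_ge0//.
  rewrite -(@ler_pXn2r _ 2)// ?nnegrE ?normc_ge0//; last first.
    by rewrite addr_ge0 ?(ltW K0)// mulr_ge0// mesh_ge0.
  rewrite sqr_normc /rdot/= -!expr2 sqrrN.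
  exact: (perturbed_square_le (Ple x) (Qle x) (PQK x) (level_node (cP _ cx)) (level_node (cQ _ cx))).
move: b1 b2 b3 b4 key; rewrite eP eQ !mulrDl; lra.
Qed.

Lemma sum_cell_measure (nu : {finite_measure set RB -> \bar R}) :
  \sum_(k <- iota 0 (N.+1 * N.+1)) fine (nu (cell k)) = fine (nu D).
Proof.
have mc := measurable_cell; rewrite sum_fine; last by move=> k _; exact: fin_num_measure.
congr fine; rewrite -[in RHS]bigcup_cell -(subn0 (N.+1 * N.+1)%N) -/(index_iota 0 _) !big_mkord.
by rewrite measure_bigsetU//; exact: trivIset_cell.
Qed.

Lemma bigcup_cell_seq : \bigcup_k cell k = D.
Proof.
apply/seteqP; split => [x [k _ []]//|x]; rewrite -{1}bigcup_cell -bigcup_seq.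
by move=> [k _ kx]; exists k.
Qed.

Lemma charge_pairing_mesh :
  charge_integral (cm_re alpha) D P - charge_integral (cm_im alpha) D Q <=
  K * fine (cm_variation alpha D) + 2 * K * (2 * fine (cm_variation alpha D) +
    (fine (re_pos D) + fine (im_neg D))) / N%:R.
Proof.
rewrite !charge_integralE.
rewrite (integral_cell re_pos mP Ple) (integral_cell re_neg mP Ple).
rewrite (integral_cell im_pos mQ Qle) (integral_cell im_neg mQ Qle) -!sumrB.
apply: (@le_trans _ _ (\sum_(k <- iota 0 (N.+1 * N.+1))
    ((K + 2 * mesh) * normc (cm_value alpha (cell k)) +
     mesh * (fine (re_pos (cell k)) + fine (im_neg (cell k)))))).
  by apply: ler_sum => k _; exact: cell_pairing.
rewrite big_split/= -!mulr_sumr big_split/= !sum_cell_measure.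
have Ke : 0 <= K + 2 * mesh by rewrite addr_ge0 ?(ltW K0)// mulr_ge0// mesh_ge0.
have := cm_variation_partition alpha mD (N.+1 * N.+1) measurable_cell trivIset_cell bigcup_cell_seq.
move=> /(ler_wpM2l Ke) h; apply: (le_trans (lerD h (lexx _))).
by rewrite /mesh le_eqVlt; apply/orP; left; apply/eqP; field; rewrite gt_eqF.
Qed.

End Grid.

(** The real part of the integral of P + i Q against alpha, bounded
by the modulus of P + i Q and the total variation. *)
Lemma charge_pairing :
  charge_integral (cm_re alpha) D P - charge_integral (cm_im alpha) D Q <=
  K * fine (cm_variation alpha D).
Proof.
apply: (@ler_add_divn _ _ _ (2 * K * (2 * fine (cm_variation alpha D) +
    (fine (re_pos D) + fine (im_neg D))))); last exact: charge_pairing_mesh.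
have fine_cge0 B (nu : {finite_measure set RB -> \bar R}) : 0 <= fine (nu B) by exact: fine_ge0.
rewrite !mulr_ge0 ?(ltW K0)// !addr_ge0 ?mulr_ge0 ?fine_cge0//.
by rewrite fine_ge0// cm_variation_ge0.
Qed.
End ChargePairing.

(** * The functional calculus *)

Section FunctionalCalculus.
Context {d} {T : measurableType d} {R : realType}.
Variable mu : {measure set T -> \bar R}.
Variable E : resolution_of_identity mu.
Local Notation cfun := (T -> R[i]).
Local Notation L2 := (in_Lp mu 2%:E).
Local Notation ip := (ip mu).
Local Notation RB := (measurableTypeR R).
Local Notation nu := (scalar_measure E).
Local Notation D := (`[0%R, +oo[%classic : set RB).
Variable alpha : complex_measure R.
Variable Phi : R -> R[i].
Variable S : cfun -> cfun.
Hypothesis nu_lt0 : forall f, L2 f -> nu f [set x | x < 0] = 0%E.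
Hypothesis Phi_rep : forall x, 0 <= x ->
  Phi x = cm_integral alpha `[0, +oo[ (fun m => 1 - m / Num.sqrt (m ^+ 2 + x)).
Hypothesis S_Phi : spectral_integral E `[0, +oo[ Phi S.
Implicit Types (f g : cfun).

Local Notation k := (fun z : RB * RB => sqrt_defect z.1 z.2).

Let mD : measurable D. Proof. exact: measurable_itv. Qed.

Lemma sqrt_defect_ge0 m x : 0 <= sqrt_defect m x :> R.
Proof. by rewrite subr_ge0 sqrt_kernel_le1. Qed.

Lemma sqrt_defect_le1 m x : sqrt_defect m x <= 1 :> R.
Proof. by rewrite lerBlDr lerDl sqrt_kernel_ge0. Qed.

Lemma measurable_sqrt_defect2 : measurable_fun [set: RB * RB] k.
Proof.
apply: measurable_funB; first exact: measurable_cst.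
apply: (@measurableT_comp _ _ _ _ _ _ (fun z : RB * RB => sqrt_kernel z.1 z.2) _
  (fun z : RB * RB => (`|z.1|, z.2))); first exact: measurable_sqrt_kernel2.
by apply: measurable_fun_pair; [exact: measurableT_comp|exact: measurable_snd].
Qed.

Lemma mean_restrict f m : L2 f ->
  mean E (sqrt_defect m) f = \int[nu f]_(x in D) sqrt_defect m x.
Proof.
move=> Lf; have Nm := @measurable_negative R.
have -> : (D : set RB) = setT `\` [set x : RB | x < 0].
  apply/seteqP; split => x /=; rewrite in_itv/= andbT.
    by move=> x0; split => //; apply/negP; rewrite -leNgt.
  by move=> [_ /negP]; rewrite -leNgt.
rewrite /mean /Rintegral (negligible_integral Nm measurableT _ (nu_lt0 Lf))//.
apply: (@unit_bounded_integrable _ (finite_nu E Lf)).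
- exact: (measurableT_comp measurable_sqrt_defect2 (pair1_measurable m)).
- by move=> x; exact: sqrt_defect_ge0.
- by move=> x; exact: sqrt_defect_le1.
Qed.

(** Fubini's theorem: integrating the representation of Phi
against the scalar measure of f is integrating the quadratic forms of the
kernels against alpha. *)
Lemma charge_representation (al : {charge set RB -> \bar R}) f : L2 f ->
  \int[nu f]_(x in D) charge_integral al D (fun m => 1 - m / Num.sqrt (m ^+ 2 + x)) =
  charge_integral al D (fun m => mean E (sqrt_defect m) f).
Proof.
move=> Lf; have D0 (x : R) : x \in D -> 0 <= x.
  by rewrite inE/= in_itv/= andbT.
have ext (h h' : R -> R) : (forall m, 0 <= m -> h m = h' m) ->
    charge_integral al D h = charge_integral al D h'.
  by move=> hh'; rewrite !charge_integralE; congr (_ - _); apply: eq_Rintegral => m /D0;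
    exact: hh'.
have -> : charge_integral al D (fun m => mean E (sqrt_defect m) f) =
    charge_integral al D (fun m => \int[finite_nu E Lf]_(x in D) k (m, x)).
  by apply: ext => m _; exact: mean_restrict.
rewrite -(charge_integral_swap al (finite_nu E Lf) mD measurable_sqrt_defect2).
- apply: eq_Rintegral => x /D0 x0; apply: ext => m m0.
  by rewrite /sqrt_defect /sqrt_kernel !ger0_norm.
- by move=> z; exact: sqrt_defect_ge0.
- by move=> z; exact: sqrt_defect_le1.
Qed.

Let SL2 f : L2 f -> L2 (S f). Proof. exact: S_Phi.1.1. Qed.

Lemma S_form f : L2 f ->
  ip (S f) f = charge_integral (cm_re alpha) D (fun m => mean E (sqrt_defect m) f) /\
  ip (S f) (fun z => 'i%C * f z) =
    charge_integral (cm_im alpha) D (fun m => mean E (sqrt_defect m) f).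
Proof.
move=> Lf; have q := S_Phi.2 f Lf; rewrite -Re_inner -Im_inner q /=.
have D0 (x : R) : x \in D -> 0 <= x by rewrite inE/= in_itv/= andbT.
rewrite -!(charge_representation _ Lf); split; apply: eq_Rintegral => x /D0 x0;
by rewrite Phi_rep.
Qed.

Lemma S_linear c f g h : L2 f -> L2 g -> L2 h ->
  ip (S (fun y => f y + c * g y)) h = ip (S f) h + ip (fun x => c * S g x) h.
Proof.
move=> Lf Lg Lh; have Lcg := L2Z c Lg; have LSg := L2Z c (SL2 Lg).
have := S_Phi.1.2 c g f Lg Lf => ae.
have -> : (fun y => f y + c * g y) = (fun y => c * g y + f y).
  by apply/funext => y; rewrite addrC.
rewrite (eq_ip _ _ Lh ae).
- by rewrite (ipDl LSg (SL2 Lf) Lh) addrC.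
- exact: SL2 (L2D Lcg Lf).
- exact: L2D LSg (SL2 Lf).
Qed.

Lemma S_quadratic c e f g : L2 f -> L2 g ->
  ip (S (fun y => f y + c * g y)) (fun y => e * (f y + c * g y)) =
  ip (S f) (fun y => e * f y) + ip (S f) (fun y => (e * c) * g y) +
  (ip (S g) (fun y => (c^* * e) * f y) + ip (S g) (fun y => (c^* * e * c) * g y)).
Proof.
move=> Lf Lg; have Lef := L2Z e Lf; have Lcg := L2Z (e * c) Lg; have Lh := L2D Lef Lcg.
have -> : (fun y => e * (f y + c * g y)) = (fun y => e * f y + (e * c) * g y).
  by apply/funext => y; rewrite mulrDr mulrA.
rewrite (S_linear c Lf Lg Lh) (ipDr Lef Lcg (SL2 Lf)) ip_mull; congr (_ + _).
have -> : (fun x => c^* * (e * f x + e * c * g x)) =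
    (fun y => (c^* * e) * f y + (c^* * e * c) * g y).
  by apply/funext => y; rewrite mulrDr !mulrA.
by rewrite (ipDr (L2Z _ Lf) (L2Z _ Lg) (SL2 Lg)).
Qed.

(** S is linear but not symmetric, so both the real and the imaginary
part of its quadratic form enter the polarization. *)
Lemma S_polar f g : L2 f -> L2 g ->
  ip (S f) g = polar (fun h => ip (S h) h) f g -
    polar (fun h => ip (S h) (fun z => 'i%C * h z)) f (fun z => 'i%C * g z).
Proof.
move=> Lf Lg; have Lig := L2Z 'i%C Lg.
have sc (c : R[i]) (a : R) u v : L2 u -> L2 v -> c = a%:C ->
    ip u (fun y => c * v y) = a * ip u v by move=> Lu Lv ->; rewrite ipZr.
have SLf := SL2 Lf; have SLg := SL2 Lg.
have e1 (c : R) : c ^+ 2 = 1 -> ip (S (fun y => f y + c%:C * g y)) (fun y => f y + c%:C * g y) =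
    ip (S f) f + c * ip (S f) g + (c * ip (S g) f + ip (S g) g).
  move=> c2; have := S_quadratic c%:C 1 Lf Lg.
  rewrite (sc _ 1 _ _ SLf Lf)// (sc _ c _ _ SLf Lg) ?mul1r//.
  rewrite (sc _ c _ _ SLg Lf); last by apply: eq_Re_Im; rewrite /=; ring.
  rewrite (sc _ (c ^+ 2) _ _ SLg Lg); last by apply: eq_Re_Im; rewrite /=; ring.
  by rewrite c2 !mul1r => <-; congr (ip _ _); apply/funext => y; rewrite mul1r.
have e2 (c : R) : c ^+ 2 = 1 ->
    ip (S (fun y => f y + c%:C * ('i%C * g y))) (fun y => 'i%C * (f y + c%:C * ('i%C * g y))) =
    ip (S f) (fun y => 'i%C * f y) - c * ip (S f) g +
    (c * ip (S g) f + ip (S g) (fun y => 'i%C * g y)).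
  move=> c2; have := S_quadratic (c%:C * 'i%C) 'i%C Lf Lg.
  rewrite (sc _ (- c) _ _ SLf Lg); last by apply: eq_Re_Im; rewrite /=; ring.
  rewrite (sc _ c _ _ SLg Lf); last by apply: eq_Re_Im; rewrite /=; ring.
  have -> : (c%:C * 'i%C)^* * 'i%C * (c%:C * 'i%C) = (c ^+ 2)%:C * 'i%C :> R[i].
    by apply: eq_Re_Im; rewrite /=; ring.
  rewrite c2 mul1r mulNr => <-; congr (ip (S _) _); apply/funext => y; rewrite ?mulrA//.
have s1 (c : R) h : c ^+ 2 = 1 -> (fun y => c%:C * g y) = h ->
    ip (S (fun y => f y + h y)) (fun y => f y + h y) =
    ip (S f) f + c * ip (S f) g + (c * ip (S g) f + ip (S g) g).
  by move=> c2 <-; exact: e1.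
have s2 (c : R) h : c ^+ 2 = 1 -> (fun y => c%:C * ('i%C * g y)) = h ->
    ip (S (fun y => f y + h y)) (fun y => 'i%C * (f y + h y)) =
    ip (S f) (fun y => 'i%C * f y) - c * ip (S f) g +
    (c * ip (S g) f + ip (S g) (fun y => 'i%C * g y)).
  by move=> c2 <-; exact: e2.
have pos h : (fun y => 1%:C * h y) = h :> cfun by apply/funext => y; rewrite mul1r.
have neg h : (fun y => (- 1)%:C * h y) = (fun y => - h y) :> cfun.
  by apply/funext => y; rewrite rmorphN mulN1r.
have one : (1 : R) ^+ 2 = 1 by rewrite expr1n.
have mone : (- 1 : R) ^+ 2 = 1 by rewrite sqrrN expr1n.
rewrite /polar (s1 _ _ one (pos g)) (s1 _ _ mone (neg g)).
rewrite (s2 _ _ one (pos (fun y => 'i%C * g y))) (s2 _ _ mone (neg (fun y => 'i%C * g y))).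
move: (ip (S f) f) (ip (S f) g) (ip (S g) f) (ip (S g) g) (ip (S f) _) (ip (S g) _).
by move=> *; field.
Qed.

Lemma charge_integral_polar (al : {charge set RB -> \bar R}) f g : L2 f -> L2 g ->
  polar (fun h => charge_integral al D (fun m => mean E (sqrt_defect m) h)) f g =
  charge_integral al D (fun m => polar (mean E (sqrt_defect m)) f g).
Proof.
move=> Lf Lg; have L1 := L2D Lf Lg; have L3 := L2B Lf Lg.
have im h (tau : {finite_measure set RB -> \bar R}) : L2 h ->
    tau.-integrable D (EFin \o (fun m => mean E (sqrt_defect m) h)).
  move=> Lh; have -> : (fun m => mean E (sqrt_defect m) h) =
      (fun m => \int[finite_nu E Lh]_(x in D) k (m, x)).
    by apply/funext => m; exact: mean_restrict.
  apply: (integrable_swapped (finite_nu E Lh) tau mD measurable_sqrt_defect2).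
    by move=> z; exact: sqrt_defect_ge0.
  by move=> z; exact: sqrt_defect_le1.
rewrite {1}/polar !charge_integralE /polar.
have ib tau := integrableB mD (im _ tau L1) (im _ tau L3).
rewrite (RintegralZl 4^-1 mD (ib (cpos al))) (RintegralZl 4^-1 mD (ib (cneg al))).
rewrite (RintegralB mD (im _ (cpos al) L1) (im _ (cpos al) L3)).
rewrite (RintegralB mD (im _ (cneg al) L1) (im _ (cneg al) L3)).
by move: (Rintegral (cpos al)) (Rintegral (cneg al)) => F G; ring.
Qed.

Variables p q : R.
Hypothesis p0 : 0 < p.
Hypothesis q0 : 0 < q.
Hypothesis pq : p^-1 + q^-1 = 1.
Local Notation Lp := (in_Lp mu p%:E).
Local Notation Lq := (in_Lp mu q%:E).
Local Notation norm_p f := (fine (cLnorm mu p%:E f)).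
Local Notation norm_q g := (fine (cLnorm mu q%:E g)).
Hypothesis resolvent_bound : forall kappa x y f g, 0 < kappa ->
  x ^+ 2 + y ^+ 2 = 1 -> L2 f -> Lp f -> L2 g -> Lq g ->
  x * polar (mean E (rker kappa)) f g +
  y * polar (mean E (rker kappa)) f (fun z => 'i%C * g z) <= norm_p f * norm_q g.

Lemma measurable_mean h : L2 h ->
  measurable_fun [set: RB] (fun m : RB => mean E (sqrt_defect m) h).
Proof.
move=> Lh; have -> : (fun m : RB => mean E (sqrt_defect m) h) =
    (fun m : RB => \int[finite_nu E Lh]_(x in D) k (m, x)).
  by apply/funext => m; exact: mean_restrict.
have mks := measurableT_comp measurable_sqrt_defect2
  (measurable_fun_pair (@measurable_snd _ _ RB RB) (@measurable_fst _ _ RB RB)).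
apply: (measurable_slice_integral mD mks) => z; first exact: sqrt_defect_ge0.
Qed.

Lemma measurable_polar_mean f g : L2 f -> L2 g ->
  measurable_fun [set: RB] (fun m : RB => polar (mean E (sqrt_defect m)) f g).
Proof.
move=> Lf Lg; apply: measurable_funM => //.
by apply: measurable_funB; apply: measurable_mean; [exact: L2D|exact: L2B].
Qed.

Lemma unit_direction_le (P Q B : R) : 0 <= B ->
  (forall x y, x ^+ 2 + y ^+ 2 = 1 -> x * P + y * Q <= B) -> P ^+ 2 + Q ^+ 2 <= B ^+ 2.
Proof.
move=> B0 h; have s0 : 0 <= P ^+ 2 + Q ^+ 2 by rewrite addr_ge0 ?sqr_ge0.
have [->|sN0] := eqVneq (P ^+ 2 + Q ^+ 2) 0; first exact: sqr_ge0.
pose r := Num.sqrt (P ^+ 2 + Q ^+ 2).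
have r2 : r ^+ 2 = P ^+ 2 + Q ^+ 2 by exact: sqr_sqrtr.
have r0 : 0 < r by rewrite sqrtr_gt0 lt_def sN0.
have rN0 : r != 0 by rewrite gt_eqF.
rewrite -r2 ler_pXn2r ?nnegrE ?(ltW r0)//.
have := h (P / r) (Q / r); rewrite !expr_div_n -mulrDl -r2 divff ?expf_neq0// => /(_ erefl).
by rewrite mulrAC [Q / r * Q]mulrAC -mulrDl -!expr2 -r2 expr2 mulfK.
Qed.

Lemma functional_calculus_pairing f g : L2 f -> Lp f -> L2 g -> Lq g ->
  ip (S f) g <= 2 * (norm_p f * norm_q g) * fine (cm_variation alpha D).
Proof.
move=> Lf Lpf Lg Lqg; have Lig := L2Z 'i%C Lg.
set B := 2 * _; set v := fine _.
have B0 : 0 <= B by rewrite !mulr_ge0// cLnorm_fine_ge0.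
have v0 : 0 <= v by rewrite fine_ge0// cm_variation_ge0.
have PQ m : polar (mean E (sqrt_defect m)) f g ^+ 2 +
    polar (mean E (sqrt_defect m)) f (fun z => 'i%C * g z) ^+ 2 <= B ^+ 2.
  apply: unit_direction_le => // x y xy.
  exact: (sqrt_defect_bound p0 q0 pq resolvent_bound m xy Lf Lpf Lg Lqg).
rewrite (S_polar Lf Lg).
have [Lp1 Lm1 Lp2 Lm2] := And4 (L2D Lf Lg) (L2B Lf Lg) (L2D Lf Lig) (L2B Lf Lig).
have -> : polar (fun h => ip (S h) h) f g =
    charge_integral (cm_re alpha) D (fun m => polar (mean E (sqrt_defect m)) f g).
  by rewrite -(charge_integral_polar _ Lf Lg) /polar (S_form Lp1).1 (S_form Lm1).1.
have -> : polar (fun h => ip (S h) (fun z => 'i%C * h z)) f (fun z => 'i%C * g z) =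
    charge_integral (cm_im alpha) D
      (fun m => polar (mean E (sqrt_defect m)) f (fun z => 'i%C * g z)).
  by rewrite -(charge_integral_polar _ Lf Lig) /polar (S_form Lp2).2 (S_form Lm2).2.
apply: (@ler_add_divn _ _ _ v) => // N N0.
have K0 : 0 < B + N%:R^-1 by rewrite ltr_wpDl// invr_gt0 ltr0n.
have := charge_pairing alpha mD (measurable_polar_mean Lf Lg) (measurable_polar_mean Lf Lig) K0.
rewrite mulrDl [N%:R^-1 * _]mulrC; apply => m; apply: (le_trans (PQ m)).
by rewrite ler_pXn2r// ?nnegrE ?(ltW K0)// lerDl invr_ge0.
Qed.

End FunctionalCalculus.

(** * Duality between L^p and L^q *)

Section Duality.
Context {d} {T : measurableType d} {R : realType}.
Variable mu : {measure set T -> \bar R}.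
Local Notation cfun := (T -> R[i]).
Local Notation L2 := (in_Lp mu 2%:E).
Local Notation ip := (ip mu).
Variables p q : R.
Hypothesis p0 : 0 < p.
Hypothesis q0 : 0 < q.
Hypothesis pq : p^-1 + q^-1 = 1.

Definition clip (k : nat) : set R := [set` `[k.+1%:R^-1, k.+1%:R]].

(** The extremal function for duality is F |F|^(p - 2). Restricted to
1 / (k + 1) <= |F| <= k + 1 its weight is bounded, so it is a legitimate test
function in L^2. *)
Definition dual_weight (k : nat) (r : R) : R := r `^ (p - 2) * \1_(clip k) r.

Lemma dual_weight_ge0 k r : 0 <= dual_weight k r.
Proof. by rewrite mulr_ge0// powR_ge0. Qed.

Lemma measurable_dual_weight k : measurable_fun [set: R] (dual_weight k).
Proof.
apply: measurable_funM; first exact: measurable_powR.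
by apply: measurable_indic; exact: measurable_itv.
Qed.

Lemma clip_gt0 k r : clip k r -> 0 < r.
Proof. by rewrite /clip/= in_itv/= => /andP[h _]; apply: lt_le_trans h; rewrite invr_gt0. Qed.

Lemma dual_weight_bounded k r : `|dual_weight k r| <= k.+1%:R `^ `|p - 2|.
Proof.
rewrite ger0_norm ?dual_weight_ge0// /dual_weight indicE.
have [|_] := boolP (r \in clip k); last by rewrite mulr0 powR_ge0.
rewrite inE => cr; have r0 := clip_gt0 cr; rewrite mulr1.
move: cr; rewrite /clip/= in_itv/= => /andP[r1 r2].
rewrite /powR !gt_eqF// ler_expR (le_trans (ler_norm _))// normrM ler_wpM2l//.
have rk : r^-1 <= k.+1%:R by rewrite -[leRHS]invrK lef_pV2 ?posrE ?invr_gt0.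
rewrite ler_norml; apply/andP; split; last by rewrite ler_ln ?posrE.
by rewrite lerNl -lnV ?posrE// ler_ln ?posrE ?invr_gt0.
Qed.

(** This is where q (p - 1) = p enters. *)
Lemma dual_weight_conj k r :
  (dual_weight k r * r) `^ q = dual_weight k r * r ^+ 2.
Proof.
rewrite /dual_weight indicE.
have [|_] := boolP (r \in clip k); last by rewrite mulr0 !mul0r powR0// gt_eqF.
rewrite inE => /clip_gt0 r0; rewrite !mulr1.
have -> : r `^ (p - 2) * r = r `^ (p - 1).
  by rewrite -{2}(powRr1 (ltW r0)) -powRD ?(gt_eqF r0) ?implybT//; congr (_ `^ _); ring.
rewrite -(powR_mulrn 2 (ltW r0)) -powRrM -powRD ?(gt_eqF r0) ?implybT//; congr (_ `^ _).
have : q * p * (p^-1 + q^-1) = q * p by rewrite pq mulr1.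
have -> : q * p * (p^-1 + q^-1) = q + p by field; rewrite !gt_eqF.
by move=> e; rewrite subrK mulrBl mul1r mulrC -e addrAC subrr add0r.
Qed.

Lemma dual_weight_cvg r : 0 <= r ->
  (fun k => dual_weight k r * r ^+ 2) @ \oo --> r `^ p.
Proof.
rewrite le_eqVlt => /predU1P[<-|r0].
  by rewrite powR0 ?gt_eqF//; apply: cvg_seq_eq (cvg_cst 0) => k; rewrite expr0n mulr0.
apply: cvg_near_cst.
exists (maxn (Num.bound r) (Num.bound r^-1)) => // k /= kN.
rewrite /dual_weight indicE mem_set ?mulr1; last first.
  rewrite /clip/= in_itv/=; apply/andP; split.
    rewrite -[leRHS]invrK lef_pV2 ?posrE ?invr_gt0//.
    have ri : 0 <= r^-1 by rewrite invr_ge0 ltW.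
    apply: (le_trans (ltW (archi_boundP ri))); rewrite ler_nat.
    exact: leq_trans (leq_trans (leq_maxr _ _) kN) (leqnSn _).
  apply: (le_trans (ltW (archi_boundP (ltW r0)))); rewrite ler_nat.
  exact: leq_trans (leq_trans (leq_maxl _ _) kN) (leqnSn _).
rewrite -(powR_mulrn 2 (ltW r0)) -powRD ?(gt_eqF r0) ?implybT//.
by rewrite subrK.
Qed.

(** For g = F |F|^(p - 2) on the truncated set, I = <F, g> satisfies
I <= C I^(1 / q), hence I <= C^p; Fatou's lemma removes the truncation. *)
Lemma cLnorm_dual (F : cfun) (C : R) : 0 <= C -> L2 F ->
  (forall g, L2 g -> in_Lp mu q%:E g -> ip F g <= C * fine (cLnorm mu q%:E g)) ->
  (cLnorm mu p%:E F <= C%:E)%E.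
Proof.
move=> C0 LF dual; have mF := measurable_normc (L2_cmeas LF).
pose psi k x := dual_weight k (normc (F x)).
have mpsi k : measurable_fun setT (psi k).
  exact: (measurableT_comp (measurable_dual_weight k) mF).
pose h k x := psi k x * normc (F x) ^+ 2.
have mh k : measurable_fun setT (h k).
  by apply: measurable_funM => //; exact: measurable_funX.
have h0 k x : 0 <= h k x by rewrite mulr_ge0 ?sqr_ge0// dual_weight_ge0.
have bound k : (\int[mu]_x (h k x)%:E <= (C `^ p)%:E)%E.
  pose g x := (psi k x)%:C * F x.
  have [Lg _] := bounded_mul_L2 (mpsi k) (fun x => dual_weight_bounded k _) LF.
  have hE x : h k x = rdot (F x) (g x) by rewrite rdotC rdotZl -sqr_normc.
  have IE : (\int[mu]_x (h k x)%:E)%E = (ip F g)%:E.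
    under eq_integral do rewrite hE.
    by rewrite /ip /Rintegral fineK//; apply: (integrable_fin_num measurableT);
      exact: integrable_rdot.
  have ip0 : 0 <= ip F g by rewrite -lee_fin -IE; apply: integral_ge0 => x _; rewrite lee_fin.
  have Nq : cLnorm mu q%:E g = ((ip F g) `^ q^-1)%:E.
    rewrite cLnormE -poweR_EFin -IE; congr (_ `^ _)%E; apply: eq_integral => x _; congr (_%:E).
    have normcR (a : R) : normc a%:C = `|a| by rewrite /normc/= expr0n addr0 sqrtr_sqr.
    by rewrite /g normcM normcR ger0_norm ?dual_weight_ge0// dual_weight_conj.
  have Lqg : in_Lp mu q%:E g by split; [exact: Lg.1|rewrite Nq ltry].
  have := dual _ Lg Lqg; rewrite Nq IE lee_fin [fine _]/=.
  move: (ip F g) ip0 => I I0 IC.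
  have [->|IN0] := eqVneq I 0; first exact: powR_ge0.
  have Ip : 0 < I by rewrite lt_def IN0.
  have IpC : I `^ p^-1 <= C.
    have -> : p^-1 = 1 - q^-1 by rewrite -pq addrK.
    rewrite powRD ?IN0 ?implybT// powRr1// powRN.
    by rewrite ler_pdivrMr ?powR_gt0.
  have -> : I = (I `^ p^-1) `^ p by rewrite -powRrM mulVf ?powRr1// gt_eqF.
  by apply: ge0_ler_powR; rewrite ?nnegrE ?powR_ge0// ltW.
have : (\int[mu]_x (normc (F x) `^ p)%:E <= (C `^ p)%:E)%E.
  apply: (fatou_ae mh) => //.
  - exact: measurable_normc_powR (L2_cmeas LF).
  - by move=> x; exact: powR_ge0.
  - by apply: aeW => x; exact: dual_weight_cvg (normc_ge0 _).
  by move=> e e0; apply: nearW => k; apply: (le_trans (bound k)); rewrite lee_fin lerDl ltW.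
move=> le; rewrite cLnormE.
have -> : C%:E = ((C `^ p)%:E `^ p^-1)%E.
  by rewrite poweR_EFin -powRrM divff ?powRr1// gt_eqF.
apply: gt0_ler_poweR => //.
- by rewrite invr_ge0 ltW.
- by rewrite in_itv/= leey andbT integral_ge0// => x _; rewrite lee_fin powR_ge0.
- by rewrite in_itv/= leey andbT lee_fin powR_ge0.
Qed.

End Duality.

(** * The multiplier theorem *)

Section MultiplierBound.
Variables (R : realType) (M : ptopologicalType) (n : nat).
Variables (A : set (chart R M n)) (Delta : (M -> R) -> M -> R) (V : M -> R).
Variable mu : {measure set (borel M) -> \bar R}.
Hypothesis hM : smooth_manifold A.
Hypothesis hDelta : diffusion_operator A Delta.
Hypothesis hV : forall x, V x <= 0.
Hypothesis hL : essentially_self_adjoint mu (schroedinger_core A Delta V).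
Variables (Phi : R -> R[i]) (alpha : complex_measure R).
Variable Phi_L : (borel M -> R[i]) -> borel M -> R[i].

Lemma schroedinger_multiplier_bound p f :
  (forall x, 0 <= x -> Phi x = cm_integral alpha `[0, +oo[
    (fun m => 1 - m / Num.sqrt (m ^+ 2 + x))) ->
  functional_calculus mu (opp_op (closure_op mu (schroedinger_core A Delta V)))
    `[0, +oo[ Phi Phi_L ->
  1 < p -> in_Lp mu 2%:E f -> in_Lp mu p%:E f ->
  (cLnorm mu p%:E (Phi_L f) <=
   2%:E * cm_variation alpha `[0%R, +oo[ * cLnorm mu p%:E f)%E.
Proof.
move=> hPhi [E [GE SPhi]] p1 Lf Lpf; pose q := p / (p - 1).
have p0 : 0 < p by exact: lt_trans p1.
have pm : 0 < p - 1 by rewrite subr_gt0.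
have q1 : 1 < q by rewrite ltr_pdivlMr// mul1r ltrBlDr ltrDl.
have q0 : 0 < q by exact: lt_trans q1.
have pq : p^-1 + q^-1 = 1 by rewrite /q; field; rewrite !gt_eqF.
have nu0 := nu_neg GE (@opp_clos_L2 _ _ _ _ _ _ _) (opp_clos_ge0 hM hDelta hV hL).
have mD : measurable (`[0%R, +oo[%classic : set (measurableTypeR R)) by exact: measurable_itv.
have vE : (fine (cm_variation alpha `[0%R, +oo[))%:E = cm_variation alpha `[0%R, +oo[.
  by rewrite fineK// ge0_fin_numE ?cm_variation_fin// cm_variation_ge0.
rewrite -vE -(cLnorm_fine Lpf) -!EFinM; apply: (cLnorm_dual p0 q0 pq).
- by rewrite !mulr_ge0 ?cLnorm_fine_ge0// fine_ge0// cm_variation_ge0.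
- exact: SPhi.1.1.
move=> g Lg Lqg.
have := functional_calculus_pairing nu0 hPhi SPhi p0 q0 pq _ Lf Lpf Lg Lqg.
move=> /(_ (fun kappa x y f g k0 xy Lf Lpf Lg Lqg => resolvent_bilinear_bound
  hM hDelta hV hL GE p1 q1 pq k0 xy Lf Lpf Lg Lqg)) h.
by apply: (le_trans h); rewrite le_eqVlt; apply/orP; left; apply/eqP; ring.
Qed.

End MultiplierBound.

Theorem theorem3p6 (R : realType) (M : ptopologicalType) (n : nat)
    (A : set (chart R M n)) (Delta : (M -> R) -> M -> R)
    (mu : {measure set (borel M) -> \bar R}) (V : M -> R)
    (hM : smooth_manifold A)
    (hDelta : diffusion_operator A Delta)
    (hsub : locally_subelliptic A Delta)
    (hmu : smooth_measure mu A)
    (hsym : symmetric_on_tests mu A Delta)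
    (hcomplete : complete_for (intrinsic_dist mu A Delta))
    (hdiff : nonexplosive_diffusion A Delta)
    (hV : smooth A V)
    (hV_le0 : forall x, V x <= 0)
    (hV_lb : exists b : R, forall x, b <= V x)
    (hL : essentially_self_adjoint mu (schroedinger_core A Delta V))
    (Phi : R -> R[i])
    (hPhi_borel : cmeasurable (`[0, +oo[ : set (measurableTypeR R)) Phi)
    (hPhi_bounded : exists K : R, forall x, 0 <= x -> normc (Phi x) <= K)
    (alpha : complex_measure R)
    (hPhi : forall x, 0 <= x ->
       Phi x = cm_integral alpha `[0, +oo[
                 (fun m => 1 - m / Num.sqrt (m ^+ 2 + x))) (* 0 / 0 = 0 *)
    (Phi_L : (borel M -> R[i]) -> borel M -> R[i])
    (hPhi_L : functional_calculus mu
       (opp_op (closure_op mu (schroedinger_core A Delta V)))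
       `[0, +oo[ Phi Phi_L)
    (p : R) (hp : 1 < p) :
  let pstar := Num.max p (p / (p - 1)) in
  (forall f, in_Lp mu 2%:E f -> in_Lp mu p%:E f ->
     (cLnorm mu p%:E (Phi_L f) <=
      (6 * (pstar - 1))%:E * cm_variation alpha `[0%R, +oo[
        * cLnorm mu p%:E f)%E) /\
  ((forall x, V x = 0) ->
   forall f, in_Lp mu 2%:E f -> in_Lp mu p%:E f ->
     (cLnorm mu p%:E (Phi_L f) <=
      (2 * (pstar - 1))%:E * cm_variation alpha `[0%R, +oo[
        * cLnorm mu p%:E f)%E).

Proof.
move=> pstar.
have pstar2 : 2 <= pstar.
  have p10 : 0 < p - 1 by rewrite subr_gt0.
  rewrite /pstar le_max ler_pdivlMr// -implyNb -ltNge; apply/implyP; move: hp; lra.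
have bound (C : R) f : 2 <= C -> in_Lp mu 2%:E f -> in_Lp mu p%:E f ->
    (cLnorm mu p%:E (Phi_L f) <=
      C%:E * cm_variation alpha `[0%R, +oo[ * cLnorm mu p%:E f)%E.
  move=> C2 Lf Lpf.
  apply: (le_trans (schroedinger_multiplier_bound hM hDelta hV_le0 hL hPhi hPhi_L hp Lf Lpf)).
  apply: lee_wpmul2r; first exact: cLnorm_ge0.
  apply: lee_wpmul2r; last by rewrite lee_fin.
  by apply: cm_variation_ge0; exact: measurable_itv.
split=> [|_] f; apply: bound; move: pstar2; lra.
Qed.
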